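(* Let $F:\mathcal H\to\mathcal K$ be a frame operator and let $\{H_r\}$ be a path of self-adjoint operators, $H_r=H_0+V_r$, $V_r=F^*J_rF$, where each $J_r$ is a bounded self-adjoint operator on $\mathcal K$, $J_0=0$, and $r\mapsto J_r\in\mathcal B(\mathcal K)$ is continuous and piecewise real-analytic. For any $\lambda\in\Lambda(H_r;F)\cap\Lambda(H_0;F)$ the densely defined form $w_\pm(\lambda;H_r,H_0)$ on $\mathfrak h_\lambda(H_r)\times\mathfrak h_\lambda(H_0)$ given by $$w_\pm(\lambda;H_r,H_0)\big(\mathcal E_\lambda(H_r)f,\mathcal E_\lambda(H_0)g\big)=\langle f,\mathfrak a_\pm(\lambda;H_r,H_0)g\rangle_{1,-1},\qquad f,g\in\mathcal H_1,$$ is well-defined, and it is bounded with norm $\le1$.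
   Context: Inner products are linear in the second variable; $R_z(H)=(H-z)^{-1}$; $\operatorname{Im}T=(T-T^* )/2i$. $\mathcal H,\mathcal K$ are complex separable Hilbert spaces. Piecewise real-analytic: there is an increasing sequence $(r_j)$ without finite accumulation points such that $J$ restricted to each $[r_{j-1},r_j]$ extends analytically in norm to a neighbourhood of it. Frame: $F=\sum_j\kappa_j\langle\varphi_j,\cdot\rangle\psi_j$, with $(\kappa_j)\in\ell_2$ a decreasing sequence of positive numbers, $(\varphi_j)$, $(\psi_j)$ orthonormal bases of $\mathcal H$, $\mathcal K$. $|F|=\sqrt{F^*F}$. For $\alpha=\pm1$, $\mathcal H_\alpha$ is the completion of $\operatorname{span}\{\varphi_j\}$ in the norm $\||F|^{-\alpha}f\|$; $\mathcal H_1\subset\mathcal H\subset\mathcal H_{-1}$, and $\langle\cdot,\cdot\rangle_{1,-1}$ is the pairing extending $\langle\cdot,\cdot\rangle$. $\Lambda(H;F)$ is the set of $\lambda\in\mathbb R$ such that, as $y\to0^+$, $FR_{\lambda+iy}(H)F^*$ converges in operator norm and $F\operatorname{Im}R_{\lambda+iy}(H)F^*$ converges in trace-class norm. Evaluation operator: for $\lambda\in\Lambda(H;F)$ let $\phi(\lambda)=\frac1\pi\big(\kappa_i\kappa_j\langle\varphi_i,\operatorname{Im}R_{\lambda+i0}(H)\varphi_j\rangle\big)_{i,j}$ (entries being limits as $y\to0^+$), a non-negative trace-class operator on $\ell_2$, $\eta(\lambda)=\sqrt{\phi(\lambda)}$, and $\eta_j(\lambda)\in\ell_2$ the $j$-th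 column of $\eta(\lambda)$. Then $\mathcal E_\lambda(H):\mathcal H_1\to\ell_2$ is the Hilbert–Schmidt operator $\sum_j\beta_j\kappa_j\varphi_j\mapsto\sum_j\beta_j\eta_j(\lambda)$, $(\beta_j)\in\ell_2$, and $\mathfrak h_\lambda(H)\subset\ell_2$ is the closure of its range. $\mathfrak a_\pm(\lambda;H_r,H_0):\mathcal H_1\to\mathcal H_{-1}$ is the limit, as $y\to0^+$, in the trace-class norm of operators $\mathcal H_1\to\mathcal H_{-1}$, of $\frac y\pi R_{\lambda\mp iy}(H_r)R_{\lambda\pm iy}(H_0)$ (this limit exists for $\lambda\in\Lambda(H_r;F)\cap\Lambda(H_0;F)$). *)

(* Defs.v *)
From Stdlib Require Import Reals Lra Lia ZArith.
From Stdlib Require Import ClassicalEpsilon FunctionalExtensionality.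
From Stdlib Require Import PropExtensionality ProofIrrelevance.
From Coquelicot Require Import Coquelicot.

Open Scope R_scope.

Record HilbertSpace : Type := MkHilbertSpace {
  hs_space :> CompleteNormedModule C_AbsRing;
  inner : hs_space -> hs_space -> C;
  inner_plus_r : forall x y z,
    inner x (plus y z) = (inner x y + inner x z)%C;
  inner_scal_r : forall (a : C) x y,
    inner x (scal a y) = (a * inner x y)%C;
  inner_conj : forall x y, inner y x = Cconj (inner x y);
  inner_norm : forall x, inner x x = RtoC (norm x ^ 2)
}.

Arguments inner {_} _ _.

Definition square_summable (u : nat -> C) : Prop :=
  ex_series (fun n => Cmod (u n) ^ 2).

Definition l2_carrier : Type := {u : nat -> C | square_summable u}.

Definition l2_coord (u : l2_carrier) : nat -> C := proj1_sig u.

Lemma l2_ext (u v : l2_carrier) :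
  (forall n, l2_coord u n = l2_coord v n) -> u = v.
Proof.
destruct u as [u hu], v as [v hv]; simpl; intros h.
assert (e : u = v) by now apply functional_extensionality.
subst v; f_equal; apply proof_irrelevance.
Qed.

Definition sqsum (u : nat -> C) (n : nat) : R :=
  sum_n (fun k => Cmod (u k) ^ 2) n.

Lemma sqsum_S u n : sqsum u (S n) = sqsum u n + Cmod (u (S n)) ^ 2.
Proof. unfold sqsum; now rewrite sum_Sn. Qed.

Lemma sqsum_0 u : sqsum u 0 = Cmod (u 0%nat) ^ 2.
Proof. unfold sqsum; now rewrite sum_O. Qed.

Lemma sqsum_ge0 u n : 0 <= sqsum u n.
Proof.
induction n as [|n IH]; [rewrite sqsum_0|rewrite sqsum_S];
  [|pose proof (pow2_ge_0 (Cmod (u (S n))))]; try apply pow2_ge_0; lra.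
Qed.

Lemma sqsum_mono u n : sqsum u n <= sqsum u (S n).
Proof.
rewrite sqsum_S; pose proof (pow2_ge_0 (Cmod (u (S n)))); lra.
Qed.

Lemma sqsum_is_lim u : square_summable u ->
  is_lim_seq (sqsum u) (Series (fun n => Cmod (u n) ^ 2)).
Proof. intros h; exact (Series_correct _ h). Qed.

Lemma sqsum_le_Series u n : square_summable u ->
  sqsum u n <= Series (fun n => Cmod (u n) ^ 2).
Proof.
intros h.
apply (is_lim_seq_incr_compare (sqsum u) _ (sqsum_is_lim u h)).
intros k; apply sqsum_mono.
Qed.

Lemma square_summable_bound u M : (forall n, sqsum u n <= M) ->
  square_summable u /\ Series (fun n => Cmod (u n) ^ 2) <= M.
Proof.
intros h.
assert (hs : square_summable u).
{ destruct (ex_finite_lim_seq_incr (sqsum u) M (sqsum_mono u) h) as [l hl].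
  exists l; exact hl. }
split; [exact hs|].
assert (H := is_lim_seq_le (sqsum u) (fun _ => M) _ _ h
  (sqsum_is_lim u hs) (is_lim_seq_const M)).
exact H.
Qed.

Lemma Cmod_pair_sqrt (a b : R) : 0 <= a ->
  Cmod (sqrt a, b) = sqrt (a + b ^ 2).
Proof.
intros ha; unfold Cmod; simpl fst; simpl snd.
f_equal; rewrite <- Rsqr_pow2, Rsqr_sqrt; auto.
Qed.

Lemma sqsum_minkowski u v n :
  sqrt (sqsum (fun k => u k + v k)%C n) <= sqrt (sqsum u n) + sqrt (sqsum v n).
Proof.
induction n as [|n IH].
- rewrite !sqsum_0, <- !Rsqr_pow2, !sqrt_Rsqr; try apply Cmod_ge_0.
  apply Cmod_triangle.
- rewrite !sqsum_S, <- !Cmod_pair_sqrt; try apply sqsum_ge0.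
  eapply Rle_trans; [|apply (Cmod_triangle (sqrt (sqsum u n), Cmod (u (S n)))
     (sqrt (sqsum v n), Cmod (v (S n))))].
  unfold Cmod at 1 3; simpl fst; simpl snd.
  apply sqrt_le_1_alt, Rplus_le_compat; apply pow_incr; split;
    try apply sqrt_pos; try apply Cmod_ge_0; auto.
  apply Cmod_triangle.
Qed.

Lemma sqsum_le_pow u n M : 0 <= M -> sqrt (sqsum u n) <= M -> sqsum u n <= M ^ 2.
Proof.
intros hM h; rewrite <- (pow2_sqrt (sqsum u n)) by apply sqsum_ge0.
apply pow_incr; split; [apply sqrt_pos|exact h].
Qed.

Definition seq_norm (u : nat -> C) : R :=
  sqrt (Series (fun n => Cmod (u n) ^ 2)).

Lemma sqrt_sqsum_le u n : square_summable u -> sqrt (sqsum u n) <= seq_norm u.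
Proof. intros h; apply sqrt_le_1_alt, sqsum_le_Series, h. Qed.

Lemma seq_norm_bound u M : 0 <= M -> (forall n, sqrt (sqsum u n) <= M) ->
  square_summable u /\ seq_norm u <= M.
Proof.
intros hM h.
destruct (square_summable_bound u (M ^ 2)) as [h1 h2].
{ intros n; apply sqsum_le_pow; auto. }
split; [exact h1|]; unfold seq_norm.
rewrite <- (sqrt_pow2 M) by exact hM.
apply sqrt_le_1_alt, h2.
Qed.

Lemma square_summable_plus u v : square_summable u -> square_summable v ->
  square_summable (fun n => u n + v n)%C
  /\ seq_norm (fun n => u n + v n)%C <= seq_norm u + seq_norm v.
Proof.
intros hu hv; apply seq_norm_bound.
- apply Rplus_le_le_0_compat; apply sqrt_pos.
- intros n; eapply Rle_trans; [apply sqsum_minkowski|].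
  apply Rplus_le_compat; apply sqrt_sqsum_le; auto.
Qed.

Lemma square_summable_scal (a : C) u : square_summable u ->
  square_summable (fun n => a * u n)%C
  /\ seq_norm (fun n => a * u n)%C = Cmod a * seq_norm u.
Proof.
intros hu.
assert (e : forall n, Cmod (a * u n) ^ 2 = Cmod a ^ 2 * Cmod (u n) ^ 2).
{ intros n; rewrite Cmod_mult; ring. }
split.
- apply (ex_series_ext (fun n => Cmod a ^ 2 * Cmod (u n) ^ 2)).
  + intros n; symmetry; apply e.
  + apply (ex_series_scal_l (V := R_NormedModule) (Cmod a ^ 2)); exact hu.
- unfold seq_norm; rewrite (Series_ext _ _ e), Series_scal_l.
  rewrite sqrt_mult_alt by apply pow2_ge_0.
  rewrite sqrt_pow2 by apply Cmod_ge_0; reflexivity.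
Qed.

Lemma square_summable_finite (u : nat -> C) (N : nat) :
  (forall n, (N < n)%nat -> u n = 0) -> square_summable u.
Proof.
intros h.
apply (square_summable_bound u (sqsum u N)); intros n.
assert (mono : forall p q, (p <= q)%nat -> sqsum u p <= sqsum u q).
{ intros p q hpq; induction hpq; [lra|].
  eapply Rle_trans; [eassumption|apply sqsum_mono]. }
destruct (le_lt_dec n N) as [hn|hn]; [now apply mono|].
induction hn as [|m hm IH]; rewrite sqsum_S, h by lia;
  rewrite Cmod_0; [|]; simpl; lra.
Qed.

Definition l2_zero : l2_carrier :=
  exist square_summable (fun _ => 0 : C)
    (square_summable_finite (fun _ => 0 : C) 0 (fun _ _ => eq_refl)).

Definition l2_plus (u v : l2_carrier) : l2_carrier :=
  exist square_summable (fun n => l2_coord u n + l2_coord v n)%C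
    (proj1 (square_summable_plus _ _ (proj2_sig u) (proj2_sig v))).

Definition l2_scal (a : C) (u : l2_carrier) : l2_carrier :=
  exist square_summable (fun n => a * l2_coord u n)%C
    (proj1 (square_summable_scal a _ (proj2_sig u))).

Definition l2_opp (u : l2_carrier) : l2_carrier := l2_scal (RtoC (-1)) u.

Definition l2_norm (u : l2_carrier) : R := seq_norm (l2_coord u).

Definition l2_AbelianMonoid_mixin : AbelianMonoid.mixin_of l2_carrier.
Proof.
apply (AbelianMonoid.Mixin _ l2_plus l2_zero); intros; apply l2_ext;
  intros n; simpl; ring.
Defined.

Definition l2_AbelianMonoid : AbelianMonoid :=
  AbelianMonoid.Pack _ l2_AbelianMonoid_mixin l2_carrier.

Definition l2_AbelianGroup_mixin : AbelianGroup.mixin_of l2_AbelianMonoid.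
Proof.
apply (AbelianGroup.Mixin l2_AbelianMonoid l2_opp); intros; apply l2_ext; intros n; simpl.
change (l2_coord x n + RtoC (-1) * l2_coord x n = 0)%C.
apply injective_projections; simpl; ring.
Defined.

Definition l2_AbelianGroup : AbelianGroup :=
  AbelianGroup.Pack _
    (AbelianGroup.Class _ l2_AbelianMonoid_mixin l2_AbelianGroup_mixin)
    l2_carrier.

Definition l2_ModuleSpace_mixin :
  ModuleSpace.mixin_of C_Ring l2_AbelianGroup.
Proof.
apply (ModuleSpace.Mixin C_Ring l2_AbelianGroup l2_scal); intros;
  apply l2_ext; intros n; simpl.
- change (x * (y * l2_coord u n) = (x * y) * l2_coord u n)%C; ring.
- change (RtoC 1 * l2_coord u n = l2_coord u n)%C; ring.
- change (x * (l2_coord u n + l2_coord v n)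
    = x * l2_coord u n + x * l2_coord v n)%C; ring.
- change ((x + y) * l2_coord u n = x * l2_coord u n + y * l2_coord u n)%C; ring.
Defined.

Definition l2_minus (u v : l2_carrier) : l2_carrier := l2_plus u (l2_opp v).

Lemma l2_norm_triangle u v : l2_norm (l2_plus u v) <= l2_norm u + l2_norm v.
Proof.
apply (square_summable_plus _ _ (proj2_sig u) (proj2_sig v)).
Qed.

Lemma l2_norm_scal a u : l2_norm (l2_scal a u) = Cmod a * l2_norm u.
Proof. apply (square_summable_scal a _ (proj2_sig u)). Qed.

Lemma l2_norm_ge0 u : 0 <= l2_norm u.
Proof. apply sqrt_pos. Qed.

Lemma l2_coord_le_norm u n : Cmod (l2_coord u n) <= l2_norm u.
Proof.
apply Rle_trans with (sqrt (sqsum (l2_coord u) n));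
  [|apply sqrt_sqsum_le, (proj2_sig u)].
rewrite <- (sqrt_pow2 (Cmod (l2_coord u n))) by apply Cmod_ge_0.
apply sqrt_le_1_alt; destruct n as [|n]; [rewrite sqsum_0; lra|].
rewrite sqsum_S; pose proof (sqsum_ge0 (l2_coord u) n); lra.
Qed.

Lemma l2_norm_eq0 u : l2_norm u = 0 -> u = l2_zero.
Proof.
intros h; apply l2_ext; intros n; simpl.
apply Cmod_eq_0, Rle_antisym; [rewrite <- h; apply l2_coord_le_norm|].
apply Cmod_ge_0.
Qed.

Lemma l2_norm_opp u : l2_norm (l2_opp u) = l2_norm u.
Proof.
unfold l2_opp; rewrite l2_norm_scal, Cmod_R, Rabs_left by lra; ring.
Qed.

Definition l2_ball (u : l2_carrier) (e : R) (v : l2_carrier) : Prop :=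
  l2_norm (l2_minus v u) < e.

Lemma l2_ball_center u (e : posreal) : l2_ball u e u.
Proof.
unfold l2_ball.
replace (l2_minus u u) with (l2_scal 0 u).
- rewrite l2_norm_scal, Cmod_0, Rmult_0_l; apply cond_pos.
- apply l2_ext; intros n; simpl.
  change (0 * l2_coord u n = l2_coord u n + RtoC (-1) * l2_coord u n)%C.
  apply injective_projections; simpl; ring.
Qed.

Lemma l2_ball_sym u v (e : R) : l2_ball u e v -> l2_ball v e u.
Proof.
unfold l2_ball; intros h; rewrite <- l2_norm_opp.
replace (l2_opp (l2_minus u v)) with (l2_minus v u); [exact h|].
apply l2_ext; intros n; simpl.
change (l2_coord v n + RtoC (-1) * l2_coord u n =
  RtoC (-1) * (l2_coord u n + RtoC (-1) * l2_coord v n))%C.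
apply injective_projections; simpl; ring.
Qed.

Lemma l2_ball_triangle u v w (e1 e2 : R) :
  l2_ball u e1 v -> l2_ball v e2 w -> l2_ball u (e1 + e2) w.
Proof.
unfold l2_ball; intros h1 h2.
replace (l2_minus w u) with (l2_plus (l2_minus v u) (l2_minus w v)).
- eapply Rle_lt_trans; [apply l2_norm_triangle|lra].
- apply l2_ext; intros n; simpl.
  change ((l2_coord v n + RtoC (-1) * l2_coord u n) +
    (l2_coord w n + RtoC (-1) * l2_coord v n) =
    l2_coord w n + RtoC (-1) * l2_coord u n)%C.
  apply injective_projections; simpl; ring.
Qed.

Definition l2_UniformSpace_mixin : UniformSpace.mixin_of l2_carrier :=
  UniformSpace.Mixin _ l2_zero l2_ball l2_ball_center l2_ball_sym
    l2_ball_triangle.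

Definition l2_UniformSpace : UniformSpace :=
  UniformSpace.Pack _ l2_UniformSpace_mixin l2_carrier.

Definition l2_NormedModuleAux : NormedModuleAux C_AbsRing :=
  NormedModuleAux.Pack C_AbsRing l2_carrier
    (NormedModuleAux.Class C_AbsRing _
      (ModuleSpace.Class C_Ring _
        (AbelianGroup.class l2_AbelianGroup) l2_ModuleSpace_mixin)
      l2_UniformSpace_mixin) l2_carrier.

Definition l2_NormedModule_mixin :
  NormedModule.mixin_of C_AbsRing l2_NormedModuleAux.
Proof.
apply (NormedModule.Mixin C_AbsRing l2_NormedModuleAux l2_norm 1).
- apply l2_norm_triangle.
- intros a u; apply Req_le; exact (l2_norm_scal a u).
- intros u v e h; exact h.
- intros u v e h; rewrite Rmult_1_l; exact h.
- apply l2_norm_eq0.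
Defined.

Lemma l2_limit_of_fast_cauchy (x : nat -> l2_carrier) :
  (forall n m, (n <= m)%nat -> l2_norm (l2_minus (x m) (x n)) <= 2 * (/ 2) ^ n) ->
  exists z, forall n, l2_norm (l2_minus z (x n)) <= 2 * (/ 2) ^ n.
Proof.
intros hx.
assert (hpos : forall n, 0 < (/ 2) ^ n) by (intros n; apply pow_lt; lra).
assert (hsmall : forall eps : posreal, exists N, 2 * (/ 2) ^ N < eps).
{ intros eps.
  assert (h2 : 0 < eps / 2) by (pose proof (cond_pos eps); lra).
  destruct (pow_lt_1_zero (/ 2) (ltac:(rewrite Rabs_pos_eq; lra)) _ h2)
    as [N hN].
  exists N; specialize (hN N (le_n N)).
  rewrite Rabs_pos_eq in hN by (apply Rlt_le, hpos); lra. }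
assert (hcoord : forall k n m, (n <= m)%nat ->
  Cmod (l2_coord (x m) k - l2_coord (x n) k) <= 2 * (/ 2) ^ n).
{ intros k n m hnm; eapply Rle_trans; [|apply (hx n m hnm)].
  eapply Rle_trans; [|apply (l2_coord_le_norm _ k)]; apply Req_le.
  f_equal; change (l2_coord (x m) k - l2_coord (x n) k =
    l2_coord (x m) k + RtoC (-1) * l2_coord (x n) k)%C.
  apply injective_projections; simpl; ring. }
assert (hre : forall k, ex_finite_lim_seq (fun n => fst (l2_coord (x n) k))).
{ intros k; apply ex_lim_seq_cauchy_corr; intros eps.
  destruct (hsmall (mkposreal (eps / 2) (is_pos_div_2 eps))) as [N hN].
  simpl in hN; exists N; intros n m hn hm.
  pose proof (hcoord k N n hn) as a1; pose proof (hcoord k N m hm) as a2.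
  pose proof (Rle_trans _ _ _ (Rmax_l _ _) (Rmax_Cmod
    (l2_coord (x n) k - l2_coord (x N) k)%C)) as b1.
  pose proof (Rle_trans _ _ _ (Rmax_l _ _) (Rmax_Cmod
    (l2_coord (x m) k - l2_coord (x N) k)%C)) as b2.
  simpl in b1, b2; apply Rabs_def1;
    apply Rabs_le_between in b1; apply Rabs_le_between in b2; lra. }
assert (him : forall k, ex_finite_lim_seq (fun n => snd (l2_coord (x n) k))).
{ intros k; apply ex_lim_seq_cauchy_corr; intros eps.
  destruct (hsmall (mkposreal (eps / 2) (is_pos_div_2 eps))) as [N hN].
  simpl in hN; exists N; intros n m hn hm.
  pose proof (hcoord k N n hn) as a1; pose proof (hcoord k N m hm) as a2.
  pose proof (Rle_trans _ _ _ (Rmax_r _ _) (Rmax_Cmod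
    (l2_coord (x n) k - l2_coord (x N) k)%C)) as b1.
  pose proof (Rle_trans _ _ _ (Rmax_r _ _) (Rmax_Cmod
    (l2_coord (x m) k - l2_coord (x N) k)%C)) as b2.
  simpl in b1, b2; apply Rabs_def1;
    apply Rabs_le_between in b1; apply Rabs_le_between in b2; lra. }
pose (z := fun k => (real (Lim_seq (fun n => fst (l2_coord (x n) k))),
  real (Lim_seq (fun n => snd (l2_coord (x n) k)))) : C).
assert (hlim : forall n k, is_lim_seq
  (fun m => sqsum (l2_coord (l2_minus (x m) (x n))) k)
  (sqsum (fun j => z j - l2_coord (x n) j)%C k)).
{ intros n.
  assert (term : forall j, is_lim_seq
    (fun m => Cmod (l2_coord (l2_minus (x m) (x n)) j) ^ 2)
    (Cmod (z j - l2_coord (x n) j) ^ 2)).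
  { intros j.
    assert (sq : forall c : C, Cmod c ^ 2 = fst c * fst c + snd c * snd c).
    { intros c; unfold Cmod; rewrite pow2_sqrt; [ring|].
      apply Rplus_le_le_0_compat; apply pow2_ge_0. }
    rewrite sq; eapply is_lim_seq_ext.
    { intros m; symmetry; apply sq. }
    pose proof (Lim_seq_correct' _ (hre j)) as l1.
    pose proof (Lim_seq_correct' _ (him j)) as l2.
    assert (d1 : is_lim_seq
      (fun m => fst (l2_coord (l2_minus (x m) (x n)) j))
      (fst (z j - l2_coord (x n) j)%C)).
    { eapply is_lim_seq_ext; [intros m; symmetry|
        apply (is_lim_seq_minus' _ (fun _ => fst (l2_coord (x n) j)) _ _ l1);
        apply is_lim_seq_const].
      simpl; unfold Rminus; ring. }
    assert (d2 : is_lim_seq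
      (fun m => snd (l2_coord (l2_minus (x m) (x n)) j))
      (snd (z j - l2_coord (x n) j)%C)).
    { eapply is_lim_seq_ext; [intros m; symmetry|
        apply (is_lim_seq_minus' _ (fun _ => snd (l2_coord (x n) j)) _ _ l2);
        apply is_lim_seq_const].
      simpl; unfold Rminus; ring. }
    apply is_lim_seq_plus'; apply is_lim_seq_mult'; assumption. }
  induction k as [|k IH].
  - rewrite sqsum_0; eapply is_lim_seq_ext; [|apply term].
    intros m; symmetry; apply sqsum_0.
  - rewrite sqsum_S; eapply is_lim_seq_ext; [|apply is_lim_seq_plus';
      [apply IH|apply term]].
    intros m; symmetry; apply sqsum_S. }
assert (hbound : forall n, square_summable (fun j => z j - l2_coord (x n) j)%C
  /\ seq_norm (fun j => z j - l2_coord (x n) j)%C <= 2 * (/ 2) ^ n).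
{ intros n; pose proof (hpos n); apply seq_norm_bound; [lra|].
  intros k; rewrite <- (sqrt_pow2 (2 * (/ 2) ^ n)) by lra.
  apply sqrt_le_1_alt.
  apply (is_lim_seq_le_loc _ (fun _ => (2 * (/ 2) ^ n) ^ 2) _
    (Finite ((2 * (/ 2) ^ n) ^ 2)) ltac:(exists n; intros m hm;
      apply sqsum_le_pow; [lra|]; eapply Rle_trans;
      [apply sqrt_sqsum_le, (proj2_sig (l2_minus (x m) (x n)))|apply (hx n m hm)])
    (hlim n k) (is_lim_seq_const _)). }
assert (hz : square_summable z).
{ replace z with (fun j => (z j - l2_coord (x 0%nat) j)
      + l2_coord (x 0%nat) j)%C.
  - apply square_summable_plus; [apply hbound|apply (proj2_sig (x 0%nat))].
  - apply functional_extensionality; intros j; ring. }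
exists (exist square_summable z hz); intros n.
replace (l2_norm (l2_minus (exist square_summable z hz) (x n)))
  with (seq_norm (fun j => z j - l2_coord (x n) j)%C); [apply hbound|].
unfold l2_norm; f_equal; apply functional_extensionality; intros j.
change (z j - l2_coord (x n) j = z j + RtoC (-1) * l2_coord (x n) j)%C.
apply injective_projections; simpl; ring.
Qed.

Lemma l2_complete (F : (l2_UniformSpace -> Prop) -> Prop) :
  ProperFilter F -> cauchy F ->
  exists z : l2_UniformSpace, forall eps : posreal, F (ball z eps).
Proof.
intros PF hF.
assert (hpos : forall n, 0 < (/ 2) ^ n) by (intros n; apply pow_lt; lra).
pose (x := fun n => proj1_sig (constructive_indefinite_description _
  (hF (mkposreal _ (hpos n))))).
assert (hx : forall n, F (ball (x n) ((/ 2) ^ n))).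
{ intros n; exact (proj2_sig (constructive_indefinite_description _
    (hF (mkposreal _ (hpos n))))). }
destruct (l2_limit_of_fast_cauchy x) as [z hz].
{ intros n m hnm.
  destruct (filter_ex _ (filter_and _ _ (hx n) (hx m))) as [w [h1 h2]].
  pose proof (l2_ball_triangle _ _ _ _ _ h1 (l2_ball_sym _ _ _ h2)) as h3.
  unfold l2_ball in h3; apply Rlt_le; eapply Rlt_le_trans; [exact h3|].
  assert ((/ 2) ^ m <= (/ 2) ^ n); [|lra].
  clear -hnm hpos; induction hnm as [|p _ IH]; [lra|].
  simpl; pose proof (hpos p); lra. }
exists z; intros eps.
assert (h3 : 0 < eps / 3) by (pose proof (cond_pos eps); lra).
destruct (pow_lt_1_zero (/ 2) (ltac:(rewrite Rabs_pos_eq; lra)) _ h3)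
  as [N hN].
specialize (hN N (le_n N)).
rewrite Rabs_pos_eq in hN by apply Rlt_le, hpos.
apply filter_imp with (2 := hx N); intros w hw.
pose proof (hz N) as hzN.
assert (hb : l2_ball z (2 * eps / 3) (x N)).
{ apply l2_ball_sym; unfold l2_ball; lra. }
pose proof (l2_ball_triangle _ _ _ _ _ hb hw) as h4.
unfold ball; simpl; unfold l2_ball in *; lra.
Qed.

Definition l2_lim (F : (l2_UniformSpace -> Prop) -> Prop) : l2_UniformSpace :=
  epsilon (inhabits l2_zero) (fun z => forall eps : posreal, F (l2_ball z eps)).

Definition l2_CompleteSpace_mixin : CompleteSpace.mixin_of l2_UniformSpace.
Proof.
apply (CompleteSpace.Mixin _ l2_lim).
- intros F PF hF; exact (epsilon_spec (inhabits l2_zero) _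
    (l2_complete F PF hF)).
- intros F1 F2 h12 h21.
  assert (e : F1 = F2).
  { apply functional_extensionality; intros P.
    apply propositional_extensionality; split; [apply h21|apply h12]. }
  subst F2; intros eps; apply ball_center.
Defined.

Definition l2_CompleteNormedModule : CompleteNormedModule C_AbsRing :=
  CompleteNormedModule.Pack C_AbsRing l2_carrier
    (CompleteNormedModule.Class C_AbsRing _
      (NormedModule.Class C_AbsRing _
        (NormedModuleAux.class C_AbsRing l2_NormedModuleAux)
        l2_NormedModule_mixin)
      l2_CompleteSpace_mixin) l2_carrier.

Definition l2_inner (u v : l2_carrier) : C :=
  (Series (fun n => fst (Cconj (l2_coord u n) * l2_coord v n)%C),
   Series (fun n => snd (Cconj (l2_coord u n) * l2_coord v n)%C)).

Lemma l2_inner_summable (u v : l2_carrier) :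
  ex_series (fun n => fst (Cconj (l2_coord u n) * l2_coord v n)%C) /\
  ex_series (fun n => snd (Cconj (l2_coord u n) * l2_coord v n)%C).
Proof.
assert (dom : forall n, Cmod (Cconj (l2_coord u n) * l2_coord v n)
  <= Cmod (l2_coord u n) ^ 2 + Cmod (l2_coord v n) ^ 2).
{ intros n; rewrite Cmod_mult, Cmod_conj.
  pose proof (Cmod_ge_0 (l2_coord u n)); pose proof (Cmod_ge_0 (l2_coord v n)).
  nra. }
assert (hs : ex_series
  (fun n => Cmod (l2_coord u n) ^ 2 + Cmod (l2_coord v n) ^ 2)).
{ apply (ex_series_plus (V := R_NormedModule));
    [apply (proj2_sig u)|apply (proj2_sig v)]. }
split; apply (ex_series_le (V := R_CompleteNormedModule)) with (2 := hs);
  intros n; (eapply Rle_trans; [|apply dom]);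
  (eapply Rle_trans; [|apply Rmax_Cmod]); [apply Rmax_l|apply Rmax_r].
Qed.

Lemma l2_inner_plus_r u v w :
  l2_inner u (l2_plus v w) = (l2_inner u v + l2_inner u w)%C.
Proof.
destruct (l2_inner_summable u v), (l2_inner_summable u w).
apply injective_projections; simpl; rewrite <- Series_plus by assumption;
  apply Series_ext; intros n; simpl; ring.
Qed.

Lemma l2_inner_scal_r (a : C) u v :
  l2_inner u (l2_scal a v) = (a * l2_inner u v)%C.
Proof.
destruct (l2_inner_summable u v) as [h1 h2].
apply injective_projections; simpl; rewrite <- !Series_scal_l.
- rewrite <- Series_minus by (apply (ex_series_scal_l (V := R_NormedModule));
    assumption).
  apply Series_ext; intros n; simpl; ring.
- rewrite <- Series_plus by (apply (ex_series_scal_l (V := R_NormedModule));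
    assumption).
  apply Series_ext; intros n; simpl; ring.
Qed.

Lemma l2_inner_conj u v : l2_inner v u = Cconj (l2_inner u v).
Proof.
apply injective_projections; simpl; [|rewrite <- Series_opp];
  apply Series_ext; intros n; simpl; ring.
Qed.

Lemma l2_inner_norm u : l2_inner u u = RtoC (l2_norm u ^ 2).
Proof.
apply injective_projections.
- change (Series (fun n => fst (Cconj (l2_coord u n) * l2_coord u n)%C)
    = sqrt (Series (fun n => Cmod (l2_coord u n) ^ 2)) ^ 2).
  rewrite pow2_sqrt.
  + apply Series_ext; intros n; unfold Cmod.
    rewrite pow2_sqrt by (apply Rplus_le_le_0_compat; apply pow2_ge_0).
    simpl; ring.
  + eapply Rle_trans; [apply (sqsum_ge0 (l2_coord u) 0)|].
    apply sqsum_le_Series, (proj2_sig u).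
- change (Series (fun n => snd (Cconj (l2_coord u n) * l2_coord u n)%C) = 0).
  rewrite <- (Rmult_0_l (Series (fun _ => 0))), <- Series_scal_l.
  apply Series_ext; intros n; simpl; ring.
Qed.

Definition l2 : HilbertSpace :=
  MkHilbertSpace l2_CompleteNormedModule l2_inner l2_inner_plus_r
    l2_inner_scal_r l2_inner_conj l2_inner_norm.

Definition l2_unit (j : nat) : l2 :=
  exist square_summable (fun n => if Nat.eqb n j then 1 : C else 0 : C)
    (square_summable_finite _ j (fun n h =>
      f_equal (fun b : bool => if b then 1 : C else 0 : C)
        (proj2 (Nat.eqb_neq n j) (Nat.neq_sym _ _ (Nat.lt_neq _ _ h))))).

(** A bounded operator is a function satisfying Coquelicot's [is_linear], which
    includes boundedness.  Objects determined by a defining property (adjoints,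
    square roots, resolvents, limits) are picked by [epsilon]. *)

Definition adjoint {X Y : HilbertSpace} (T : X -> Y) (y : Y) : X :=
  epsilon (inhabits zero) (fun x => forall u, inner x u = inner y (T u)).

Definition bounded_self_adjoint {X : HilbertSpace} (A : X -> X) : Prop :=
  is_linear A /\ forall x y, inner x (A y) = inner (A x) y.

(** In a complex space this already forces [A] to be self-adjoint. *)
Definition nonneg_operator {X : HilbertSpace} (A : X -> X) : Prop :=
  is_linear A /\ forall x, 0 <= Re (inner x (A x)) /\ Im (inner x (A x)) = 0.

Definition op_sqrt {X : HilbertSpace} (A : X -> X) : X -> X :=
  epsilon (inhabits (fun _ => zero))
    (fun B => nonneg_operator B /\ forall x, B (B x) = A x).

Definition op_abs {X Y : HilbertSpace} (T : X -> Y) : X -> X :=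
  op_sqrt (fun x => adjoint T (T x)).

Definition im_part {X : HilbertSpace} (T : X -> X) (x : X) : X :=
  scal (/ (2 * Ci))%C (minus (T x) (adjoint T x)).

Definition op_norm {X Y : HilbertSpace} (T : X -> Y) : Rbar :=
  Lub_Rbar (fun c => exists x : X, norm x <= 1 /\ c = norm (T x)).

Definition is_orthonormal_basis {X : HilbertSpace} (e : nat -> X) : Prop :=
  (forall i j, inner (e i) (e j) = if Nat.eqb i j then 1 : C else 0 : C) /\
  (forall x, is_series (fun j => scal (inner (e j) x) (e j)) x).

(** The trace of a non-negative operator does not depend on the basis; all the
    spaces considered below have a basis indexed by [nat]. *)
Definition trace {X : HilbertSpace} (A : X -> X) : Rbar :=
  let e := epsilon (inhabits (fun _ : nat => zero : X))
             is_orthonormal_basis in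
  Lim_seq (sum_n (fun j => Re (inner (e j) (A (e j))))).

Definition trace_norm {X Y : HilbertSpace} (T : X -> Y) : Rbar :=
  trace (op_abs T).

Definition op_limit {I : Type} {X Y : HilbertSpace}
    (F : (I -> Prop) -> Prop) (T : I -> X -> Y) (L : X -> Y) : Prop :=
  is_linear L /\
  forall eps : posreal,
    F (fun i => Rbar_lt (op_norm (fun x => minus (T i x) (L x))) eps).

Definition trace_limit {I : Type} {X Y : HilbertSpace}
    (F : (I -> Prop) -> Prop) (T : I -> X -> Y) (L : X -> Y) : Prop :=
  is_linear L /\
  forall eps : posreal,
    F (fun i => Rbar_lt (trace_norm (fun x => minus (T i x) (L x))) eps).

(** The values of [op_fun] outside [op_dom] are irrelevant. *)
Record operator (X : HilbertSpace) : Type := MkOperator {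
  op_dom : X -> Prop;
  op_fun :> X -> X
}.
Arguments MkOperator {X} _ _.
Arguments op_dom {X} _ _.
Arguments op_fun {X} _ _.

Definition subspace {X : HilbertSpace} (D : X -> Prop) : Prop :=
  D zero /\ (forall x y, D x -> D y -> D (plus x y)) /\
  (forall (a : C) x, D x -> D (scal a x)).

Definition set_closure {X : HilbertSpace} (D : X -> Prop) (x : X) : Prop :=
  forall eps : posreal, exists u, D u /\ norm (minus x u) < eps.

(** The last clause states that [T] and its adjoint have the same graph. *)
Definition self_adjoint {X : HilbertSpace} (T : operator X) : Prop :=
  subspace (op_dom T) /\
  (forall x y, op_dom T x -> op_dom T y -> T (plus x y) = plus (T x) (T y)) /\
  (forall (a : C) x, op_dom T x -> T (scal a x) = scal a (T x)) /\
  (forall x, set_closure (op_dom T) x) /\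
  (forall x z, (forall y, op_dom T y -> inner x (T y) = inner z y) <->
     (op_dom T x /\ T x = z)).

Definition resolvent {X : HilbertSpace} (T : operator X) (z : C) (x : X) : X :=
  epsilon (inhabits zero)
    (fun u => op_dom T u /\ minus (T u) (scal z u) = x).

Record frame (H K : HilbertSpace) : Type := MkFrame {
  kappa : nat -> R;
  phi : nat -> H;
  psi : nat -> K;
  frame_op :> H -> K;
  kappa_pos : forall j, 0 < kappa j;
  kappa_decr : forall j, kappa (S j) <= kappa j;
  kappa_l2 : ex_series (fun j => kappa j ^ 2);
  phi_basis : is_orthonormal_basis phi;
  psi_basis : is_orthonormal_basis psi;
  frame_op_series : forall f,
    is_series (fun j => scal (kappa j * inner (phi j) f)%C (psi j))
      (frame_op f)
}.
Arguments kappa {H K} _ _.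
Arguments phi {H K} _ _.
Arguments psi {H K} _ _.
Arguments frame_op {H K} _ _.

Definition in_span {X : HilbertSpace} (e : nat -> X) (f : X) : Prop :=
  exists (n : nat) (c : nat -> C), f = sum_n (fun j => scal (c j) (e j)) n.

(** The norm |||F|^{-alpha} f|| on span(phi_j), for alpha = -1 and alpha = 1. *)
Definition frame_norm_minus {H K : HilbertSpace} (F : frame H K) (f : H) : R :=
  norm (op_abs F f).

Definition frame_norm_plus {H K : HilbertSpace} (F : frame H K) (f : H) : R :=
  norm (epsilon (inhabits zero) (fun g : H => op_abs F g = f)).

(** [E], with the map [i], is a completion of the subspace [D] of [X] in the
    norm [N]. *)
Definition is_completion {X E : HilbertSpace}
    (D : X -> Prop) (N : X -> R) (i : X -> E) : Prop :=
  (forall f g, D f -> D g -> i (plus f g) = plus (i f) (i g)) /\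
  (forall (a : C) f, D f -> i (scal a f) = scal a (i f)) /\
  (forall f, D f -> norm (i f) = N f) /\
  (forall u, set_closure (fun v => exists f, D f /\ i f = v) u).

(** Completions are determined up to a unique isometric isomorphism; a [rigging]
    is any choice of H_1 and H_{-1}, with the continuous extensions of the
    inclusions and of the inner product from span(phi_j). *)
Record rigging {H K : HilbertSpace} (F : frame H K) : Type := MkRigging {
  H_plus : HilbertSpace;
  H_minus : HilbertSpace;
  i_plus : H -> H_plus;
  incl_plus : H_plus -> H;
  incl_minus : H -> H_minus;
  pairing : H_plus -> H_minus -> C;
  H_plus_completion :
    is_completion (in_span (phi F)) (frame_norm_plus F) i_plus;
  H_minus_completion :
    is_completion (in_span (phi F)) (frame_norm_minus F) incl_minus;
  incl_plus_linear : is_linear incl_plus;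
  incl_plus_span : forall f, in_span (phi F) f -> incl_plus (i_plus f) = f;
  incl_minus_linear : is_linear incl_minus;
  pairing_plus_l : forall u v w,
    pairing (plus u v) w = (pairing u w + pairing v w)%C;
  pairing_scal_l : forall (a : C) u w,
    pairing (scal a u) w = (Cconj a * pairing u w)%C;
  pairing_plus_r : forall u v w,
    pairing u (plus v w) = (pairing u v + pairing u w)%C;
  pairing_scal_r : forall (a : C) u w,
    pairing u (scal a w) = (a * pairing u w)%C;
  pairing_bounded : exists M : R, forall u w,
    Cmod (pairing u w) <= M * norm u * norm w;
  pairing_span : forall f g, in_span (phi F) f -> in_span (phi F) g ->
    pairing (i_plus f) (incl_minus g) = inner f g
}.
Arguments H_plus {H K F} _.
Arguments H_minus {H K F} _.
Arguments i_plus {H K F} _ _.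
Arguments incl_plus {H K F} _ _.
Arguments incl_minus {H K F} _ _.
Arguments pairing {H K F} _ _ _.

Definition perturbed {H K : HilbertSpace} (H0 : operator H) (F : frame H K)
    (J : K -> K) : operator H :=
  MkOperator (op_dom H0) (fun x => plus (H0 x) (adjoint F (J (F x)))).

Definition norm_continuous {K : HilbertSpace} (J : R -> K -> K) : Prop :=
  forall r, op_limit (locally r) J (J r).

Definition norm_analytic_at {K : HilbertSpace} (G : R -> K -> K) (s : R)
    : Prop :=
  exists (A : nat -> K -> K) (rho : posreal),
    (forall n, is_linear (A n)) /\
    forall t, Rabs (t - s) < rho ->
      op_limit eventually
        (fun N x => sum_n (fun n => scal (RtoC ((t - s) ^ n)) (A n x)) N)
        (G t).

(** The break points are indexed by [Z], so that the intervals between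
    consecutive ones cover the line. *)
Definition piecewise_analytic {K : HilbertSpace} (J : R -> K -> K) : Prop :=
  exists b : Z -> R,
    (forall j, b j < b (j + 1)%Z) /\
    (forall x, exists eps : posreal, forall j,
       b j = x \/ eps <= Rabs (b j - x)) /\
    (forall j, exists (G : R -> K -> K) (delta : posreal),
       (forall s, b (j - 1)%Z - delta < s < b j + delta ->
          norm_analytic_at G s) /\
       (forall s x, b (j - 1)%Z <= s <= b j -> G s x = J s x)).

Definition sandwiched {H K : HilbertSpace} (F : frame H K) (T : H -> H)
    (x : K) : K := F (T (adjoint F x)).

Definition in_Lambda {H K : HilbertSpace} (T : operator H) (F : frame H K)
    (lam : R) : Prop :=
  (exists L : K -> K, op_limit (at_right 0)
     (fun y => sandwiched F (resolvent T (lam, y))) L) /\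
  (exists L : K -> K, trace_limit (at_right 0)
     (fun y => sandwiched F (im_part (resolvent T (lam, y)))) L).

Definition phi_entry {H K : HilbertSpace} (T : operator H) (F : frame H K)
    (lam : R) (i j : nat) : C :=
  (/ PI * epsilon (inhabits (0 : C)) (fun l : C =>
     filterlim (fun y => kappa F i * kappa F j *
          inner (phi F i) (im_part (resolvent T (lam, y)) (phi F j)))%C
       (at_right 0) (locally l)))%C.

Definition phi_op {H K : HilbertSpace} (T : operator H) (F : frame H K)
    (lam : R) : l2 -> l2 :=
  epsilon (inhabits (fun _ : l2 => zero : l2)) (fun A =>
    is_linear A /\
    forall i j, l2_coord (A (l2_unit j)) i = phi_entry T F lam i j).

Definition eta {H K : HilbertSpace} (T : operator H) (F : frame H K)
    (lam : R) : l2 -> l2 := op_sqrt (phi_op T F lam).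

(** The coefficients of u = sum_j beta_j kappa_j phi_j in H_1 are
    beta_j = <phi_j, u> / kappa_j, and the j-th column of eta is its value at
    the j-th unit vector. *)
Definition evaluation {H K : HilbertSpace} {F : frame H K} (G : rigging F)
    (T : operator H) (lam : R) (u : H_plus G) : l2 :=
  epsilon (inhabits (zero : l2)) (is_series (fun j =>
    scal (inner (phi F j) (incl_plus G u) / kappa F j)%C
      (eta T F lam (l2_unit j)))).

Definition evaluation_range {H K : HilbertSpace} {F : frame H K}
    (G : rigging F) (T : operator H) (lam : R) (v : l2) : Prop :=
  exists u, evaluation G T lam u = v.

Definition fibre {H K : HilbertSpace} {F : frame H K} (G : rigging F)
    (T : operator H) (lam : R) : l2 -> Prop :=
  set_closure (evaluation_range G T lam).

(** [s = 1] gives a_+ and [s = -1] gives a_-. *)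
Definition is_wave_limit {H K : HilbertSpace} {F : frame H K} (G : rigging F)
    (T1 T0 : operator H) (lam s : R) (a : H_plus G -> H_minus G) : Prop :=
  trace_limit (at_right 0)
    (fun y f => incl_minus G (scal (RtoC (y / PI))
       (resolvent T1 (lam, - s * y) (resolvent T0 (lam, s * y)
          (incl_plus G f))))) a.

(** [w] is a sesquilinear form on [h1 x h2], conjugate-linear in its first
    argument, with the dense domain [D1 x D2]; its values elsewhere are
    irrelevant. *)
Definition densely_defined_form {X : HilbertSpace} (h1 h2 D1 D2 : X -> Prop)
    (w : X -> X -> C) : Prop :=
  subspace D1 /\ subspace D2 /\
  (forall u, D1 u -> h1 u) /\ (forall u, D2 u -> h2 u) /\
  (forall u, h1 u -> set_closure D1 u) /\
  (forall u, h2 u -> set_closure D2 u) /\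
  (forall u u' v, D1 u -> D1 u' -> D2 v ->
     w (plus u u') v = (w u v + w u' v)%C) /\
  (forall (a : C) u v, D1 u -> D2 v -> w (scal a u) v = (Cconj a * w u v)%C) /\
  (forall u v v', D1 u -> D2 v -> D2 v' ->
     w u (plus v v') = (w u v + w u v')%C) /\
  (forall (a : C) u v, D1 u -> D2 v -> w u (scal a v) = (a * w u v)%C).

Definition form_norm {X : HilbertSpace} (D1 D2 : X -> Prop) (w : X -> X -> C)
    : Rbar :=
  Lub_Rbar (fun c => exists u v, D1 u /\ D2 v /\ norm u <= 1 /\ norm v <= 1 /\
    c = Cmod (w u v)).

(* Main.v *)
Require Import Defs.
From Stdlib Require Import Reals Lra Lia Arith.
From Stdlib Require Import ClassicalEpsilon FunctionalExtensionality.
From Coquelicot Require Import Coquelicot.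

Open Scope R_scope.

(** For real [y > 0] the resolvent identity gives
    [(y/pi) |R_{lam +- iy}(H) f|^2 = (1/pi) <f, Im R_{lam+iy}(H) f>].  If [f] is
    in H_1, this tends to [<beta, phi(lam) beta> = |E_lam(H) f|^2] as [y -> 0+],
    where [beta] is the sequence of coefficients of [f].  By Cauchy-Schwarz,
    [|<f, (y/pi) R_{lam-+iy}(H_r) R_{lam+-iy}(H_0) g>|^2] is at most
    [(y/pi) |R_{lam+-iy}(H_r) f|^2 (y/pi) |R_{lam+-iy}(H_0) g|^2], so in the limit
    [|<f, a g>| <= |E_lam(H_r) f| |E_lam(H_0) g|].  This bound makes the form
    well defined on the ranges of the evaluation operators and shows that its
    norm is at most 1.

    Square roots of non-negative operators are needed for trace norms and for
    the evaluation operator; they come from the iteration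
    [Y_{n+1} = (D + Y_n^2) / 2], whose limit [Y] satisfies [(1 - Y)^2 = 1 - D]. *)

(** Adjoints, square roots, resolvents, matrix entries and evaluation operators are all picked by
    [epsilon], so none of them can be used before an object with the defining property is
    constructed and, where its values matter, shown to be unique. Hence the basic theory
    (projections, Riesz representation, surjectivity of T - z for self-adjoint T) comes with the
    proof.

    The link between the matrix phi(lam) and resolvents is the trace-norm limit L of F Im R F^*.
    Every u in H_1 is F^* k for a unique k = Z u in K, where Z maps kappa_j phi_j to psi_j. Thus <u,
    Im R u> is the matrix element at Z u of the operator that converges to L, while phi(lam) is L /
    pi written in the basis psi_j. Both sides of the norm identity for E_lam therefore equal <Z u, L
    Z u> / pi in the limit.

    Trace-norm convergence enters through the estimate of the operator norm by the trace norm, which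
    turns it into convergence of matrix elements and of pairings. *)

(** * Algebra of inner products and norms *)

Lemma C_ext (a b : C) : Re a = Re b -> Im a = Im b -> a = b.
Proof. exact (injective_projections a b). Qed.

Lemma Cmod_sqr (c : C) : Cmod c ^ 2 = Re c ^ 2 + Im c ^ 2.
Proof. apply Cmod2_alt. Qed.

Lemma sqr_le_inv (a b : R) : 0 <= b -> a ^ 2 <= b ^ 2 -> a <= b.
Proof. intros hb h; nra. Qed.

Lemma inner_plus_l (X : HilbertSpace) (x y z : X) :
  inner (plus x y) z = (inner x z + inner y z)%C.
Proof.
rewrite (inner_conj X z), inner_plus_r, Cplus_conj, <- !(inner_conj X z).
reflexivity.
Qed.

Lemma inner_scal_l (X : HilbertSpace) (a : C) (x y : X) :
  inner (scal a x) y = (Cconj a * inner x y)%C.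
Proof.
rewrite (inner_conj X y), inner_scal_r, Cmult_conj, <- (inner_conj X y).
reflexivity.
Qed.

Lemma scal_C0 (X : HilbertSpace) (x : X) : scal (0 : C) x = (zero : X).
Proof. exact (scal_zero_l (K := C_Ring) x). Qed.

Lemma opp_scal (X : HilbertSpace) (x : X) : (opp x : X) = scal (RtoC (-1)) x.
Proof.
transitivity (scal (opp one : C_Ring) x).
- symmetry; exact (scal_opp_one (K := C_Ring) x).
- f_equal; apply C_ext; simpl; ring.
Qed.

Lemma inner_zero_r (X : HilbertSpace) (x : X) : inner x zero = 0.
Proof.
pose proof (inner_scal_r X 0 x zero) as h.
rewrite scal_C0 in h; rewrite h; ring.
Qed.

Lemma inner_zero_l (X : HilbertSpace) (x : X) : inner zero x = 0.
Proof. rewrite (inner_conj X x), inner_zero_r; apply C_ext; simpl; ring. Qed.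

Lemma inner_opp_r (X : HilbertSpace) (x y : X) :
  inner x (opp y) = (- inner x y)%C.
Proof. rewrite opp_scal, inner_scal_r; apply C_ext; simpl; ring. Qed.

Lemma inner_opp_l (X : HilbertSpace) (x y : X) :
  inner (opp x) y = (- inner x y)%C.
Proof. rewrite opp_scal, inner_scal_l; apply C_ext; simpl; ring. Qed.

Lemma inner_minus_r (X : HilbertSpace) (x y z : X) :
  inner x (minus y z) = (inner x y - inner x z)%C.
Proof. unfold minus; rewrite inner_plus_r, inner_opp_r; reflexivity. Qed.

Lemma inner_minus_l (X : HilbertSpace) (x y z : X) :
  inner (minus x y) z = (inner x z - inner y z)%C.
Proof. unfold minus; rewrite inner_plus_l, inner_opp_l; reflexivity. Qed.

Lemma norm_sqr (X : HilbertSpace) (x : X) : norm x ^ 2 = Re (inner x x).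
Proof. rewrite inner_norm; reflexivity. Qed.

Lemma Im_inner_self (X : HilbertSpace) (x : X) : Im (inner x x) = 0.
Proof. rewrite inner_norm; reflexivity. Qed.

Lemma norm_C0 (X : HilbertSpace) (x : X) : norm x = 0 -> x = zero.
Proof. exact (norm_eq_zero (K := C_AbsRing) (V := X) x). Qed.

Lemma norm_zero_H (X : HilbertSpace) : norm (zero : X) = 0.
Proof. apply (norm_zero (K := C_AbsRing) (V := X)). Qed.

Lemma norm_pos (X : HilbertSpace) (x : X) : 0 <= norm x.
Proof. apply (norm_ge_0 (K := C_AbsRing) (V := X)). Qed.

Lemma norm_tri (X : HilbertSpace) (x y : X) :
  norm (plus x y) <= norm x + norm y.
Proof. apply (norm_triangle (K := C_AbsRing) (V := X)). Qed.

Lemma minus_eq0 (X : HilbertSpace) (x y : X) : minus x y = zero -> x = y.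
Proof.
intros h; apply (plus_reg_r (opp y)).
rewrite plus_opp_r; exact h.
Qed.

Lemma inner_ext (X : HilbertSpace) (x y : X) :
  (forall z, inner z x = inner z y) -> x = y.
Proof.
intros h; apply minus_eq0, norm_C0.
assert (e : norm (minus x y) ^ 2 = 0).
{ rewrite norm_sqr, inner_minus_r, h; simpl; ring. }
pose proof (norm_pos X (minus x y)); nra.
Qed.

Ltac inner_expand :=
  repeat first [rewrite inner_plus_r | rewrite inner_plus_l
    | rewrite inner_minus_r | rewrite inner_minus_l | rewrite inner_opp_r
    | rewrite inner_opp_l | rewrite inner_zero_l | rewrite inner_zero_r
    | rewrite inner_scal_r | rewrite inner_scal_l].

(* Linear identities between vectors are checked under every functional
   [inner z], where they are identities of complex numbers. *)
Ltac vec :=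
  apply inner_ext; let z := fresh "z" in intros z; inner_expand;
  apply C_ext; unfold Re, Im; simpl; first [ring | field].

Lemma minus_as_plus (X : HilbertSpace) (x y : X) :
  minus x y = plus x (scal (RtoC (-1)) y).
Proof. vec. Qed.

Lemma norm_scal_eq (X : HilbertSpace) (a : C) (x : X) :
  norm (scal a x) = Cmod a * norm x.
Proof.
assert (e : norm (scal a x) ^ 2 = (Cmod a * norm x) ^ 2).
{ rewrite Rpow_mult_distr, !norm_sqr, Cmod_sqr; inner_expand.
  pose proof (Im_inner_self X x) as h.
  destruct (inner x x) as [p q]; unfold Re, Im; simpl in *; subst q; ring. }
pose proof (norm_pos X (scal a x)); pose proof (norm_pos X x);
  pose proof (Cmod_ge_0 a).
assert (0 <= Cmod a * norm x) by now apply Rmult_le_pos.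
nra.
Qed.

Lemma norm_minus_sym (X : HilbertSpace) (x y : X) :
  norm (minus x y) = norm (minus y x).
Proof.
rewrite <- (norm_opp (K := C_AbsRing) (V := X)); f_equal; vec.
Qed.

Lemma norm_minus_tri (X : HilbertSpace) (x y z : X) :
  norm (minus x z) <= norm (minus x y) + norm (minus y z).
Proof.
replace (minus x z) with (plus (minus x y) (minus y z)) by vec.
apply norm_tri.
Qed.

Lemma norm_minus_le (X : HilbertSpace) (x y : X) :
  norm (minus x y) <= norm x + norm y.
Proof.
rewrite <- (norm_opp (K := C_AbsRing) (V := X) y).
apply norm_tri.
Qed.

Lemma norm_sqr_plus (X : HilbertSpace) (x y : X) :
  norm (plus x y) ^ 2 = norm x ^ 2 + 2 * Re (inner x y) + norm y ^ 2.
Proof.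
rewrite !norm_sqr; inner_expand.
rewrite (inner_conj X x y); unfold Re; simpl; ring.
Qed.

Lemma norm_sqr_minus (X : HilbertSpace) (x y : X) :
  norm (minus x y) ^ 2 = norm x ^ 2 - 2 * Re (inner x y) + norm y ^ 2.
Proof.
rewrite !norm_sqr; inner_expand.
rewrite (inner_conj X x y); unfold Re; simpl; ring.
Qed.

(** * Non-negative operators and the Cauchy-Schwarz inequality *)

(** Polarization: reality of the quadratic form at x + y and at x + i y determines the imaginary and
    the real part of <y, A x> from <x, A y>. *)
Lemma nonneg_symmetric (X : HilbertSpace) (A : X -> X) :
  nonneg_operator A -> forall x y, inner x (A y) = inner (A x) y.
Proof.
intros [[lp ls _] h] x y.
assert (e : inner y (A x) = Cconj (inner x (A y))).
{ pose proof (proj2 (h (plus x y))) as h1.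
  pose proof (proj2 (h (plus x (scal Ci y)))) as h2.
  pose proof (proj2 (h x)) as h3; pose proof (proj2 (h y)) as h4.
  rewrite lp in h1, h2; rewrite ls in h2.
  repeat (rewrite inner_plus_r in h1 || rewrite inner_plus_l in h1).
  repeat (rewrite inner_plus_r in h2 || rewrite inner_plus_l in h2
    || rewrite inner_scal_l in h2 || rewrite inner_scal_r in h2).
  destruct (inner x (A x)), (inner y (A y)), (inner x (A y)), (inner y (A x)).
  unfold Re, Im in *; simpl in *; apply C_ext; unfold Re, Im; simpl; nra. }
rewrite (inner_conj X y (A x)), e, Cconj_conj; reflexivity.
Qed.

(** At x + c y with c = -t conj(<x, A y>), the form of A is the polynomial p - 2 t m^2 + t^2 m^2 q
    in the real variable t. It is non-negative, and its minimum at t = 1/q gives the inequality. *)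
Lemma nonneg_cauchy_schwarz (X : HilbertSpace) (A : X -> X) :
  nonneg_operator A -> forall x y,
  Cmod (inner x (A y)) ^ 2 <= Re (inner x (A x)) * Re (inner y (A y)).
Proof.
intros hA x y.
set (p := Re (inner x (A x))); set (q := Re (inner y (A y))).
set (m := Cmod (inner x (A y))).
assert (hp : 0 <= p) by apply hA.
assert (hq : 0 <= q) by apply hA.
assert (h : forall t : R, 0 <= p - 2 * t * m ^ 2 + t ^ 2 * m ^ 2 * q).
{ intros t.
  set (c := (RtoC (- t) * Cconj (inner x (A y)))%C).
  pose proof (proj1 (proj2 hA (plus x (scal c y)))) as h.
  rewrite (linear_plus _ (proj1 hA)), (linear_scal _ (proj1 hA)) in h.
  repeat (rewrite inner_plus_r in h || rewrite inner_plus_l in h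
    || rewrite inner_scal_l in h || rewrite inner_scal_r in h).
  rewrite (inner_conj X (A x) y), <- (nonneg_symmetric X A hA) in h.
  eapply Rle_trans; [exact h|]; apply Req_le.
  unfold m; rewrite Cmod_sqr; unfold p, q, c.
  pose proof (proj2 (proj2 hA y)) as hy.
  destruct (inner x (A y)), (inner y (A y)), (inner x (A x)).
  unfold Re, Im in *; simpl in *; subst; ring. }
destruct (Rle_lt_or_eq_dec 0 q hq) as [hq'|hq'].
- specialize (h (/ q)).
  assert (e : p - 2 * / q * m ^ 2 + (/ q) ^ 2 * m ^ 2 * q = p - m ^ 2 * / q)
    by (field; lra).
  rewrite e in h.
  assert (m ^ 2 * / q * q <= p * q) by (apply Rmult_le_compat_r; lra).
  rewrite Rmult_assoc, Rinv_l in H by lra; lra.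
- rewrite <- hq' in h |- *; rewrite Rmult_0_r.
  destruct (Rle_dec (m ^ 2) 0) as [hm|hm]; [exact hm|].
  (* For q = 0 the polynomial is affine in t, and at this t it would equal -1. *)
  specialize (h ((p + 1) / (2 * m ^ 2))).
  assert (e : 2 * ((p + 1) / (2 * m ^ 2)) * m ^ 2 = p + 1) by (field; nra).
  lra.
Qed.

Lemma lin_op_id (X : HilbertSpace) : is_linear (fun x : X => x).
Proof.
split; [reflexivity|reflexivity|].
exists 1; split; [lra|]; intros x; lra.
Qed.

Lemma cauchy_schwarz (X : HilbertSpace) (x y : X) :
  Cmod (inner x y) <= norm x * norm y.
Proof.
apply sqr_le_inv; [apply Rmult_le_pos; apply norm_pos|].
rewrite Rpow_mult_distr, !norm_sqr.
apply (nonneg_cauchy_schwarz X (fun x => x)).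
split; [apply lin_op_id|]; intros u; split.
- rewrite <- norm_sqr; apply pow2_ge_0.
- apply Im_inner_self.
Qed.

(** * Bounded linear operators *)

Lemma lin_zero (X Y : HilbertSpace) (T : X -> Y) : is_linear T -> T zero = zero.
Proof. intros h; rewrite <- (scal_C0 X zero), (linear_scal _ h); apply scal_C0. Qed.

Lemma lin_minus (X Y : HilbertSpace) (T : X -> Y) : is_linear T ->
  forall x y, T (minus x y) = minus (T x) (T y).
Proof.
intros h x y; unfold minus.
rewrite (linear_plus _ h), !opp_scal, (linear_scal _ h); reflexivity.
Qed.

Lemma lin_bound (X Y : HilbertSpace) (T : X -> Y) : is_linear T ->
  exists M, 0 < M /\ forall x, norm (T x) <= M * norm x.
Proof. intros [_ _ h]; exact h. Qed.

Lemma lin_op_comp (X Y Z : HilbertSpace) (S : Y -> Z) (T : X -> Y) :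
  is_linear S -> is_linear T -> is_linear (fun x => S (T x)).
Proof.
intros hS hT; split.
- intros x y; now rewrite (linear_plus _ hT), (linear_plus _ hS).
- intros a x; now rewrite (linear_scal _ hT), (linear_scal _ hS).
- destruct (lin_bound _ _ _ hS) as [M [hM h1]].
  destruct (lin_bound _ _ _ hT) as [N [hN h2]].
  exists (M * N); split; [now apply Rmult_lt_0_compat|]; intros x.
  rewrite Rmult_assoc; eapply Rle_trans; [apply h1|].
  apply Rmult_le_compat_l; [lra|apply h2].
Qed.

Lemma lin_op_plus (X Y : HilbertSpace) (S T : X -> Y) :
  is_linear S -> is_linear T -> is_linear (fun x => plus (S x) (T x)).
Proof.
intros hS hT; split.
- intros x y; rewrite (linear_plus _ hT), (linear_plus _ hS); vec.
- intros a x; rewrite (linear_scal _ hT), (linear_scal _ hS); vec.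
- destruct (lin_bound _ _ _ hS) as [M [hM h1]].
  destruct (lin_bound _ _ _ hT) as [N [hN h2]].
  exists (M + N); split; [lra|]; intros x.
  eapply Rle_trans; [apply norm_tri|].
  specialize (h1 x); specialize (h2 x); lra.
Qed.

Lemma lin_op_scal (X Y : HilbertSpace) (a : C) (T : X -> Y) :
  is_linear T -> is_linear (fun x => scal a (T x)).
Proof.
intros hT; split.
- intros x y; rewrite (linear_plus _ hT); vec.
- intros b x; rewrite (linear_scal _ hT); vec.
- destruct (lin_bound _ _ _ hT) as [N [hN h2]].
  exists (Cmod a * N + 1); pose proof (Cmod_ge_0 a).
  split; [nra|]; intros x; rewrite norm_scal_eq.
  specialize (h2 x); pose proof (norm_pos _ x); nra.
Qed.

Lemma lin_op_minus (X Y : HilbertSpace) (S T : X -> Y) :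
  is_linear S -> is_linear T -> is_linear (fun x => minus (S x) (T x)).
Proof.
intros hS hT; apply (lin_op_plus X Y S (fun x => opp (T x)) hS).
destruct (lin_op_scal X Y (RtoC (-1)) T hT) as [h1 h2 [M [hM h3]]].
split.
- intros x y; rewrite (linear_plus _ hT); vec.
- intros b x; rewrite (linear_scal _ hT); vec.
- exists M; split; [exact hM|]; intros x; rewrite opp_scal; apply h3.
Qed.

(** * Convergence of sequences of vectors *)

(** Stated through a real sequence, so that squeezing and passage to limits reduce to [is_lim_seq];
    [hilbert_complete] and [is_series_cvg] translate from filters. *)
Definition cvg {X : HilbertSpace} (u : nat -> X) (x : X) : Prop :=
  is_lim_seq (fun n => norm (minus (u n) x)) 0.

Lemma cvg_eps (X : HilbertSpace) (u : nat -> X) (x : X) :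
  cvg u x <-> forall eps, 0 < eps ->
    exists N, forall n, (N <= n)%nat -> norm (minus (u n) x) < eps.
Proof.
unfold cvg; rewrite <- is_lim_seq_spec; split.
- intros h eps he; destruct (h (mkposreal eps he)) as [N hN].
  exists N; intros n hn; specialize (hN n hn); simpl in hN.
  rewrite Rminus_0_r, Rabs_pos_eq in hN; [exact hN|apply norm_pos].
- intros h eps; destruct (h eps (cond_pos eps)) as [N hN].
  exists N; intros n hn; specialize (hN n hn).
  rewrite Rminus_0_r, Rabs_pos_eq; [exact hN|apply norm_pos].
Qed.

Lemma cvg_squeeze (X : HilbertSpace) (u : nat -> X) (x : X) (e : nat -> R) :
  (forall n, norm (minus (u n) x) <= e n) -> is_lim_seq e 0 -> cvg u x.
Proof.
intros h he; apply (is_lim_seq_le_le (fun _ => 0) _ e).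
- intros n; split; [apply norm_pos|apply h].
- apply is_lim_seq_const.
- exact he.
Qed.

Lemma cvg_const (X : HilbertSpace) (x : X) : cvg (fun _ => x) x.
Proof.
apply (cvg_squeeze _ _ _ (fun _ => 0)); [|apply is_lim_seq_const].
intros n; replace (minus x x) with (zero : X) by vec.
rewrite norm_zero_H; lra.
Qed.

Lemma cvg_lin (X Y : HilbertSpace) (T : X -> Y) u x : is_linear T ->
  cvg u x -> cvg (fun n => T (u n)) (T x).
Proof.
intros hT h; destruct (lin_bound _ _ _ hT) as [M [hM hb]].
apply (cvg_squeeze _ _ _ (fun n => M * norm (minus (u n) x))).
- intros n; rewrite <- lin_minus by exact hT; apply hb.
- replace (Finite 0) with (Rbar_mult M 0) by (simpl; f_equal; ring).
  apply is_lim_seq_scal_l, h.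
Qed.

Lemma cvg_plus (X : HilbertSpace) (u v : nat -> X) x y :
  cvg u x -> cvg v y -> cvg (fun n => plus (u n) (v n)) (plus x y).
Proof.
intros h1 h2.
apply (cvg_squeeze _ _ _
  (fun n => norm (minus (u n) x) + norm (minus (v n) y))).
- intros n; eapply Rle_trans; [|apply norm_tri]; apply Req_le; f_equal; vec.
- replace (Finite 0) with (Finite (0 + 0)) by (f_equal; ring).
  apply is_lim_seq_plus'; assumption.
Qed.

Lemma cvg_scal (X : HilbertSpace) (a : C) (u : nat -> X) x :
  cvg u x -> cvg (fun n => scal a (u n)) (scal a x).
Proof. apply cvg_lin, lin_op_scal, lin_op_id. Qed.

Lemma cvg_minus (X : HilbertSpace) (u v : nat -> X) x y :
  cvg u x -> cvg v y -> cvg (fun n => minus (u n) (v n)) (minus x y).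
Proof.
intros h1 h2.
apply (cvg_squeeze _ _ _
  (fun n => norm (minus (u n) x) + norm (minus (v n) y))).
- intros n; eapply Rle_trans; [|apply norm_minus_le]; apply Req_le; f_equal; vec.
- replace (Finite 0) with (Finite (0 + 0)) by (f_equal; ring).
  apply is_lim_seq_plus'; assumption.
Qed.

Lemma cvg_ext (X : HilbertSpace) (u v : nat -> X) x :
  (forall n, u n = v n) -> cvg u x -> cvg v x.
Proof. intros h; apply is_lim_seq_ext; intros n; now rewrite h. Qed.

Lemma cvg_unique (X : HilbertSpace) (u : nat -> X) x y :
  cvg u x -> cvg u y -> x = y.
Proof.
intros h1 h2; apply minus_eq0, norm_C0, Rle_antisym; [|apply norm_pos].
apply Rnot_lt_le; intros h.
destruct (proj1 (cvg_eps _ _ _) h1 (norm (minus x y) / 2) ltac:(lra)) as [N hN].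
destruct (proj1 (cvg_eps _ _ _) h2 (norm (minus x y) / 2) ltac:(lra)) as [M hM].
specialize (hN (max N M) ltac:(lia)); specialize (hM (max N M) ltac:(lia)).
pose proof (norm_minus_tri X x (u (max N M)) y) as h3.
rewrite (norm_minus_sym X x (u _)) in h3; lra.
Qed.

Lemma is_lim_seq_abs_squeeze (u e : nat -> R) (l : R) :
  (forall n, Rabs (u n - l) <= e n) -> is_lim_seq e 0 -> is_lim_seq u l.
Proof.
intros h he; apply (is_lim_seq_le_le (fun n => l - e n) _ (fun n => l + e n)).
- intros n; specialize (h n); apply Rabs_le_between in h; lra.
- replace (Finite l) with (Finite (l - 0)) by (f_equal; ring).
  apply is_lim_seq_minus'; [apply is_lim_seq_const|exact he].
- replace (Finite l) with (Finite (l + 0)) by (f_equal; ring).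
  apply is_lim_seq_plus'; [apply is_lim_seq_const|exact he].
Qed.

Lemma cvg_norm (X : HilbertSpace) (u : nat -> X) x :
  cvg u x -> is_lim_seq (fun n => norm (u n)) (norm x).
Proof.
intros h; apply is_lim_seq_abs_squeeze with (2 := h); intros n.
apply (norm_triangle_inv (K := C_AbsRing) (V := X)).
Qed.

Lemma Im_le_Cmod (c : C) : Rabs (Im c) <= Cmod c.
Proof. eapply Rle_trans; [apply Rmax_r|apply Rmax_Cmod]. Qed.

Lemma cvg_inner (X : HilbertSpace) (y : X) u x : cvg u x ->
  is_lim_seq (fun n => Re (inner y (u n))) (Re (inner y x)) /\
  is_lim_seq (fun n => Im (inner y (u n))) (Im (inner y x)).
Proof.
intros h.
assert (he : is_lim_seq (fun n => norm y * norm (minus (u n) x)) 0).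
{ replace (Finite 0) with (Rbar_mult (norm y) 0) by (simpl; f_equal; ring).
  apply is_lim_seq_scal_l, h. }
split; apply is_lim_seq_abs_squeeze with (2 := he); intros n;
  (eapply Rle_trans; [|apply cauchy_schwarz]); rewrite inner_minus_r.
- apply (re_le_Cmod (_ - _)%C).
- apply (Im_le_Cmod (_ - _)%C).
Qed.

Lemma inner_lim_eq (X : HilbertSpace) (y : X) u x (c : C) : cvg u x ->
  (forall n, inner y (u n) = c) -> inner y x = c.
Proof.
intros h e; destruct (cvg_inner _ y _ _ h) as [h1 h2].
apply is_lim_seq_unique in h1; apply is_lim_seq_unique in h2.
apply C_ext.
- rewrite (Lim_seq_ext _ (fun _ => Re c)), Lim_seq_const in h1;
    [now inversion h1|intros n; now rewrite e].
- rewrite (Lim_seq_ext _ (fun _ => Im c)), Lim_seq_const in h2;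
    [now inversion h2|intros n; now rewrite e].
Qed.

Lemma hilbert_complete (X : HilbertSpace) (u : nat -> X) :
  (forall eps, 0 < eps -> exists N, forall n m, (N <= n)%nat -> (N <= m)%nat ->
     norm (minus (u n) (u m)) < eps) ->
  exists x, cvg u x.
Proof.
intros h.
destruct (proj1 (filterlim_locally_cauchy (U := X) (F := eventually) u)) as [x hx].
{ intros eps; destruct (h eps (cond_pos eps)) as [N hN].
  exists (fun n => (N <= n)%nat); split; [now exists N|].
  intros n m hn hm; apply (norm_compat1 (K := C_AbsRing) (V := X)).
  rewrite norm_minus_sym; auto. }
exists x; apply cvg_eps; intros eps he.
pose proof (norm_factor_gt_0 (K := C_AbsRing) (V := X)) as hf.
(* Balls of the uniform structure and norm balls are comparable only up to [norm_factor], so the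
   radius is divided by it. *)
assert (hd : 0 < eps / norm_factor (K := C_AbsRing) (V := X))
  by (apply Rdiv_lt_0_compat; assumption).
destruct (proj1 (filterlim_locally u x) hx (mkposreal _ hd)) as [N hN].
exists N; intros n hn; specialize (hN n hn).
apply (norm_compat2 (K := C_AbsRing) (V := X)) in hN; simpl in hN.
eapply Rlt_le_trans; [exact hN|]; apply Req_le; field.
apply Rgt_not_eq, hf.
Qed.

Lemma is_series_cvg (X : HilbertSpace) (a : nat -> X) (x : X) :
  is_series a x <-> cvg (sum_n a) x.
Proof.
unfold is_series; rewrite cvg_eps; split.
- intros hx eps he.
  pose proof (norm_factor_gt_0 (K := C_AbsRing) (V := X)) as hf.
  assert (hd : 0 < eps / norm_factor (K := C_AbsRing) (V := X))
    by (apply Rdiv_lt_0_compat; assumption).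
  destruct (proj1 (filterlim_locally _ x) hx (mkposreal _ hd)) as [N hN].
  exists N; intros n hn; specialize (hN n hn).
  apply (norm_compat2 (K := C_AbsRing) (V := X)) in hN; simpl in hN.
  eapply Rlt_le_trans; [exact hN|]; apply Req_le; field.
  apply Rgt_not_eq, hf.
- intros h; apply filterlim_locally; intros eps.
  destruct (h eps (cond_pos eps)) as [N hN].
  exists N; intros n hn; apply (norm_compat1 (K := C_AbsRing) (V := X)); auto.
Qed.

Lemma lin_sum_n (X Y : HilbertSpace) (T : X -> Y) (a : nat -> X) n :
  is_linear T -> T (sum_n a n) = sum_n (fun k => T (a k)) n.
Proof.
intros hT; induction n as [|n IH]; [now rewrite !sum_O|].
now rewrite !sum_Sn, (linear_plus _ hT), IH.
Qed.

Lemma inner_sum_n (X : HilbertSpace) (y : X) (a : nat -> X) n :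
  inner y (sum_n a n) = sum_n (fun k => inner y (a k) : C) n.
Proof.
induction n as [|n IH]; [now rewrite !sum_O|].
rewrite !sum_Sn, inner_plus_r, IH; reflexivity.
Qed.

(** * Projections, the Riesz representation and adjoints *)

Definition closed_subspace {X : HilbertSpace} (M : X -> Prop) : Prop :=
  subspace M /\ forall u x, (forall n, M (u n)) -> cvg u x -> M x.

Lemma inv_S_pos (n : nat) : 0 < / (INR n + 1).
Proof. apply Rinv_0_lt_compat; pose proof (pos_INR n); lra. Qed.

Lemma inv_S_small (eps : R) : 0 < eps ->
  exists N, forall n, (N <= n)%nat -> / (INR n + 1) < eps.
Proof.
intros he; destruct (archimed_cor1 eps he) as [N [h1 h2]].
exists N; intros n hn; eapply Rle_lt_trans; [|exact h1].
apply Rinv_le_contravar; [now apply (lt_INR 0)|].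
apply le_INR in hn; lra.
Qed.

Lemma min_distance (X : HilbertSpace) (M : X -> Prop) (x : X) :
  M zero ->
  exists d, (forall m, M m -> d <= norm (minus x m) ^ 2) /\
    forall eps, 0 < eps -> exists m, M m /\ norm (minus x m) ^ 2 < d + eps.
Proof.
intros hM.
(* The infimum of the squared distances is minus the supremum of their opposites. *)
destruct (completeness (fun c => exists m, M m /\ c = - norm (minus x m) ^ 2))
  as [b [hb1 hb2]].
- exists 0; intros c [m [_ ->]]; pose proof (pow2_ge_0 (norm (minus x m))); lra.
- exists (- norm (minus x zero) ^ 2); now exists zero.
- exists (- b); split.
  + intros m hm.
    assert (- norm (minus x m) ^ 2 <= b) by (apply hb1; now exists m); lra.
  + intros eps he; apply NNPP; intros hn.
    assert (b <= b - eps); [|lra].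
    apply hb2; intros c [m [hm ->]].
    apply Rnot_lt_le; intros hlt; apply hn; exists m; split; [exact hm|lra].
Qed.

(** The parallelogram law for x - m and x - n, solved for the distance of m and n. The last term
    involves their midpoint, which stays in any subspace containing both; hence minimizing sequences
    in [projection] are Cauchy. *)
Lemma parallelogram (X : HilbertSpace) (x m n : X) :
  norm (minus m n) ^ 2 = 2 * norm (minus x m) ^ 2 + 2 * norm (minus x n) ^ 2
    - 4 * norm (minus x (scal (RtoC (/ 2)) (plus m n))) ^ 2.
Proof.
rewrite !norm_sqr; inner_expand.
rewrite (inner_conj X m n), (inner_conj X x m), (inner_conj X x n).
unfold Re; simpl; field.
Qed.

Lemma projection (X : HilbertSpace) (M : X -> Prop) (x : X) :
  closed_subspace M ->
  exists m, M m /\ forall v, M v -> inner v (minus x m) = 0.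
Proof.
intros [[h0 [hp hs]] hc].
destruct (min_distance X M x h0) as [d [hd1 hd2]].
assert (hseq : forall n : nat, exists m, M m /\
  norm (minus x m) ^ 2 < d + / (INR n + 1)) by (intros n; apply hd2, inv_S_pos).
pose (u := fun n => proj1_sig (constructive_indefinite_description _ (hseq n))).
assert (hu : forall n, M (u n) /\ norm (minus x (u n)) ^ 2 < d + / (INR n + 1)).
{ intros n; exact (proj2_sig (constructive_indefinite_description _ (hseq n))). }
destruct (hilbert_complete X u) as [m hm].
{ intros eps he.
  (* If both squared distances are below d + eps^2/4 and the midpoint contributes at least 4 d, the
     parallelogram law leaves less than eps^2. *)
  destruct (inv_S_small (eps ^ 2 / 4) ltac:(nra)) as [N hN].
  exists N; intros n k hn hk.
  pose proof (hN n hn); pose proof (hN k hk).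
  pose proof (proj2 (hu n)); pose proof (proj2 (hu k)).
  pose proof (parallelogram X x (u n) (u k)) as e.
  assert (d <= norm (minus x (scal (RtoC (/ 2)) (plus (u n) (u k)))) ^ 2).
  { apply hd1, hs, hp; apply hu. }
  apply Rnot_le_lt; intros hle.
  assert (eps ^ 2 <= norm (minus (u n) (u k)) ^ 2) by (apply pow_incr; lra).
  lra. }
assert (hMm : M m) by (apply (hc u); [apply hu|exact hm]).
exists m; split; [exact hMm|].
assert (hmin : norm (minus x m) ^ 2 <= d).
{ pose proof (cvg_norm _ _ _ (cvg_minus _ _ _ _ _ (cvg_const _ x) hm)) as h1.
  assert (h2 := is_lim_seq_mult' _ _ _ _ h1 h1).
  assert (h3 : is_lim_seq (fun n => d + / (INR n + 1)) d).
  { apply (is_lim_seq_abs_squeeze _ (fun n => / (INR n + 1))).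
    - intros n; apply Req_le; rewrite Rabs_pos_eq; [ring|].
      pose proof (inv_S_pos n); lra.
    - apply is_lim_seq_spec; intros eps.
      destruct (inv_S_small eps (cond_pos eps)) as [N hN].
      exists N; intros n hn; rewrite Rminus_0_r, Rabs_pos_eq; [auto|].
      apply Rlt_le, inv_S_pos. }
  assert (h4 : Rbar_le (norm (minus x m) * norm (minus x m)) d).
  { apply (is_lim_seq_le _ _ _ _) with (2 := h2) (3 := h3); intros n.
    pose proof (proj2 (hu n)); lra. }
  simpl in h4; lra. }
intros v hv.
set (a := inner v (minus x m)).
(* First variation: the minimizer m is compared with m + t a v, where a is the inner product that
   has to vanish. *)
assert (h : forall t, 0 <= - 2 * t * Cmod a ^ 2
  + t ^ 2 * Cmod a ^ 2 * norm v ^ 2).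
{ intros t; pose proof (hd1 (plus m (scal (RtoC t * a)%C v))
    ltac:(apply hp; [exact hMm|apply hs, hv])) as h.
  replace (minus x (plus m (scal (RtoC t * a)%C v)))
    with (minus (minus x m) (scal (RtoC t * a)%C v)) in h by vec.
  rewrite norm_sqr_minus, norm_scal_eq, inner_scal_r in h.
  rewrite (inner_conj X v (minus x m)) in h; fold a in h.
  rewrite Rpow_mult_distr, Cmod_mult, Cmod_R, Rpow_mult_distr, pow2_abs in h.
  assert (e : Re (RtoC t * a * Cconj a)%C = t * Cmod a ^ 2).
  { rewrite Cmod_sqr; unfold Re, Im; simpl; ring. }
  rewrite e in h; lra. }
apply Cmod_eq_0.
pose proof (pow2_ge_0 (norm v)) as hV.
assert (hden : 0 < norm v ^ 2 + 1) by lra.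
(* For this t the quadratic term is at most half of the linear one in absolute value, so a must
   vanish; the added 1 covers v = 0. *)
specialize (h (/ (norm v ^ 2 + 1))).
assert (hi := Rinv_0_lt_compat _ hden).
assert (e : / (norm v ^ 2 + 1) * norm v ^ 2 <= 1).
{ apply (Rmult_le_reg_l (norm v ^ 2 + 1)); [exact hden|].
  rewrite <- Rmult_assoc, Rinv_r by lra; lra. }
pose proof (Cmod_ge_0 a); set (q := / (norm v ^ 2 + 1)) in *.
assert (h5 : q * Cmod a ^ 2 * (q * norm v ^ 2) <= q * Cmod a ^ 2 * 1).
{ apply Rmult_le_compat_l; [|exact e].
  apply Rmult_le_pos; [lra|apply pow2_ge_0]. }
assert (q * Cmod a ^ 2 <= 0) by nra.
assert (Cmod a ^ 2 <= 0) by nra.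
nra.
Qed.

(** Serves to deduce surjectivity of T - z from injectivity of T - conj z. *)
Lemma full_of_trivial_complement (X : HilbertSpace) (M : X -> Prop) :
  closed_subspace M -> (forall w, (forall v, M v -> inner w v = 0) -> w = zero) ->
  forall x, M x.
Proof.
intros hM h x; destruct (projection X M x hM) as [m [hm ho]].
replace x with m; [exact hm|].
symmetry; apply minus_eq0, h; intros v hv.
rewrite (inner_conj X v), ho by exact hv; apply C_ext; simpl; ring.
Qed.

Lemma riesz (X : HilbertSpace) (l : X -> C) (B : R) :
  (forall x y, l (plus x y) = (l x + l y)%C) ->
  (forall (a : C) x, l (scal a x) = (a * l x)%C) ->
  (forall x, Cmod (l x) <= B * norm x) ->
  exists v, forall x, inner v x = l x.
Proof.
intros lp ls lb.
assert (lm : forall x y, l (minus x y) = (l x - l y)%C).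
{ intros x y; replace (minus x y) with (plus x (scal (RtoC (-1)) y)) by vec.
  rewrite lp, ls; apply C_ext; simpl; ring. }
assert (hM : closed_subspace (fun x => l x = 0)).
{ split; [split; [|split]|].
  - rewrite <- (scal_C0 X zero), ls; ring.
  - intros x y hx hy; rewrite lp, hx, hy; ring.
  - intros a x hx; rewrite ls, hx; ring.
  - intros u x hu hx; apply Cmod_eq_0, Rle_antisym; [|apply Cmod_ge_0].
    assert (h : Rbar_le (Cmod (l x)) (B * 0)).
    { apply (is_lim_seq_le (fun _ => Cmod (l x))
        (fun n => B * norm (minus (u n) x))).
      - intros n; replace (Cmod (l x)) with (Cmod (l (minus (u n) x)));
          [apply lb|].
        rewrite lm, hu, <- Cmod_opp; f_equal; ring.
      - apply is_lim_seq_const.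
      - apply (is_lim_seq_scal_l _ B 0 hx). }
    simpl in h; lra. }
destruct (classic (forall x, l x = 0)) as [hl|hl].
{ exists zero; intros x; now rewrite inner_zero_l, hl. }
apply not_all_ex_not in hl; destruct hl as [x hx].
destruct (projection X _ x hM) as [m [hm ho]]; simpl in hm, ho.
set (p := minus x m) in *.
assert (hlp : l p = l x) by (unfold p; rewrite lm, hm; ring).
assert (hp : inner p p <> 0).
{ rewrite inner_norm; intros e; apply hx; rewrite <- hlp.
  assert (hp0 : norm p = 0).
  { apply (f_equal Re) in e; unfold Re in e; simpl in e; nra. }
  apply norm_C0 in hp0; rewrite hp0, <- (scal_C0 X zero), ls; ring. }
(* The kernel of l has codimension one: y - (l y / l p) p lies in it and is thus orthogonal to p,
   which determines <p, y> and the scalar in front of p. *)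
exists (scal (Cconj (l p / inner p p)) p); intros y.
rewrite inner_scal_l, Cconj_conj.
assert (hlpn : l p <> 0) by (rewrite hlp; exact hx).
pose proof (ho (minus y (scal (l y / l p)%C p))) as e.
rewrite lm, ls in e.
assert (e1 : (l y - l y / l p * l p)%C = 0) by (field; exact hlpn).
specialize (e e1); rewrite inner_minus_l, inner_scal_l in e.
assert (e2 : inner p y = (l y / l p * inner p p)%C).
{ rewrite (inner_conj X y p).
  replace (inner y p) with (Cconj (l y / l p) * inner p p)%C.
  - rewrite Cmult_conj, Cconj_conj; f_equal; symmetry; apply inner_conj.
  - apply (f_equal (fun c => c + Cconj (l y / l p) * inner p p)%C) in e.
    ring_simplify in e; rewrite e; reflexivity. }
rewrite e2; field; split; assumption.
Qed.

Lemma adjoint_spec (X Y : HilbertSpace) (T : X -> Y) : is_linear T ->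
  forall y u, inner (adjoint T y) u = inner y (T u).
Proof.
intros hT y.
apply (epsilon_spec (inhabits zero)
  (fun x => forall u, inner x u = inner y (T u))).
destruct (lin_bound _ _ _ hT) as [M [hM hb]].
apply (riesz X (fun u => inner y (T u)) (norm y * M)).
- intros u v; rewrite (linear_plus _ hT); apply inner_plus_r.
- intros a u; rewrite (linear_scal _ hT); apply inner_scal_r.
- intros u; eapply Rle_trans; [apply cauchy_schwarz|].
  rewrite Rmult_assoc; apply Rmult_le_compat_l; [apply norm_pos|apply hb].
Qed.

Lemma adjoint_spec_r (X Y : HilbertSpace) (T : X -> Y) : is_linear T ->
  forall y u, inner u (adjoint T y) = inner (T u) y.
Proof.
intros hT y u.
rewrite (inner_conj X (adjoint T y)), adjoint_spec by exact hT.
symmetry; apply inner_conj.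
Qed.

Lemma adjoint_unique (X Y : HilbertSpace) (T : X -> Y) (S : Y -> X) :
  is_linear T -> (forall y u, inner (S y) u = inner y (T u)) -> adjoint T = S.
Proof.
intros hT hS; apply functional_extensionality; intros y.
apply inner_ext; intros z.
rewrite adjoint_spec_r, (inner_conj X (S y)), hS by exact hT.
apply inner_conj.
Qed.

Lemma adjoint_linear (X Y : HilbertSpace) (T : X -> Y) :
  is_linear T -> is_linear (adjoint T).
Proof.
intros hT; split.
- intros x y; apply inner_ext; intros z.
  rewrite inner_plus_r, !adjoint_spec_r, inner_plus_r by exact hT; reflexivity.
- intros a y; apply inner_ext; intros z.
  rewrite inner_scal_r, !adjoint_spec_r, inner_scal_r by exact hT; reflexivity.
- destruct (lin_bound _ _ _ hT) as [M [hM hb]].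
  exists M; split; [exact hM|]; intros y.
  assert (h : norm (adjoint T y) ^ 2 <= norm y * (M * norm (adjoint T y))).
  { rewrite norm_sqr, adjoint_spec by exact hT.
    eapply Rle_trans; [apply Rle_abs|]; eapply Rle_trans; [apply re_le_Cmod|].
    eapply Rle_trans; [apply cauchy_schwarz|].
    apply Rmult_le_compat_l; [apply norm_pos|apply hb]. }
  pose proof (norm_pos _ (adjoint T y)); pose proof (norm_pos _ y).
  destruct (Req_dec (norm (adjoint T y)) 0) as [e|e]; [rewrite e; nra|].
  apply (Rmult_le_reg_r (norm (adjoint T y))); lra.
Qed.

(** * Orthonormal families *)

Definition orthonormal {X : HilbertSpace} (e : nat -> X) : Prop :=
  forall i j, inner (e i) (e j) = if Nat.eqb i j then 1 : C else 0 : C.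

(** The equality may live in a structure whose carrier is only convertible to [C]; the [change]
    restores the type that [ring] recognizes. *)
Ltac cring := match goal with |- @eq _ ?a ?b => change (@eq C a b); ring end.

Lemma sum_n_delta (c : nat -> C) k n :
  sum_n (fun j => (c j * (if Nat.eqb k j then 1 else 0))%C : C) n =
  if Nat.leb k n then c k else 0 : C.
Proof.
induction n as [|n IH].
- rewrite sum_O; destruct (Nat.eqb_spec k 0) as [->|h].
  + simpl. cring.
  + destruct k; [lia|]; simpl; cring.
- rewrite sum_Sn, IH; change plus with Cplus.
  destruct (Nat.eqb_spec k (S n)) as [->|h].
  + rewrite (proj2 (Nat.leb_gt (S n) n)), Nat.leb_refl by lia; cring.
  + destruct (Nat.leb_spec k n) as [h1|h1].
    * rewrite (proj2 (Nat.leb_le k (S n))) by lia; cring.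
    * rewrite (proj2 (Nat.leb_gt k (S n))) by lia; cring.
Qed.

Lemma inner_basis_sum (X : HilbertSpace) (e : nat -> X) (c : nat -> C) k n :
  orthonormal e -> inner (e k) (sum_n (fun j => scal (c j) (e j)) n) =
  if Nat.leb k n then c k else 0 : C.
Proof.
intros he; rewrite inner_sum_n, <- sum_n_delta.
apply sum_n_ext; intros j; rewrite inner_scal_r, he; reflexivity.
Qed.

Lemma inner_sum_n_l (X : HilbertSpace) (e : nat -> X) (c : nat -> C) (y : X) n :
  inner (sum_n (fun j => scal (c j) (e j)) n) y =
  sum_n (fun j => (Cconj (c j) * inner (e j) y)%C : C) n.
Proof.
induction n as [|n IH]; [rewrite !sum_O; apply inner_scal_l|].
rewrite !sum_Sn, inner_plus_l, IH, inner_scal_l; reflexivity.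
Qed.

Lemma sum_n_Cmod_sqr (c d : nat -> C) n :
  (forall k, (k <= n)%nat -> d k = (Cconj (c k) * c k)%C) ->
  sum_n d n = RtoC (sqsum c n).
Proof.
assert (hc : forall z : C, (Cconj z * z)%C = RtoC (Cmod z ^ 2)).
{ intros z; rewrite Cmod_sqr; apply C_ext; unfold Re, Im; simpl; ring. }
intros h; induction n as [|n IH].
- now rewrite sum_O, sqsum_0, h, hc by lia.
- rewrite sum_Sn, sqsum_S, IH, h, hc by (intros; auto with arith).
  change plus with Cplus; now rewrite RtoC_plus.
Qed.

Lemma inner_partial_sums (X : HilbertSpace) (e : nat -> X) (c : nat -> C) n m :
  orthonormal e -> (n <= m)%nat ->
  inner (sum_n (fun j => scal (c j) (e j)) n)
    (sum_n (fun j => scal (c j) (e j)) m) = RtoC (sqsum c n).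
Proof.
intros he h; rewrite inner_sum_n_l; apply sum_n_Cmod_sqr.
intros k hk; rewrite inner_basis_sum by exact he.
now rewrite (proj2 (Nat.leb_le k m)) by lia.
Qed.

Lemma norm_partial_sum (X : HilbertSpace) (e : nat -> X) (c : nat -> C) n :
  orthonormal e -> norm (sum_n (fun j => scal (c j) (e j)) n) ^ 2 = sqsum c n.
Proof.
intros he; rewrite norm_sqr, inner_partial_sums by auto; reflexivity.
Qed.

Lemma norm_partial_diff (X : HilbertSpace) (e : nat -> X) (c : nat -> C) n m :
  orthonormal e -> (n <= m)%nat ->
  norm (minus (sum_n (fun j => scal (c j) (e j)) n)
    (sum_n (fun j => scal (c j) (e j)) m)) ^ 2 = sqsum c m - sqsum c n.
Proof.
intros he h; rewrite norm_sqr_minus, !norm_partial_sum by exact he.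
rewrite inner_partial_sums by assumption; simpl; ring.
Qed.

(** By orthonormality the squared distance of two partial sums is a difference of partial sums of
    the series of |c_j|^2, so they form a Cauchy sequence. *)
Lemma riesz_fischer (X : HilbertSpace) (e : nat -> X) (c : nat -> C) :
  orthonormal e -> square_summable c ->
  exists x, is_series (fun j => scal (c j) (e j)) x.
Proof.
intros he hc.
destruct (hilbert_complete X (sum_n (fun j => scal (c j) (e j)))) as [x hx].
{ intros eps heps.
  pose proof (sqsum_is_lim c hc) as hl; apply is_lim_seq_spec in hl.
  assert (h2 : 0 < eps ^ 2 / 2) by nra.
  destruct (hl (mkposreal _ h2)) as [N hN]; simpl in hN.
  assert (key : forall n m, (N <= n)%nat -> (n <= m)%nat ->
    norm (minus (sum_n (fun j => scal (c j) (e j)) n)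
      (sum_n (fun j => scal (c j) (e j)) m)) < eps).
  { intros n m hn hm; apply Rnot_le_lt; intros hle.
    pose proof (norm_partial_diff X e c n m he hm) as ed.
    pose proof (hN n hn) as a1; pose proof (hN m ltac:(lia)) as a2.
    apply Rabs_lt_between in a1; apply Rabs_lt_between in a2.
    assert (eps ^ 2 <= sqsum c m - sqsum c n)
      by (rewrite <- ed; apply pow_incr; lra).
    lra. }
  exists N; intros n m hn hm; destruct (le_lt_dec n m) as [h|h].
  - now apply key.
  - rewrite norm_minus_sym; apply key; lia. }
exists x; now apply is_series_cvg.
Qed.

Lemma series_coefficient (X : HilbertSpace) (e : nat -> X) (c : nat -> C) x k :
  orthonormal e -> is_series (fun j => scal (c j) (e j)) x ->
  inner (e k) x = c k.
Proof.
intros he hx; apply is_series_cvg in hx.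
(* The k-th coefficient of a partial sum is constant only from index k on, hence the shift by k. *)
apply (inner_lim_eq X (e k)
  (fun n => sum_n (fun j => scal (c j) (e j)) (n + k)%nat)).
- apply (is_lim_seq_incr_n (fun n =>
    norm (minus (sum_n (fun j => scal (c j) (e j)) n) x)) k), hx.
- intros n; rewrite inner_basis_sum by exact he.
  now rewrite (proj2 (Nat.leb_le k (n + k))) by lia.
Qed.

Lemma series_norm_sqr (X : HilbertSpace) (e : nat -> X) (c : nat -> C) x :
  orthonormal e -> is_series (fun j => scal (c j) (e j)) x ->
  is_lim_seq (sqsum c) (norm x ^ 2).
Proof.
intros he hx; apply is_series_cvg, cvg_norm in hx.
assert (h2 := is_lim_seq_mult' _ _ _ _ hx hx).
replace (norm x ^ 2) with (norm x * norm x) by ring.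
apply is_lim_seq_ext with (2 := h2); intros n.
rewrite <- (norm_partial_sum X e) by exact he; simpl; rewrite Rmult_1_r; reflexivity.
Qed.

(** With S the Fourier partial sum, <S, x> = |S|^2, so 0 <= |x - S|^2 = |x|^2 - |S|^2. *)
Lemma bessel (X : HilbertSpace) (e : nat -> X) x n :
  orthonormal e -> sqsum (fun j => inner (e j) x) n <= norm x ^ 2.
Proof.
intros he.
set (S := sum_n (fun j => scal (inner (e j) x) (e j)) n).
assert (h : inner S x = RtoC (sqsum (fun j => inner (e j) x) n)).
{ unfold S; rewrite inner_sum_n_l; apply sum_n_Cmod_sqr; reflexivity. }
pose proof (pow2_ge_0 (norm (minus x S))) as h1.
rewrite norm_sqr_minus, (inner_conj X S x), h in h1.
assert (h2 : norm S ^ 2 = sqsum (fun j => inner (e j) x) n)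
  by (now apply norm_partial_sum).
rewrite h2 in h1; simpl in h1; lra.
Qed.

Lemma coefficients_summable (X : HilbertSpace) (e : nat -> X) x :
  orthonormal e -> square_summable (fun j => inner (e j) x).
Proof.
intros he; apply (square_summable_bound _ (norm x ^ 2)).
intros n; now apply bessel.
Qed.

(** The Fourier partial sum P is the best approximation: x - P is orthogonal to P - S for every
    combination S of the vectors up to index n. Once n reaches the length of an S within eps of x,
    the sum P is within eps as well. *)
Lemma orthonormal_basis_of_dense (X : HilbertSpace) (e : nat -> X) :
  orthonormal e -> (forall x, set_closure (in_span e) x) ->
  is_orthonormal_basis e.
Proof.
intros he hd; split; [exact he|]; intros x.
apply is_series_cvg, cvg_eps; intros eps heps.
destruct (hd x (mkposreal eps heps)) as [u [[N [d ->]] hu]]; simpl in hu.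
exists N; intros n hn.
set (c := fun j => inner (e j) x).
set (P := sum_n (fun j => scal (inner (e j) x) (e j)) n).
set (S := sum_n (fun j => scal (d j) (e j)) N) in *.
assert (o : forall j, (j <= n)%nat -> inner (e j) (minus x P) = 0).
{ intros j hj; rewrite inner_minus_r; unfold P.
  rewrite (inner_basis_sum X e c) by exact he.
  rewrite (proj2 (Nat.leb_le j n)) by exact hj; unfold c; ring. }
assert (os : forall (b : nat -> C) m, (m <= n)%nat ->
  inner (sum_n (fun j => scal (b j) (e j)) m) (minus x P) = 0).
{ intros b m hm; induction m as [|m IH].
  - rewrite sum_O, inner_scal_l, o by lia; ring.
  - rewrite sum_Sn, inner_plus_l, inner_scal_l, o, IH by lia; ring. }
rewrite norm_minus_sym; eapply Rle_lt_trans; [|exact hu].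
apply sqr_le_inv; [apply norm_pos|].
replace (minus x S) with (plus (minus x P) (minus P S)) by vec.
assert (e0 : inner (minus P S) (minus x P) = 0).
{ rewrite inner_minus_l.
  replace (inner P (minus x P)) with (0 : C) by (symmetry; apply os; lia).
  replace (inner S (minus x P)) with (0 : C) by (symmetry; apply os; lia).
  ring. }
rewrite norm_sqr_plus, (inner_conj X (minus P S) (minus x P)), e0.
pose proof (pow2_ge_0 (norm (minus P S))); unfold Re; simpl fst.
change (norm (minus x P) ^ 2 <= norm (minus x P) ^ 2 + 2 * 0 + norm (minus P S) ^ 2).
lra.
Qed.

Lemma basis_ext (X : HilbertSpace) (e : nat -> X) x y :
  is_orthonormal_basis e -> (forall j, inner (e j) x = inner (e j) y) -> x = y.
Proof.
intros [_ he] h; apply (cvg_unique X (sum_n (fun j => scal (inner (e j) x) (e j)))).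
- apply is_series_cvg, he.
- replace (fun j => scal (inner (e j) x) (e j))
    with (fun j => scal (inner (e j) y) (e j)); [apply is_series_cvg, he|].
  apply functional_extensionality; intros j; now rewrite h.
Qed.

Lemma basis_lin_ext (X Y : HilbertSpace) (e : nat -> X) (S T : X -> Y) :
  is_orthonormal_basis e -> is_linear S -> is_linear T ->
  (forall j, S (e j) = T (e j)) -> S = T.
Proof.
intros [_ he] hS hT h; apply functional_extensionality; intros x.
pose proof (proj1 (is_series_cvg _ _ _) (he x)) as hx.
apply (cvg_unique Y (fun n => S (sum_n (fun j => scal (inner (e j) x) (e j)) n))).
- now apply cvg_lin.
- apply (cvg_ext _
    (fun n => T (sum_n (fun j => scal (inner (e j) x) (e j)) n))).
  + intros n; rewrite (lin_sum_n X Y S _ n hS), (lin_sum_n X Y T _ n hT).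
    apply sum_n_ext; intros k.
    rewrite (linear_scal _ hS), (linear_scal _ hT), h; reflexivity.
  + now apply cvg_lin.
Qed.

(** * Square roots of non-negative operators *)

(* [poly_dominated D T t]: [T] is a polynomial without constant term in [D]
   with coefficients [c_k >= 0], and [t] is the sum of the [c_k]. *)
Inductive poly_dominated {X : HilbertSpace} (D : X -> X) : (X -> X) -> R -> Prop :=
| pd_zero : poly_dominated D (fun _ => zero) 0
| pd_base : poly_dominated D D 1
| pd_plus S T s t : poly_dominated D S s -> poly_dominated D T t ->
    poly_dominated D (fun x => plus (S x) (T x)) (s + t)
| pd_comp S T s t : poly_dominated D S s -> poly_dominated D T t ->
    poly_dominated D (fun x => S (T x)) (s * t)
| pd_half S s : poly_dominated D S s ->
    poly_dominated D (fun x => scal (RtoC (/ 2)) (S x)) (s / 2).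

Lemma lin_op_zero (X Y : HilbertSpace) : is_linear (fun _ : X => zero : Y).
Proof.
split.
- intros x y; vec.
- intros a x; vec.
- exists 1; split; [lra|]; intros x; rewrite norm_zero_H.
  pose proof (norm_pos X x); lra.
Qed.

Section PolyDominated.

Context (X : HilbertSpace) (D : X -> X) (hD : is_linear D)
  (hDn : forall x, norm (D x) <= norm x)
  (hDs : forall x y, inner x (D y) = inner (D x) y).

Lemma pd_linear T t : poly_dominated D T t -> is_linear T.
Proof.
induction 1.
- apply lin_op_zero.
- exact hD.
- now apply lin_op_plus.
- now apply lin_op_comp.
- now apply lin_op_scal.
Qed.

Lemma pd_norm T t : poly_dominated D T t ->
  0 <= t /\ forall x, norm (T x) <= t * norm x.
Proof.
induction 1 as [| |S T s t _ [hs IHs] _ [ht IHt]|S T s t _ [hs IHs] _ [ht IHt]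
  |S s _ [hs IHs]].
- split; [lra|]; intros x; rewrite norm_zero_H; lra.
- split; [lra|]; intros x; rewrite Rmult_1_l; apply hDn.
- split; [lra|]; intros x; eapply Rle_trans; [apply norm_tri|].
  specialize (IHs x); specialize (IHt x); lra.
- split; [now apply Rmult_le_pos|]; intros x.
  eapply Rle_trans; [apply IHs|]; rewrite Rmult_assoc.
  apply Rmult_le_compat_l; auto.
- split; [lra|]; intros x; rewrite norm_scal_eq, Cmod_R, Rabs_pos_eq by lra.
  specialize (IHs x); lra.
Qed.

Lemma pd_comm_base T t : poly_dominated D T t -> forall x, T (D x) = D (T x).
Proof.
induction 1 as [| |S T s t _ IHs _ IHt|S T s t _ IHs _ IHt|S s _ IHs]; intros x.
- symmetry; apply lin_zero, hD.
- reflexivity.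
- now rewrite IHs, IHt, (linear_plus _ hD).
- now rewrite IHt, IHs.
- now rewrite IHs, (linear_scal _ hD).
Qed.

Lemma pd_comm S s T t : poly_dominated D S s -> poly_dominated D T t ->
  forall x, S (T x) = T (S x).
Proof.
intros hS; pose proof (pd_linear S s hS) as hSl.
induction 1 as [| |T U u t _ IHs _ IHt|T U u t _ IHs _ IHt|T u _ IHs]; intros x.
- apply lin_zero, hSl.
- now apply (pd_comm_base S s).
- now rewrite (linear_plus _ hSl), IHs, IHt.
- now rewrite IHs, IHt.
- now rewrite (linear_scal _ hSl), IHs.
Qed.

Lemma pd_symmetric T t : poly_dominated D T t ->
  forall x y, inner x (T y) = inner (T x) y.
Proof.
induction 1 as [| |S T s t _ IHs _ IHt|S T s t hS IHs hT IHt|S s _ IHs];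
  intros x y.
- now rewrite inner_zero_l, inner_zero_r.
- apply hDs.
- now rewrite inner_plus_l, inner_plus_r, IHs, IHt.
- now rewrite IHs, IHt, (pd_comm _ _ _ _ hT hS).
- rewrite inner_scal_l, inner_scal_r, IHs; f_equal; apply C_ext; simpl; ring.
Qed.

Fixpoint sqrt_iter (n : nat) : X -> X :=
  match n with
  | O => fun _ => zero
  | S n => fun x =>
      scal (RtoC (/ 2)) (plus (D x) (sqrt_iter n (sqrt_iter n x)))
  end.

(** The same iteration with D replaced by the number 1, that is, the sum of the coefficients of the
    polynomial [sqrt_iter n]. *)
Fixpoint sqrt_bound (n : nat) : R :=
  match n with
  | O => 0
  | S n => (1 + sqrt_bound n * sqrt_bound n) / 2
  end.

Lemma sqrt_bound_range n : 0 <= sqrt_bound n <= 1.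
Proof. induction n as [|n IH]; simpl; nra. Qed.

Lemma sqrt_iter_dominated n : poly_dominated D (sqrt_iter n) (sqrt_bound n).
Proof.
induction n as [|n IH]; simpl; [apply pd_zero|].
apply (pd_half D (fun x => plus (D x) (sqrt_iter n (sqrt_iter n x)))).
apply (pd_plus D D (fun x => sqrt_iter n (sqrt_iter n x)));
  [apply pd_base|apply (pd_comp D (sqrt_iter n)); exact IH].
Qed.

(** Polynomials in D commute, so Y_{n+2} - Y_{n+1} = (Y_{n+1} + Y_n)(Y_{n+1} - Y_n) / 2, and
    non-negativity of coefficients passes from one increment to the next. Since D is a contraction,
    the increments of the bounded increasing sequence [sqrt_bound] then dominate those of the
    operators. *)
Lemma sqrt_iter_step n : exists E,
  poly_dominated D E (sqrt_bound (S n) - sqrt_bound n) /\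
  forall x, minus (sqrt_iter (S n) x) (sqrt_iter n x) = E x.
Proof.
induction n as [|n [E [hE IH]]].
- exists (fun x => scal (RtoC (/ 2)) (D x)); split.
  + replace (sqrt_bound 1 - sqrt_bound 0) with (1 / 2) by (simpl; field).
    apply (pd_half D D), pd_base.
  + intros x; simpl; vec.
- exists (fun x => scal (RtoC (/ 2))
    (plus (sqrt_iter (S n) (E x)) (sqrt_iter n (E x)))); split.
  + replace (sqrt_bound (S (S n)) - sqrt_bound (S n)) with
      ((sqrt_bound (S n) * (sqrt_bound (S n) - sqrt_bound n)
        + sqrt_bound n * (sqrt_bound (S n) - sqrt_bound n)) / 2)
      by (simpl; field).
    apply (pd_half D (fun x => plus (sqrt_iter (S n) (E x)) (sqrt_iter n (E x)))).
    apply (pd_plus D (fun x => sqrt_iter (S n) (E x)) (fun x => sqrt_iter n (E x)));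
      (apply (pd_comp D (sqrt_iter _)); [apply sqrt_iter_dominated|exact hE]).
  + intros x; rewrite <- IH.
    pose proof (pd_linear _ _ (sqrt_iter_dominated (S n))) as l1.
    pose proof (pd_linear _ _ (sqrt_iter_dominated n)) as l2.
    rewrite !lin_minus by assumption.
    rewrite <- (pd_comm _ _ _ _ (sqrt_iter_dominated (S n))
      (sqrt_iter_dominated n)).
    change (sqrt_iter (S (S n)) x) with (scal (RtoC (/ 2))
      (plus (D x) (sqrt_iter (S n) (sqrt_iter (S n) x)))).
    set (a := sqrt_iter (S n) (sqrt_iter (S n) x)).
    set (b := sqrt_iter (S n) (sqrt_iter n x)).
    change (sqrt_iter (S n) x)
      with (scal (RtoC (/ 2)) (plus (D x) (sqrt_iter n (sqrt_iter n x)))).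
    vec.
Qed.

Lemma sqrt_iter_cauchy n m x : (n <= m)%nat ->
  norm (minus (sqrt_iter m x) (sqrt_iter n x))
    <= (sqrt_bound m - sqrt_bound n) * norm x.
Proof.
induction 1 as [|m hm IH].
- replace (minus (sqrt_iter n x) (sqrt_iter n x)) with (zero : X) by vec.
  rewrite norm_zero_H; lra.
- eapply Rle_trans; [apply (norm_minus_tri X _ (sqrt_iter m x))|].
  destruct (sqrt_iter_step m) as [E [hE h]]; rewrite h.
  pose proof (proj2 (pd_norm _ _ hE) x); lra.
Qed.

Lemma sqrt_iter_limit x : exists y, cvg (fun n => sqrt_iter n x) y.
Proof.
apply hilbert_complete; intros eps he.
assert (hinc : forall n, sqrt_bound n <= sqrt_bound (S n)).
{ intros n; destruct (sqrt_iter_step n) as [E [hE _]].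
  pose proof (proj1 (pd_norm _ _ hE)); lra. }
destruct (ex_finite_lim_seq_incr sqrt_bound 1 hinc
  (fun n => proj2 (sqrt_bound_range n))) as [l hl].
apply is_lim_seq_spec in hl.
pose proof (norm_pos X x) as hx.
assert (hd : 0 < eps / (2 * (norm x + 1)))
  by (apply Rdiv_lt_0_compat; lra).
destruct (hl (mkposreal _ hd)) as [N hN]; simpl in hN.
assert (key : forall n m, (N <= n)%nat -> (n <= m)%nat ->
  norm (minus (sqrt_iter m x) (sqrt_iter n x)) < eps).
{ intros n m hn hm; eapply Rle_lt_trans; [now apply sqrt_iter_cauchy|].
  pose proof (hN n hn) as a1; pose proof (hN m ltac:(lia)) as a2.
  apply Rabs_lt_between in a1; apply Rabs_lt_between in a2.
  set (q := eps / (2 * (norm x + 1))) in *.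
  assert (e : 2 * q * (norm x + 1) = eps) by (unfold q; field; lra).
  assert (sqrt_bound m - sqrt_bound n < 2 * q) by lra.
  nra. }
exists N; intros n m hn hm; destruct (le_lt_dec n m) as [h|h].
- rewrite norm_minus_sym; now apply key.
- apply key; lia.
Qed.

Lemma sqrt_fixpoint : exists Y : X -> X, is_linear Y /\
  (forall x, norm (Y x) <= norm x) /\
  (forall x y, inner x (Y y) = inner (Y x) y) /\
  (forall x, plus (Y x) (Y x) = plus (D x) (Y (Y x))).
Proof.
pose (Y := fun x => proj1_sig
  (constructive_indefinite_description _ (sqrt_iter_limit x))).
assert (hY : forall x, cvg (fun n => sqrt_iter n x) (Y x)).
{ intros x; exact (proj2_sig
    (constructive_indefinite_description _ (sqrt_iter_limit x))). }
assert (hlin : forall n, is_linear (sqrt_iter n))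
  by (intros n; exact (pd_linear _ _ (sqrt_iter_dominated n))).
assert (hn1 : forall n x, norm (sqrt_iter n x) <= norm x).
{ intros n x; eapply Rle_trans;
    [apply (pd_norm _ _ (sqrt_iter_dominated n))|].
  pose proof (sqrt_bound_range n); pose proof (norm_pos X x); nra. }
assert (hYn : forall x, norm (Y x) <= norm x).
{ intros x.
  assert (h : Rbar_le (norm (Y x)) (norm x)).
  { apply (is_lim_seq_le (fun n => norm (sqrt_iter n x)) (fun _ => norm x));
      [auto|apply cvg_norm, hY|apply is_lim_seq_const]. }
  exact h. }
assert (hYp : forall x y, Y (plus x y) = plus (Y x) (Y y)).
{ intros x y; apply (cvg_unique X (fun n => sqrt_iter n (plus x y))); [apply hY|].
  apply (cvg_ext _ (fun n => plus (sqrt_iter n x) (sqrt_iter n y))).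
  - intros n; symmetry; apply (linear_plus _ (hlin n)).
  - apply cvg_plus; apply hY. }
assert (hYs : forall (a : C) x, Y (scal a x) = scal a (Y x)).
{ intros a x; apply (cvg_unique X (fun n => sqrt_iter n (scal a x))); [apply hY|].
  apply (cvg_ext _ (fun n => scal a (sqrt_iter n x))).
  - intros n; symmetry; apply (linear_scal _ (hlin n)).
  - apply cvg_scal, hY. }
exists Y; split; [|split; [|split]].
- split; [exact hYp|exact hYs|].
  exists 1; split; [lra|]; intros x; rewrite Rmult_1_l; apply hYn.
- exact hYn.
- intros x y.
  destruct (cvg_inner X x _ _ (hY y)) as [r1 i1].
  destruct (cvg_inner X y _ _ (hY x)) as [r2 i2].
  assert (e : forall n, inner x (sqrt_iter n y) = Cconj (inner y (sqrt_iter n x))).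
  { intros n; rewrite (pd_symmetric _ _ (sqrt_iter_dominated n)).
    apply inner_conj. }
  rewrite (inner_conj X y (Y x)).
  apply C_ext.
  + assert (h : Finite (Re (inner x (Y y))) = Re (inner y (Y x))).
    { rewrite <- (is_lim_seq_unique _ _ r1), <- (is_lim_seq_unique _ _ r2).
      apply Lim_seq_ext; intros n; rewrite e; reflexivity. }
    injection h as h; exact h.
  + assert (h : Finite (Im (inner x (Y y))) = - Im (inner y (Y x))).
    { rewrite <- (is_lim_seq_unique _ _ i1).
      apply is_lim_seq_opp in i2; simpl in i2.
      rewrite <- (is_lim_seq_unique _ _ i2).
      apply Lim_seq_ext; intros n; rewrite e; reflexivity. }
    injection h as h; exact h.
- intros x.
  (* Split Y_n Y_n x - Y Y x as Y_n (Y_n x - Y x) + (Y_n - Y)(Y x); the Y_n are contractions, so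
     pointwise convergence suffices for the product. *)
  assert (h2 : cvg (fun n => sqrt_iter n (sqrt_iter n x)) (Y (Y x))).
  { apply (cvg_squeeze _ _ _ (fun n => norm (minus (sqrt_iter n x) (Y x))
      + norm (minus (sqrt_iter n (Y x)) (Y (Y x))))).
    - intros n; eapply Rle_trans;
        [apply (norm_minus_tri X _ (sqrt_iter n (Y x)))|].
      apply Rplus_le_compat_r; rewrite <- lin_minus by apply hlin; apply hn1.
    - replace (Finite 0) with (Finite (0 + 0)) by (f_equal; ring).
      apply is_lim_seq_plus'; apply hY. }
  apply (cvg_unique X
    (fun n => plus (sqrt_iter (S n) x) (sqrt_iter (S n) x))).
  + apply cvg_plus; apply (is_lim_seq_incr_1
      (fun n => norm (minus (sqrt_iter n x) (Y x)))), hY.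
  + apply (cvg_ext _ (fun n => plus (D x) (sqrt_iter n (sqrt_iter n x)))).
    * intros n; change (sqrt_iter (S n) x) with (scal (RtoC (/ 2))
        (plus (D x) (sqrt_iter n (sqrt_iter n x)))). vec.
    * apply cvg_plus; [apply cvg_const|exact h2].
Qed.

End PolyDominated.

(** Cauchy-Schwarz for the form of A at A x and x bounds |A x|^4 by <A x, A A x> <x, A x>, hence by
    M |A x|^2 <x, A x>; divide by |A x|^2. *)
Lemma nonneg_norm_sqr_le (X : HilbertSpace) (A : X -> X) (M : R) :
  nonneg_operator A -> (forall x, Re (inner x (A x)) <= M * norm x ^ 2) ->
  forall x, norm (A x) ^ 2 <= M * Re (inner x (A x)).
Proof.
intros hA hM x.
pose proof (nonneg_cauchy_schwarz X A hA (A x) x) as h.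
rewrite inner_norm, Cmod_R, pow2_abs in h.
pose proof (hM (A x)) as h1; pose proof (proj1 (proj2 hA x)) as h2.
assert (h3 : (norm (A x) ^ 2) ^ 2 <= M * norm (A x) ^ 2 * Re (inner x (A x))).
{ eapply Rle_trans; [exact h|]; apply Rmult_le_compat_r; assumption. }
destruct (Req_dec (norm (A x)) 0) as [e|e].
- assert (eA : A x = zero) by now apply norm_C0.
  rewrite eA, inner_zero_r, norm_zero_H; simpl; lra.
- pose proof (norm_pos X (A x)).
  assert (0 < norm (A x) ^ 2) by (apply pow_lt; lra).
  apply (Rmult_le_reg_l (norm (A x) ^ 2)); [assumption|].
  simpl in *; lra.
Qed.

(** After scaling by a bound M of A, the operator D = 1 - A / M is a symmetric contraction. The
    fixed point Y of the iteration gives B = sqrt M (1 - Y), with B^2 = M (1 - D) = A, and |Y x| <=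
    |x| makes B non-negative. *)
Lemma sqrt_exists (X : HilbertSpace) (A : X -> X) : nonneg_operator A ->
  exists B, nonneg_operator B /\ forall x, B (B x) = A x.
Proof.
intros hA; pose proof (proj1 hA) as lA.
destruct (lin_bound _ _ _ lA) as [M [hM hb]].
pose (D := fun x => minus x (scal (RtoC (/ M)) (A x))).
assert (hi : 0 < / M) by now apply Rinv_0_lt_compat.
assert (hD : is_linear D).
{ apply (lin_op_minus X X (fun x => x) (fun x => scal (RtoC (/ M)) (A x)));
    [apply lin_op_id|now apply lin_op_scal]. }
assert (hDs : forall x y, inner x (D y) = inner (D x) y).
{ intros x y; unfold D; inner_expand.
  rewrite (nonneg_symmetric X A hA); apply C_ext; unfold Re, Im; simpl; ring. }
assert (hDn : forall x, norm (D x) <= norm x).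
{ intros x; apply sqr_le_inv; [apply norm_pos|].
  unfold D; rewrite norm_sqr_minus, norm_scal_eq, inner_scal_r.
  rewrite Cmod_R, Rabs_pos_eq by lra.
  assert (h : norm (A x) ^ 2 <= M * Re (inner x (A x))).
  { apply nonneg_norm_sqr_le; [exact hA|]; intros u.
    eapply Rle_trans; [apply Rle_abs|]; eapply Rle_trans; [apply re_le_Cmod|].
    eapply Rle_trans; [apply cauchy_schwarz|].
    pose proof (norm_pos X u); specialize (hb u); nra. }
  pose proof (proj1 (proj2 hA x)) as h0.
  assert (e : Re (RtoC (/ M) * inner x (A x))%C = / M * Re (inner x (A x)))
    by (unfold Re; simpl; ring).
  rewrite e, Rpow_mult_distr.
  assert (h1 : / M ^ 2 * norm (A x) ^ 2 <= / M ^ 2 * (M * Re (inner x (A x)))).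
  { apply Rmult_le_compat_l; [|exact h].
    apply Rlt_le, Rinv_0_lt_compat, pow_lt, hM. }
  replace (/ M ^ 2 * (M * Re (inner x (A x)))) with (/ M * Re (inner x (A x)))
    in h1 by (field; lra).
  rewrite pow_inv; assert (0 <= / M * Re (inner x (A x))) by nra; lra. }
destruct (sqrt_fixpoint X D hD hDn hDs) as [Y [lY [hYn [hYs hYf]]]].
exists (fun x => scal (RtoC (sqrt M)) (minus x (Y x))); split; [split|].
- apply lin_op_scal, (lin_op_minus X X (fun x => x) Y);
    [apply lin_op_id|exact lY].
- intros x; rewrite inner_scal_r, inner_minus_r.
  assert (hi0 : Im (inner x (Y x)) = 0).
  { pose proof (inner_conj X x (Y x)) as e; rewrite <- hYs in e.
    apply (f_equal Im) in e; unfold Im in *; simpl in e; lra. }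
  assert (hr : Re (inner x (Y x)) <= norm x ^ 2).
  { eapply Rle_trans; [apply Rle_abs|]; eapply Rle_trans; [apply re_le_Cmod|].
    eapply Rle_trans; [apply cauchy_schwarz|].
    pose proof (norm_pos X x); specialize (hYn x); nra. }
  rewrite norm_sqr in hr; pose proof (Im_inner_self X x) as h3.
  pose proof (sqrt_pos M); unfold Re, Im in *; simpl; split; [|rewrite hi0, h3; ring].
  replace (sqrt M * (fst (inner x x) + - fst (inner x (Y x))) -
    0 * (snd (inner x x) + - snd (inner x (Y x))))
    with (sqrt M * (fst (inner x x) - fst (inner x (Y x)))) by ring.
  apply Rmult_le_pos; lra.
- intros x; rewrite (linear_scal _ lY), (lin_minus _ _ _ lY).
  assert (e : Y (Y x) = minus (plus (Y x) (Y x)) (D x)) by (rewrite hYf; vec).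
  rewrite e; unfold D; apply inner_ext; intros z; inner_expand.
  assert (hs : RtoC M = (RtoC (sqrt M) * RtoC (sqrt M))%C).
  { rewrite <- RtoC_mult, sqrt_sqrt by lra; reflexivity. }
  assert (hM0 : RtoC M <> 0) by (intros h; apply RtoC_inj in h; lra).
  rewrite RtoC_inv by lra.
  transitivity (RtoC M * (/ RtoC M * inner z (A x)))%C.
  { set (q := (/ RtoC M * inner z (A x))%C); rewrite hs; ring. }
  field; exact hM0.
Qed.

Lemma op_sqrt_spec (X : HilbertSpace) (A : X -> X) : nonneg_operator A ->
  nonneg_operator (op_sqrt A) /\ forall x, op_sqrt A (op_sqrt A x) = A x.
Proof.
intros hA; exact (epsilon_spec (inhabits (fun _ => zero))
  (fun B => nonneg_operator B /\ forall x, B (B x) = A x) (sqrt_exists X A hA)).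
Qed.

Lemma op_sqrt_norm (X : HilbertSpace) (A : X -> X) x : nonneg_operator A ->
  norm (op_sqrt A x) ^ 2 = Re (inner x (A x)).
Proof.
intros hA; destruct (op_sqrt_spec X A hA) as [h1 h2].
rewrite norm_sqr, <- (nonneg_symmetric X _ h1), h2; reflexivity.
Qed.

Lemma adjoint_comp_nonneg (X Y : HilbertSpace) (T : X -> Y) : is_linear T ->
  nonneg_operator (fun x => adjoint T (T x)).
Proof.
intros hT; split.
- apply lin_op_comp; [now apply adjoint_linear|exact hT].
- intros x; rewrite adjoint_spec_r by exact hT; split.
  + rewrite <- norm_sqr; apply pow2_ge_0.
  + apply Im_inner_self.
Qed.

Lemma op_abs_spec (X Y : HilbertSpace) (T : X -> Y) : is_linear T ->
  nonneg_operator (op_abs T) /\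
  (forall x, op_abs T (op_abs T x) = adjoint T (T x)) /\
  forall x, norm (op_abs T x) ^ 2 = norm (T x) ^ 2.
Proof.
intros hT; pose proof (adjoint_comp_nonneg X Y T hT) as hn.
destruct (op_sqrt_spec X _ hn) as [h1 h2].
split; [exact h1|]; split; [exact h2|]; intros x.
unfold op_abs; rewrite op_sqrt_norm, adjoint_spec_r, <- norm_sqr by assumption.
reflexivity.
Qed.

(** * The operator norm is bounded by the trace norm *)

Lemma finite_cauchy_schwarz (a b : nat -> R) n :
  (sum_n (fun k => a k * b k) n) ^ 2
    <= sum_n (fun k => a k ^ 2) n * sum_n (fun k => b k ^ 2) n.
Proof.
assert (hpos : forall (c : nat -> R) n, 0 <= sum_n (fun k => c k ^ 2) n).
{ intros c m; induction m as [|m IH]; [rewrite sum_O; apply pow2_ge_0|].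
  rewrite sum_Sn; apply Rplus_le_le_0_compat; [exact IH|apply pow2_ge_0]. }
induction n as [|n IH]; [rewrite !sum_O; apply Req_le; ring|].
rewrite !sum_Sn; change plus with Rplus; cbv beta.
pose proof (hpos a n); pose proof (hpos b n).
set (s := sum_n (fun k => a k * b k) n) in *.
set (p := sum_n (fun k => a k ^ 2) n) in *.
set (q := sum_n (fun k => b k ^ 2) n) in *.
set (u := a (S n)); set (v := b (S n)).
(* Cross term of the induction step: s^2 <= p q combined with the arithmetic-geometric mean
   inequality for p v^2 and q u^2. *)
assert (h : 2 * s * (u * v) <= p * v ^ 2 + q * u ^ 2).
{ apply sqr_le_inv; [pose proof (pow2_ge_0 u); pose proof (pow2_ge_0 v); nra|].
  assert (h1 : s ^ 2 * (2 * (u * v)) ^ 2 <= p * q * (2 * (u * v)) ^ 2)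
    by (apply Rmult_le_compat_r; [apply pow2_ge_0|exact IH]).
  pose proof (pow2_ge_0 (p * v ^ 2 - q * u ^ 2)); nra. }
nra.
Qed.

(** Let b = <x, B x> and t_j = <e_j, B e_j>. Expanding x in the basis and using |<x, B e_j>| <= sqrt
    b sqrt t_j bounds b by sqrt b times the sum of |<e_j, x>| sqrt t_j. By Cauchy-Schwarz and Bessel
    that sum is at most |x| sqrt t, so b^2 <= b t |x|^2. *)
Lemma trace_form_bound (X : HilbertSpace) (e : nat -> X) (B : X -> X) (t : R) :
  is_orthonormal_basis e -> nonneg_operator B ->
  (forall n, sum_n (fun j => Re (inner (e j) (B (e j)))) n <= t) ->
  forall x, Re (inner x (B x)) <= t * norm x ^ 2.
Proof.
intros [he hs] hB ht x.
set (b := Re (inner x (B x))).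
assert (hb : 0 <= b) by apply hB.
set (tj := fun j => Re (inner (e j) (B (e j)))) in *.
assert (htj : forall j, 0 <= tj j) by (intros j; apply hB).
assert (ht0 : 0 <= t) by (specialize (ht 0%nat); rewrite sum_O in ht;
  specialize (htj 0%nat); lra).
pose (P := sum_n (fun j => scal (inner (e j) x) (e j))).
assert (key : forall n, Re (inner (B x) (P n)) <= norm x * sqrt (t * b)).
{ intros n; eapply Rle_trans; [apply Rle_abs|].
  eapply Rle_trans; [apply re_le_Cmod|].
  assert (h1 : Cmod (inner (B x) (P n))
    <= sqrt b * sum_n (fun j => Cmod (inner (e j) x) * sqrt (tj j)) n).
  { unfold P; clear -hB htj hb; induction n as [|n IH].
    - rewrite !sum_O, inner_scal_r, Cmod_mult.
      rewrite <- (nonneg_symmetric X B hB).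
      pose proof (nonneg_cauchy_schwarz X B hB x (e 0%nat)) as h.
      fold b in h; fold (tj 0%nat) in h.
      assert (Cmod (inner x (B (e 0%nat))) <= sqrt b * sqrt (tj 0%nat)).
      { rewrite <- sqrt_mult by auto; apply sqr_le_inv; [apply sqrt_pos|].
        rewrite pow2_sqrt by (apply Rmult_le_pos; auto); exact h. }
      pose proof (Cmod_ge_0 (inner (e 0%nat) x)); nra.
    - rewrite !sum_Sn, inner_plus_r, inner_scal_r; change plus with Rplus.
      eapply Rle_trans; [apply Cmod_triangle|]; rewrite Cmod_mult.
      rewrite <- (nonneg_symmetric X B hB _ (e (S n))).
      pose proof (nonneg_cauchy_schwarz X B hB x (e (S n))) as h.
      fold b in h; fold (tj (S n)) in h.
      assert (Cmod (inner x (B (e (S n)))) <= sqrt b * sqrt (tj (S n))).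
      { rewrite <- sqrt_mult by auto; apply sqr_le_inv; [apply sqrt_pos|].
        rewrite pow2_sqrt by (apply Rmult_le_pos; auto); exact h. }
      pose proof (Cmod_ge_0 (inner (e (S n)) x)); nra. }
  eapply Rle_trans; [exact h1|].
  assert (h2 : sum_n (fun j => Cmod (inner (e j) x) * sqrt (tj j)) n
    <= norm x * sqrt t).
  { apply sqr_le_inv; [apply Rmult_le_pos; [apply norm_pos|apply sqrt_pos]|].
    eapply Rle_trans; [apply (finite_cauchy_schwarz
      (fun j => Cmod (inner (e j) x)) (fun j => sqrt (tj j)))|].
    rewrite Rpow_mult_distr, pow2_sqrt by exact ht0.
    apply Rmult_le_compat.
    - apply (sqsum_ge0 (fun j => inner (e j) x)).
    - replace (sum_n (fun k => sqrt (tj k) ^ 2) n) with (sum_n tj n).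
      + clear -htj; induction n as [|n IH]; [rewrite sum_O; auto|].
        rewrite sum_Sn; apply Rplus_le_le_0_compat; auto.
      + apply sum_n_ext; intros j; rewrite pow2_sqrt; auto.
    - apply (bessel X e x n he).
    - replace (sum_n (fun k => sqrt (tj k) ^ 2) n) with (sum_n tj n);
        [apply ht|apply sum_n_ext; intros j; rewrite pow2_sqrt; auto]. }
  rewrite sqrt_mult by assumption.
  pose proof (sqrt_pos b); nra. }
assert (hlim := proj1 (cvg_inner X (B x) _ _ (proj1 (is_series_cvg _ _ _) (hs x)))).
assert (h : Rbar_le (Re (inner (B x) x)) (norm x * sqrt (t * b))).
{ apply (is_lim_seq_le _ (fun _ => norm x * sqrt (t * b))) with (2 := hlim);
    [exact key|apply is_lim_seq_const]. }
rewrite <- (nonneg_symmetric X B hB) in h; fold b in h; simpl in h.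
assert (h2 : b ^ 2 <= (norm x * sqrt (t * b)) ^ 2) by (apply pow_incr; lra).
rewrite Rpow_mult_distr, pow2_sqrt in h2 by now apply Rmult_le_pos.
destruct (Req_dec b 0) as [e0|e0].
- rewrite e0; apply Rmult_le_pos; [exact ht0|apply pow2_ge_0].
- apply (Rmult_le_reg_l b); lra.
Qed.

(** The trace bounds the form of |T|, hence the norm of |T| x, which equals that of T x. Existence
    of some basis guarantees that the sequence chosen inside [trace] is one. *)
Lemma norm_le_trace_norm (X Y : HilbertSpace) (T : X -> Y) (t : R) :
  (exists e : nat -> X, is_orthonormal_basis e) -> is_linear T ->
  Rbar_lt (trace_norm T) t -> forall x, norm (T x) <= t * norm x.
Proof.
intros hbas hT ht x.
destruct (op_abs_spec X Y T hT) as [hB [_ hBn]].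
pose proof (epsilon_spec (inhabits (fun _ : nat => zero : X))
  is_orthonormal_basis hbas) as he.
unfold trace_norm, trace in ht.
set (e := epsilon (inhabits (fun _ : nat => zero : X)) is_orthonormal_basis) in *.
set (B := op_abs T) in *.
set (s := sum_n (fun j => Re (inner (e j) (B (e j))))) in *.
assert (hinc : forall n, s n <= s (S n)).
{ intros n; unfold s; rewrite sum_Sn; change plus with Rplus.
  pose proof (proj1 (proj2 hB (e (S n)))); lra. }
(* Partial sums of a non-negative series increase, so [Lim_seq] is their true extended limit; being
   below t, it bounds each of them by t. *)
assert (hs : forall n, s n <= t).
{ pose proof (Lim_seq_correct s (ex_lim_seq_incr s hinc)) as hl.
  intros n; destruct (Lim_seq s) as [l| |]; simpl in ht.
  - pose proof (is_lim_seq_incr_compare s l hl hinc n); lra.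
  - contradiction.
  - assert (h : Rbar_le (s 0%nat) m_infty); [|contradiction].
    apply (is_lim_seq_le (fun _ => s 0%nat) s) with (3 := hl);
      [|apply is_lim_seq_const].
    intros k; induction k as [|k IH]; [lra|]; pose proof (hinc k); lra. }
pose proof (trace_form_bound X e B t he hB hs) as hf.
pose proof (nonneg_norm_sqr_le X B t hB hf x) as h1; specialize (hf x).
assert (ht0 : 0 <= t).
{ specialize (hs 0%nat); unfold s in hs; rewrite sum_O in hs.
  pose proof (proj1 (proj2 hB (e 0%nat))); lra. }
apply sqr_le_inv; [apply Rmult_le_pos; [exact ht0|apply norm_pos]|].
rewrite <- hBn, Rpow_mult_distr; nra.
Qed.

(** * Resolvents of self-adjoint operators *)

Section Resolvent.

Context (X : HilbertSpace) (T : operator X) (hT : self_adjoint T).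

Lemma sa_symmetric x y : op_dom T x -> op_dom T y ->
  inner x (T y) = inner (T x) y.
Proof.
intros hx hy; destruct hT as [_ [_ [_ [_ h]]]].
exact (proj2 (h x (T x)) (conj hx eq_refl) y hy).
Qed.

Lemma sa_plus x y : op_dom T x -> op_dom T y -> T (plus x y) = plus (T x) (T y).
Proof. apply hT. Qed.

Lemma sa_scal (a : C) x : op_dom T x -> T (scal a x) = scal a (T x).
Proof. apply hT. Qed.

Lemma sa_dom_plus x y : op_dom T x -> op_dom T y -> op_dom T (plus x y).
Proof. apply (proj1 (proj2 (proj1 hT))). Qed.

Lemma sa_dom_scal (a : C) x : op_dom T x -> op_dom T (scal a x).
Proof. apply (proj2 (proj2 (proj1 hT))). Qed.

Lemma sa_dom_minus x y : op_dom T x -> op_dom T y -> op_dom T (minus x y).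
Proof.
intros hx hy; rewrite minus_as_plus.
now apply sa_dom_plus, sa_dom_scal.
Qed.

Lemma sa_minus x y : op_dom T x -> op_dom T y ->
  T (minus x y) = minus (T x) (T y).
Proof.
intros hx hy; rewrite !minus_as_plus, sa_plus, sa_scal; auto.
now apply sa_dom_scal.
Qed.

Lemma sa_Im u (z : C) : op_dom T u ->
  Im (inner u (minus (T u) (scal z u))) = - Im z * norm u ^ 2.
Proof.
intros hu; rewrite inner_minus_r, inner_scal_r, inner_norm.
assert (h : Im (inner u (T u)) = 0).
{ pose proof (sa_symmetric u u hu hu) as e.
  rewrite (inner_conj X u (T u)) in e.
  apply (f_equal Im) in e; unfold Im in *; simpl in e; lra. }
unfold Im in *; simpl; rewrite h; ring.
Qed.

Lemma sa_lower_bound u (z : C) : op_dom T u ->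
  Rabs (Im z) * norm u <= norm (minus (T u) (scal z u)).
Proof.
intros hu; pose proof (sa_Im u z hu) as e.
pose proof (Rle_trans _ _ _ (Im_le_Cmod (inner u (minus (T u) (scal z u))))
  (cauchy_schwarz X u (minus (T u) (scal z u)))) as h.
rewrite e, Rabs_mult, Rabs_Ropp, (Rabs_pos_eq (norm u ^ 2)) in h
  by apply pow2_ge_0.
destruct (Req_dec (norm u) 0) as [h0|h0].
- rewrite h0, Rmult_0_r; apply norm_pos.
- pose proof (norm_pos X u); apply (Rmult_le_reg_l (norm u)); lra.
Qed.

Lemma sa_injective u (z : C) : Im z <> 0 -> op_dom T u ->
  T u = scal z u -> u = zero.
Proof.
intros hz hu e; pose proof (sa_lower_bound u z hu) as hb.
assert (e0 : norm (minus (T u) (scal z u)) = 0).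
{ rewrite e; transitivity (norm (zero : X)); [f_equal; vec|apply norm_zero_H]. }
assert (hz' : 0 < Rabs (Im z)) by now apply Rabs_pos_lt.
rewrite e0 in hb; pose proof (norm_pos X u); apply norm_C0; nra.
Qed.

(** The lower bound |Im z| |u| <= |(T - z) u| makes the preimages of a convergent sequence Cauchy,
    and a self-adjoint operator has a closed graph. *)
Lemma range_closed (z : C) : Im z <> 0 ->
  closed_subspace (fun x => exists u, op_dom T u /\ minus (T u) (scal z u) = x).
Proof.
intros hz; split; [split; [|split]|].
- exists (scal (0 : C) zero); pose proof (proj1 (proj1 hT)) as h0.
  split; [now apply sa_dom_scal|].
  rewrite sa_scal by exact h0; vec.
- intros x y [u [hu <-]] [v [hv <-]]; exists (plus u v).
  split; [now apply sa_dom_plus|]; rewrite sa_plus by assumption; vec.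
- intros a x [u [hu <-]]; exists (scal a u).
  split; [now apply sa_dom_scal|]; rewrite sa_scal by assumption; vec.
- intros w x hw hx.
  pose (u := fun n => proj1_sig (constructive_indefinite_description _ (hw n))).
  assert (hu : forall n, op_dom T (u n)
    /\ minus (T (u n)) (scal z (u n)) = w n).
  { intros n; exact (proj2_sig (constructive_indefinite_description _ (hw n))). }
  assert (hz' : 0 < Rabs (Im z)) by now apply Rabs_pos_lt.
  destruct (hilbert_complete X u) as [v hv].
  { intros eps he.
    assert (he' : 0 < Rabs (Im z) * eps / 2) by nra.
    destruct (proj1 (cvg_eps X w x) hx _ he') as [N hN].
    exists N; intros n m hn hm.
    pose proof (sa_lower_bound (minus (u n) (u m)) z
      ltac:(apply sa_dom_minus; apply hu)) as h.
    rewrite sa_minus in h by apply hu.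
    replace (minus (minus (T (u n)) (T (u m))) (scal z (minus (u n) (u m))))
      with (minus (minus (T (u n)) (scal z (u n)))
        (minus (T (u m)) (scal z (u m)))) in h by vec.
    rewrite (proj2 (hu n)), (proj2 (hu m)) in h.
    pose proof (norm_minus_tri X (w n) x (w m)) as h2.
    rewrite (norm_minus_sym X x (w m)) in h2.
    pose proof (hN n hn); pose proof (hN m hm).
    apply (Rmult_lt_reg_l (Rabs (Im z))); lra. }
  (* The limit v satisfies <v, T y> = <x + z v, y> for all y in the domain, so it belongs to the
     graph of the adjoint, which is the graph of T. *)
  assert (hdom : op_dom T v /\ T v = plus x (scal z v)).
  { destruct hT as [_ [_ [_ [_ hcl]]]]; apply hcl; intros y hy.
    rewrite (inner_conj X (T y) v), (inner_conj X y (plus x (scal z v))).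
    f_equal.
    assert (h1 : cvg (fun n => plus (w n) (scal z (u n))) (plus x (scal z v)))
      by (apply cvg_plus; [exact hx|now apply cvg_scal]).
    destruct (cvg_inner X y _ _ h1) as [r1 i1].
    destruct (cvg_inner X (T y) _ _ hv) as [r2 i2].
    assert (e : forall n, inner (T y) (u n) = inner y (plus (w n) (scal z (u n)))).
    { intros n; rewrite <- (proj2 (hu n)), <- sa_symmetric by (apply hu || auto).
      f_equal; vec. }
    apply C_ext.
    - assert (h : Finite (Re (inner (T y) v)) = Re (inner y (plus x (scal z v)))).
      { rewrite <- (is_lim_seq_unique _ _ r1), <- (is_lim_seq_unique _ _ r2).
        apply Lim_seq_ext; intros n; now rewrite e. }
      injection h as h; exact h.
    - assert (h : Finite (Im (inner (T y) v)) = Im (inner y (plus x (scal z v)))).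
      { rewrite <- (is_lim_seq_unique _ _ i1), <- (is_lim_seq_unique _ _ i2).
        apply Lim_seq_ext; intros n; now rewrite e. }
      injection h as h; exact h. }
  destruct hdom as [h1 h2]; exists v; split; [exact h1|]; rewrite h2; vec.
Qed.

(** A vector w orthogonal to the closed range of T - z lies in the domain of the adjoint, with T w =
    (conj z) w. A self-adjoint operator has no non-real eigenvalue, so w = 0 and the range is
    everything. *)
Lemma resolvent_spec (z : C) (x : X) : Im z <> 0 ->
  op_dom T (resolvent T z x) /\
  minus (T (resolvent T z x)) (scal z (resolvent T z x)) = x.
Proof.
intros hz.
apply (epsilon_spec (inhabits zero)
  (fun u => op_dom T u /\ minus (T u) (scal z u) = x)).
revert x; apply full_of_trivial_complement; [now apply range_closed|].
intros w hw.
assert (h : op_dom T w /\ T w = scal (Cconj z) w).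
{ destruct hT as [_ [_ [_ [_ hcl]]]]; apply hcl; intros y hy.
  pose proof (hw _ (ex_intro _ y (conj hy eq_refl))) as e.
  rewrite inner_minus_r, inner_scal_r in e.
  rewrite inner_scal_l, Cconj_conj.
  apply (f_equal (fun c => c + z * inner w y)%C) in e.
  ring_simplify in e; exact e. }
destruct h as [h1 h2].
apply (sa_injective w (Cconj z)); [rewrite im_conj; lra|exact h1|exact h2].
Qed.

Lemma resolvent_unique (z : C) (x u : X) : Im z <> 0 -> op_dom T u ->
  minus (T u) (scal z u) = x -> resolvent T z x = u.
Proof.
intros hz hu e; destruct (resolvent_spec z x hz) as [h1 h2].
set (v := resolvent T z x) in *.
apply minus_eq0, (sa_injective (minus v u) z hz); [now apply sa_dom_minus|].
rewrite sa_minus by assumption.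
assert (e1 : T v = plus x (scal z v)) by (rewrite <- h2; vec).
assert (e2 : T u = plus x (scal z u)) by (rewrite <- e; vec).
rewrite e1, e2; vec.
Qed.

Lemma resolvent_linear (z : C) : Im z <> 0 -> is_linear (resolvent T z).
Proof.
intros hz; split.
- intros x y; destruct (resolvent_spec z x hz) as [a1 a2].
  destruct (resolvent_spec z y hz) as [b1 b2].
  apply resolvent_unique; [exact hz|now apply sa_dom_plus|].
  rewrite sa_plus by assumption; rewrite <- a2 at 3; rewrite <- b2 at 3; vec.
- intros a x; destruct (resolvent_spec z x hz) as [a1 a2].
  apply resolvent_unique; [exact hz|now apply sa_dom_scal|].
  rewrite sa_scal by assumption; rewrite <- a2 at 3; vec.
- assert (h : 0 < Rabs (Im z)) by now apply Rabs_pos_lt.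
  exists (/ Rabs (Im z)); split; [now apply Rinv_0_lt_compat|].
  intros x; destruct (resolvent_spec z x hz) as [a1 a2].
  pose proof (sa_lower_bound _ z a1) as hb; rewrite a2 in hb.
  apply (Rmult_le_reg_l (Rabs (Im z))); [exact h|].
  rewrite <- Rmult_assoc, Rinv_r by lra; lra.
Qed.

Lemma resolvent_adjoint (z : C) : Im z <> 0 ->
  adjoint (resolvent T z) = resolvent T (Cconj z).
Proof.
intros hz; apply adjoint_unique; [now apply resolvent_linear|].
assert (hz' : Im (Cconj z) <> 0) by (rewrite im_conj; lra).
intros y u; destruct (resolvent_spec z u hz) as [a1 a2].
destruct (resolvent_spec (Cconj z) y hz') as [b1 b2].
set (w := resolvent T z u) in *; set (v := resolvent T (Cconj z) y) in *.
transitivity (inner v (minus (T w) (scal z w))); [now rewrite a2|].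
transitivity (inner (minus (T v) (scal (Cconj z) v)) w); [|now rewrite b2].
rewrite inner_minus_r, inner_minus_l, inner_scal_r, inner_scal_l, Cconj_conj.
now rewrite sa_symmetric.
Qed.

Lemma resolvent_Im (z : C) (x : X) : Im z <> 0 ->
  Im (inner x (resolvent T z x)) = Im z * norm (resolvent T z x) ^ 2.
Proof.
intros hz; destruct (resolvent_spec z x hz) as [h1 h2].
pose proof (sa_Im _ z h1) as e; rewrite h2 in e.
rewrite (inner_conj X (resolvent T z x) x), im_conj, e; ring.
Qed.

(** Both sides, multiplied by Im z, are Im <x, R_z x> up to conjugation. This covers a_-, where
    resolvents appear below the real axis while [in_Lambda] looks at them above it. *)
Lemma resolvent_norm_conj (z : C) (x : X) : Im z <> 0 ->
  norm (resolvent T (Cconj z) x) ^ 2 = norm (resolvent T z x) ^ 2.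
Proof.
intros hz; pose proof (resolvent_Im z x hz) as e1.
pose proof (resolvent_Im (Cconj z) x ltac:(rewrite im_conj; lra)) as e2.
assert (e3 : inner x (resolvent T (Cconj z) x) = inner (resolvent T z x) x).
{ rewrite <- resolvent_adjoint by exact hz.
  now apply adjoint_spec_r, resolvent_linear. }
rewrite e3 in e2.
rewrite (inner_conj X x (resolvent T z x)), !im_conj, e1 in e2.
apply (Rmult_eq_reg_l (Im z)); lra.
Qed.

Lemma im_part_form (z : C) (x : X) : Im z <> 0 ->
  inner x (im_part (resolvent T z) x) = RtoC (Im z * norm (resolvent T z x) ^ 2).
Proof.
intros hz; unfold im_part.
rewrite inner_scal_r, inner_minus_r, adjoint_spec_r
  by now apply resolvent_linear.
rewrite (inner_conj X x (resolvent T z x)), im_alt', resolvent_Im by exact hz.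
set (q := Im z * norm (resolvent T z x) ^ 2).
field; intros h; apply (f_equal Im) in h; unfold Im in h; simpl in h; lra.
Qed.

Lemma im_part_linear (z : C) : Im z <> 0 -> is_linear (im_part (resolvent T z)).
Proof.
intros hz; apply lin_op_scal,
  (lin_op_minus X X (resolvent T z) (adjoint (resolvent T z)));
  [|apply adjoint_linear]; now apply resolvent_linear.
Qed.

Lemma im_part_nonneg (lam y : R) : 0 < y ->
  nonneg_operator (im_part (resolvent T (lam, y))).
Proof.
intros hy; assert (hz : Im (lam, y) <> 0) by (simpl; lra).
split; [now apply im_part_linear|]; intros x.
rewrite im_part_form by exact hz; split; [|reflexivity].
change (0 <= y * norm (resolvent T (lam, y) x) ^ 2).
apply Rmult_le_pos; [lra|apply pow2_ge_0].
Qed.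

Lemma resolvent_norm_im_part (lam y s : R) (x : X) : 0 < y -> s = 1 \/ s = -1 ->
  y * norm (resolvent T (lam, s * y) x) ^ 2 =
  Re (inner x (im_part (resolvent T (lam, y)) x)).
Proof.
intros hy hs; assert (hz : Im (lam, y) <> 0) by (simpl; lra).
rewrite im_part_form by exact hz.
change (y * norm (resolvent T (lam, s * y) x) ^ 2 =
  y * norm (resolvent T (lam, y) x) ^ 2).
f_equal; destruct hs as [-> | ->].
- now rewrite Rmult_1_l.
- rewrite <- (resolvent_norm_conj (lam, y)) by exact hz.
  replace (-1 * y) with (- y) by ring; reflexivity.
Qed.

(** In the identity that defines the adjoint graph, V moves to the other side: z belongs to x for T
    + V exactly when z - V x does for T. *)
Lemma perturbation_self_adjoint (V : X -> X) : bounded_self_adjoint V ->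
  self_adjoint (MkOperator (op_dom T) (fun x => plus (T x) (V x))).
Proof.
intros [lV sV]; pose proof hT as [h1 [h2 [h3 [h4 h5]]]].
split; [exact h1|]; split; [|split; [|split; [exact h4|]]]; simpl.
- intros x y hx hy; rewrite h2, (linear_plus _ lV) by assumption; vec.
- intros a x hx; rewrite h3, (linear_scal _ lV) by assumption; vec.
- intros x z.
  assert (e : (forall y, op_dom T y -> inner x (plus (T y) (V y)) = inner z y) <->
    (forall y, op_dom T y -> inner x (T y) = inner (minus z (V x)) y)).
  { split; intros h y hy; specialize (h y hy);
      rewrite inner_plus_r, sV in *; rewrite inner_minus_l in *.
    - rewrite <- h; ring.
    - rewrite h; ring. }
  rewrite e, h5; split; intros [a b]; split; auto.
  + rewrite b; vec.
  + rewrite <- b; vec.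
Qed.

End Resolvent.

Lemma sandwiched_self_adjoint (X Y : HilbertSpace) (T : X -> Y) (J : Y -> Y) :
  is_linear T -> bounded_self_adjoint J ->
  bounded_self_adjoint (fun x => adjoint T (J (T x))).
Proof.
intros hT [lJ sJ]; split.
- apply (lin_op_comp X Y X (adjoint T) (fun x => J (T x)));
    [now apply adjoint_linear|now apply lin_op_comp].
- intros x y; rewrite adjoint_spec_r, adjoint_spec by exact hT; apply sJ.
Qed.

(** * Isometries between spaces with orthonormal bases *)

(** The series of <e_j, x> f_j converges by Riesz-Fischer; the equality of coefficients determines U
    and is the form in which it is applied. *)
Lemma basis_isometry (X Y : HilbertSpace) (e : nat -> X) (f : nat -> Y) :
  is_orthonormal_basis e -> is_orthonormal_basis f ->
  exists U : X -> Y, is_linear U /\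
    forall k x, inner (f k) (U x) = inner (e k) x.
Proof.
intros he hf.
assert (h : forall x, exists y, is_series (fun j => scal (inner (e j) x) (f j)) y).
{ intros x; apply (riesz_fischer Y f (fun j => inner (e j) x)); [exact (proj1 hf)|].
  apply coefficients_summable; exact (proj1 he). }
pose (U := fun x => proj1_sig (constructive_indefinite_description _ (h x))).
assert (hU : forall x, is_series (fun j => scal (inner (e j) x) (f j)) (U x)).
{ intros x; exact (proj2_sig (constructive_indefinite_description _ (h x))). }
assert (hc : forall k x, inner (f k) (U x) = inner (e k) x).
{ intros k x.
  exact (series_coefficient Y f (fun j => inner (e j) x) _ k (proj1 hf) (hU x)). }
exists U; split; [split|exact hc].
- intros x y; apply (basis_ext Y f); [exact hf|]; intros j.
  now rewrite inner_plus_r, !hc, inner_plus_r.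
- intros a x; apply (basis_ext Y f); [exact hf|]; intros j.
  now rewrite inner_scal_r, !hc, inner_scal_r.
- exists 1; split; [lra|]; intros x; rewrite Rmult_1_l.
  apply sqr_le_inv; [apply norm_pos|].
  assert (hl : Rbar_le (norm (U x) ^ 2) (norm x ^ 2)); [|exact hl].
  apply (is_lim_seq_le (sqsum (fun j => inner (e j) x)) (fun _ => norm x ^ 2)).
  + intros n; apply bessel; exact (proj1 he).
  + apply (series_norm_sqr Y f (fun j => inner (e j) x)); [exact (proj1 hf)|apply hU].
  + apply is_lim_seq_const.
Qed.

Lemma Series_single (a : nat -> R) i :
  (forall n, n <> i -> a n = 0) -> Series a = a i.
Proof.
intros h; apply is_series_unique.
assert (e : forall m, (sum_n a m : R) = if Nat.leb i m then a i else 0).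
{ intros m; induction m as [|m IH].
  - rewrite sum_O; destruct i as [|i]; [reflexivity|]; apply h; lia.
  - rewrite sum_Sn, IH; change plus with Rplus.
    destruct (Nat.leb_spec i m) as [h1|h1].
    + rewrite (proj2 (Nat.leb_le i (S m))), (h (S m)) by lia; ring.
    + destruct (Nat.eq_dec (S m) i) as [->|h2].
      * rewrite Nat.leb_refl; ring.
      * rewrite (proj2 (Nat.leb_gt i (S m))), (h (S m)) by lia; ring. }
change (is_lim_seq (sum_n a) (a i)).
apply (is_lim_seq_ext_loc (fun _ => a i)); [|apply is_lim_seq_const].
exists i; intros m hm; rewrite e.
now rewrite (proj2 (Nat.leb_le i m)).
Qed.

Lemma l2_unit_coord i n :
  l2_coord (l2_unit i) n = if Nat.eqb n i then 1 : C else 0 : C.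
Proof. reflexivity. Qed.

Lemma inner_l2_unit i (v : l2) : inner (l2_unit i) v = l2_coord v i.
Proof.
change (inner (l2_unit i) v) with (l2_inner (l2_unit i) v).
unfold l2_inner; apply C_ext; unfold Re, Im; simpl fst; simpl snd.
- rewrite (Series_single _ i).
  + rewrite Nat.eqb_refl; simpl; ring.
  + intros n hn; rewrite (proj2 (Nat.eqb_neq n i)) by exact hn; simpl; ring.
- rewrite (Series_single _ i).
  + rewrite Nat.eqb_refl; simpl; ring.
  + intros n hn; rewrite (proj2 (Nat.eqb_neq n i)) by exact hn; simpl; ring.
Qed.

Lemma l2_unit_basis : is_orthonormal_basis l2_unit.
Proof.
assert (ho : orthonormal l2_unit).
{ intros i j; rewrite inner_l2_unit; apply l2_unit_coord. }
split; [exact ho|]; intros x.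
destruct (riesz_fischer l2 l2_unit (fun j => inner (l2_unit j) x) ho) as [y hy].
{ now apply coefficients_summable. }
replace x with y at 1; [exact hy|].
apply l2_ext; intros n; rewrite <- !inner_l2_unit.
exact (series_coefficient l2 l2_unit _ y n ho hy).
Qed.

(** * The frame operator *)

Section Frame.

Context (H K : HilbertSpace) (F : frame H K).

Lemma kappa_neq j : RtoC (kappa F j) <> 0.
Proof.
intros h; apply RtoC_inj in h; pose proof (kappa_pos _ _ F j); lra.
Qed.

Lemma kappa_le_0 j : kappa F j <= kappa F 0.
Proof.
induction j as [|j IH]; [lra|]; pose proof (kappa_decr _ _ F j); lra.
Qed.

Lemma frame_coefficient k f :
  inner (psi F k) (F f) = (kappa F k * inner (phi F k) f)%C.
Proof.
exact (series_coefficient K (psi F) (fun j => kappa F j * inner (phi F j) f)%C _ k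
  (proj1 (psi_basis _ _ F)) (frame_op_series _ _ F f)).
Qed.

(** The operator is given only by its series, so linearity is read off from coefficients. The bound
    is kappa_0, the largest of the kappa_j. *)
Lemma frame_linear : is_linear F.
Proof.
split.
- intros x y; apply (basis_ext K (psi F)); [apply psi_basis|]; intros j.
  rewrite inner_plus_r, !frame_coefficient, inner_plus_r; ring.
- intros a x; apply (basis_ext K (psi F)); [apply psi_basis|]; intros j.
  rewrite inner_scal_r, !frame_coefficient, inner_scal_r; ring.
- pose proof (kappa_pos _ _ F 0) as h0.
  exists (kappa F 0); split; [exact h0|]; intros x.
  apply sqr_le_inv; [apply Rmult_le_pos; [lra|apply norm_pos]|].
  assert (hl : Rbar_le (norm (F x) ^ 2) ((kappa F 0 * norm x) ^ 2)); [|exact hl].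
  apply (is_lim_seq_le (sqsum (fun j => kappa F j * inner (phi F j) x)%C)
    (fun _ => (kappa F 0 * norm x) ^ 2)).
  + intros n; rewrite Rpow_mult_distr.
    apply Rle_trans with (kappa F 0 ^ 2 * sqsum (fun j => inner (phi F j) x) n).
    * assert (ht : forall j, Cmod (kappa F j * inner (phi F j) x)%C ^ 2
        <= kappa F 0 ^ 2 * Cmod (inner (phi F j) x) ^ 2).
      { intros j; rewrite Cmod_mult, Rpow_mult_distr.
        apply Rmult_le_compat_r; [apply pow2_ge_0|].
        apply pow_incr; split; [apply Cmod_ge_0|].
        pose proof (kappa_pos _ _ F j).
        rewrite Cmod_R, Rabs_pos_eq by lra; apply kappa_le_0. }
      induction n as [|n IH]; [rewrite !sqsum_0; apply ht|].
      rewrite !sqsum_S; specialize (ht (S n)); lra.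
    * apply Rmult_le_compat_l; [apply pow2_ge_0|].
      apply bessel; exact (proj1 (phi_basis _ _ F)).
  + apply (series_norm_sqr K (psi F)); [exact (proj1 (psi_basis _ _ F))|].
    apply frame_op_series.
  + apply is_lim_seq_const.
Qed.

Lemma frame_phi j : F (phi F j) = scal (RtoC (kappa F j)) (psi F j).
Proof.
apply (basis_ext K (psi F)); [apply psi_basis|]; intros k.
rewrite frame_coefficient, inner_scal_r.
rewrite (proj1 (phi_basis _ _ F)), (proj1 (psi_basis _ _ F)).
destruct (Nat.eqb_spec k j) as [->|h]; ring.
Qed.

Lemma frame_adjoint_coefficient k x :
  inner (phi F k) (adjoint F x) = (kappa F k * inner (psi F k) x)%C.
Proof.
rewrite adjoint_spec_r, frame_phi, inner_scal_l by apply frame_linear.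
f_equal; apply C_ext; simpl; ring.
Qed.

Lemma frame_adjoint_psi j :
  adjoint F (psi F j) = scal (RtoC (kappa F j)) (phi F j).
Proof.
apply (basis_ext H (phi F)); [apply phi_basis|]; intros k.
rewrite frame_adjoint_coefficient, inner_scal_r.
rewrite (proj1 (phi_basis _ _ F)), (proj1 (psi_basis _ _ F)).
destruct (Nat.eqb_spec k j) as [->|h]; ring.
Qed.

(** Instead of uniqueness of square roots: B = |F| satisfies B^2 phi_j = kappa_j^2 phi_j, so v = B
    phi_j - kappa_j phi_j satisfies B v = -kappa_j v, and non-negativity of B forces v = 0. *)
Lemma op_abs_phi j : op_abs F (phi F j) = scal (RtoC (kappa F j)) (phi F j).
Proof.
destruct (op_abs_spec H K F frame_linear) as [hB [hB2 _]].
set (B := op_abs F) in *; pose proof (proj1 hB) as lB.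
set (k := kappa F j); pose proof (kappa_pos _ _ F j) as hk; fold k in hk.
set (v := minus (B (phi F j)) (scal (RtoC k) (phi F j))).
assert (e : B v = scal (RtoC (- k)) v).
{ unfold v; rewrite lin_minus, (linear_scal _ lB), hB2 by exact lB.
  rewrite frame_phi, (linear_scal _ (adjoint_linear _ _ F frame_linear)).
  rewrite frame_adjoint_psi; fold k; vec. }
apply minus_eq0, norm_C0; change (norm v = 0).
pose proof (proj1 (proj2 hB v)) as h; rewrite e, inner_scal_r, inner_norm in h.
unfold Re in h; simpl in h; pose proof (norm_pos H v).
assert (h3 : k * (norm v * norm v) <= 0) by nra.
apply Rle_antisym; [|assumption]; apply Rnot_lt_le; intros hp.
assert (0 < k * (norm v * norm v)) by (repeat apply Rmult_lt_0_compat; assumption).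
lra.
Qed.

Lemma op_abs_injective x : op_abs F x = zero -> x = zero.
Proof.
intros e; destruct (op_abs_spec H K F frame_linear) as [_ [_ hn]].
specialize (hn x); rewrite e, norm_zero_H in hn.
assert (e2 : F x = zero) by (apply norm_C0; pose proof (norm_pos K (F x)); nra).
apply (basis_ext H (phi F)); [apply phi_basis|]; intros j.
pose proof (frame_coefficient j x) as e3; rewrite e2, !inner_zero_r in *.
destruct (Ceq_dec (inner (phi F j) x) 0) as [h|h]; [exact h|].
exfalso; revert e3; apply not_eq_sym, Cmult_neq_0; [apply kappa_neq|exact h].
Qed.

(** Injectivity of |F| identifies the preimage picked by [epsilon] in [frame_norm_plus]. *)
Lemma frame_norm_plus_eq f g : op_abs F g = f -> frame_norm_plus F f = norm g.
Proof.
intros hg; unfold frame_norm_plus.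
pose proof (epsilon_spec (inhabits zero) (fun g : H => op_abs F g = f)
  (ex_intro _ g hg)) as h.
cbv beta in h; set (g' := epsilon _ _) in *.
f_equal; apply minus_eq0, op_abs_injective.
destruct (op_abs_spec H K F frame_linear) as [hB _].
rewrite lin_minus, h, hg by apply hB; vec.
Qed.

End Frame.

(** * Finite linear combinations *)

Lemma sum_n_pad (X : HilbertSpace) (e : nat -> X) (c : nat -> C) n m :
  (n <= m)%nat ->
  sum_n (fun j => scal (if Nat.leb j n then c j else 0 : C) (e j)) m =
  sum_n (fun j => scal (c j) (e j)) n.
Proof.
induction 1 as [|m hm IH].
- apply sum_n_ext_loc; intros j hj; now rewrite (proj2 (Nat.leb_le j n)).
- rewrite sum_Sn, IH, (proj2 (Nat.leb_gt (S m) n)) by lia.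
  set (s := sum_n _ n); vec.
Qed.

Lemma in_span_plus (X : HilbertSpace) (e : nat -> X) f g :
  in_span e f -> in_span e g -> in_span e (plus f g).
Proof.
intros [n [c ->]] [m [d ->]].
exists (max n m), (fun j => ((if Nat.leb j n then c j else 0)
  + (if Nat.leb j m then d j else 0))%C).
rewrite <- (sum_n_pad X e c n (max n m)), <- (sum_n_pad X e d m (max n m)) by lia.
rewrite <- sum_n_plus; apply sum_n_ext; intros j; vec.
Qed.

Lemma in_span_scal (X : HilbertSpace) (e : nat -> X) (a : C) f :
  in_span e f -> in_span e (scal a f).
Proof.
intros [n [c ->]]; exists n, (fun j => (a * c j)%C).
rewrite (lin_sum_n X X (fun x => scal a x)) by apply lin_op_scal, lin_op_id.
apply sum_n_ext; intros j; vec.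
Qed.

Lemma in_span_gen (X : HilbertSpace) (e : nat -> X) k : in_span e (e k).
Proof.
exists k, (fun j => if Nat.eqb j k then 1 : C else 0 : C).
assert (h : forall m, (m < k)%nat -> sum_n (fun j =>
  scal (if Nat.eqb j k then 1 : C else 0 : C) (e j)) m = (zero : X)).
{ intros m hm; induction m as [|m IH].
  - rewrite sum_O; rewrite (proj2 (Nat.eqb_neq 0 k)) by lia; apply scal_C0.
  - rewrite sum_Sn, IH by lia.
    rewrite (proj2 (Nat.eqb_neq (S m) k)) by lia; vec. }
destruct k as [|k].
- rewrite sum_O; simpl; vec.
- rewrite sum_Sn, h, Nat.eqb_refl by lia; vec.
Qed.

(** * The rigging *)

Section Rigging.

Context (H K : HilbertSpace) (F : frame H K) (G : rigging F).

(** These are the vectors |F| phi_j seen in H_1. Since |F| carries the norm of H to that of H_1,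
    they should be an orthonormal basis, and the coordinates in it are the beta_j of the evaluation
    operator. *)
Definition plus_basis (j : nat) : H_plus G :=
  i_plus G (scal (RtoC (kappa F j)) (phi F j)).

Lemma span_kappa_phi (a : C) j : in_span (phi F) (scal a (phi F j)).
Proof. apply in_span_scal, in_span_gen. Qed.

(** A completion prescribes only norms, so inner products in H_1 must be recovered from norms of
    two-term combinations. *)
Lemma plus_basis_norm_comb i j (c : C) :
  norm (plus (plus_basis i) (scal c (plus_basis j))) ^ 2 =
  norm (plus (phi F i) (scal c (phi F j))) ^ 2.
Proof.
destruct (H_plus_completion _ G) as [hp [hs [hn _]]].
unfold plus_basis.
rewrite <- hs, <- hp by (repeat apply in_span_scal; apply in_span_gen).
rewrite hn by (apply in_span_plus; repeat apply in_span_scal; apply in_span_gen).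
f_equal; apply frame_norm_plus_eq.
destruct (op_abs_spec H K F (frame_linear H K F)) as [[lB _] _].
rewrite (linear_plus _ lB), (linear_scal _ lB), !op_abs_phi; reflexivity.
Qed.

(** Polarization: c = 0 compares the norms, then c = 1 and c = i compare the real and imaginary
    parts of the inner products. *)
Lemma plus_basis_orthonormal : orthonormal plus_basis.
Proof.
intros i j; rewrite <- (proj1 (phi_basis _ _ F)).
assert (hn : forall k, norm (plus_basis k) ^ 2 = norm (phi F k) ^ 2).
{ intros k; pose proof (plus_basis_norm_comb k k 0) as e.
  replace (plus (plus_basis k) (scal (0 : C) (plus_basis k)))
    with (plus_basis k) in e by vec.
  replace (plus (phi F k) (scal (0 : C) (phi F k)))
    with (phi F k) in e by vec.
  exact e. }
assert (h : forall c : C, Re (c * inner (plus_basis i) (plus_basis j))%C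
  = Re (c * inner (phi F i) (phi F j))%C).
{ intros c; pose proof (plus_basis_norm_comb i j c) as e.
  rewrite !norm_sqr_plus, !norm_scal_eq, !Rpow_mult_distr, !hn,
    !inner_scal_r in e; lra. }
pose proof (h 1) as h1; pose proof (h Ci) as h2.
apply C_ext; unfold Re, Im in *; simpl in h1, h2; lra.
Qed.

Lemma i_plus_sum (c : nat -> C) n :
  i_plus G (sum_n (fun j => scal (c j) (phi F j)) n) =
  sum_n (fun j => scal (c j / kappa F j)%C (plus_basis j)) n.
Proof.
destruct (H_plus_completion _ G) as [hp [hs [hn _]]].
assert (h1 : forall j, i_plus G (scal (c j) (phi F j)) =
  scal (c j / kappa F j)%C (plus_basis j)).
{ intros j; unfold plus_basis.
  rewrite <- hs by apply span_kappa_phi; f_equal.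
  apply inner_ext; intros z; rewrite !inner_scal_r; field; apply kappa_neq. }
induction n as [|n IH]; [rewrite !sum_O; apply h1|].
rewrite !sum_Sn, hp; [now rewrite h1, IH| |apply span_kappa_phi].
now exists n, c.
Qed.

Lemma plus_basis_basis : is_orthonormal_basis plus_basis.
Proof.
apply orthonormal_basis_of_dense; [apply plus_basis_orthonormal|].
destruct (H_plus_completion _ G) as [_ [_ [_ hd]]].
intros x eps; destruct (hd x eps) as [v [[f [[n [c ->]] <-]] hv]].
eexists; split; [|exact hv]; rewrite i_plus_sum.
now exists n, (fun j => c j / kappa F j)%C.
Qed.

Lemma incl_plus_basis k :
  incl_plus G (plus_basis k) = scal (RtoC (kappa F k)) (phi F k).
Proof. apply incl_plus_span, span_kappa_phi. Qed.

(** The adjoint of the inclusion sends phi_j to kappa_j times [plus_basis j]. Hence <phi_j, u> /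
    kappa_j in [evaluation] is the j-th coordinate of u in [plus_basis]. *)
Lemma incl_plus_coefficient j u :
  inner (phi F j) (incl_plus G u) = (kappa F j * inner (plus_basis j) u)%C.
Proof.
pose proof (incl_plus_linear _ G) as li.
rewrite <- (adjoint_spec _ _ _ li).
replace (adjoint (incl_plus G) (phi F j))
  with (scal (RtoC (kappa F j)) (plus_basis j)).
{ rewrite inner_scal_l; f_equal; apply C_ext; simpl; ring. }
apply (basis_ext _ plus_basis); [apply plus_basis_basis|]; intros k.
rewrite (adjoint_spec_r _ _ _ li), incl_plus_basis, inner_scal_r, inner_scal_l.
rewrite plus_basis_orthonormal, (proj1 (phi_basis _ _ F)).
destruct (Nat.eqb_spec k j) as [->|h]; [|ring].
apply C_ext; simpl; ring.
Qed.

(** The pairing is prescribed on the span only and is extended by continuity. Riesz turns it into a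
    bounded V from H_1 to H_{-1}; then (incl_minus)^* V and [incl_plus] are bounded operators that
    agree on [plus_basis], hence everywhere. *)
Lemma pairing_incl u g : pairing G u (incl_minus G g) = inner (incl_plus G u) g.
Proof.
destruct (pairing_bounded _ G) as [M hM].
pose proof (incl_minus_linear _ G) as lm.
assert (hr : forall u, exists v, forall w, inner v w = pairing G u w).
{ intros u'; apply (riesz _ (pairing G u') (M * norm u')).
  - intros x y; apply pairing_plus_r.
  - intros a x; apply pairing_scal_r.
  - intros x; apply hM. }
pose (V := fun u => proj1_sig (constructive_indefinite_description _ (hr u))).
assert (hV : forall u w, inner (V u) w = pairing G u w).
{ intros u'; exact (proj2_sig (constructive_indefinite_description _ (hr u'))). }
assert (lV : is_linear V).
{ split.
  - intros x y; apply inner_ext; intros z.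
    rewrite (inner_conj _ (V (plus x y)) z), hV.
    etransitivity; [exact (f_equal Cconj (pairing_plus_l _ G x y z))|].
    rewrite <- !hV, Cplus_conj, <- !(inner_conj _ _ z), <- inner_plus_r; reflexivity.
  - intros a x; apply inner_ext; intros z.
    rewrite (inner_conj _ (V (scal a x)) z), hV.
    etransitivity; [exact (f_equal Cconj (pairing_scal_l _ G a x z))|].
    rewrite <- hV, Cmult_conj, Cconj_conj, <- (inner_conj _ _ z), <- inner_scal_r.
    reflexivity.
  - exists (Rabs M + 1); pose proof (Rabs_pos M); split; [lra|]; intros x.
    pose proof (hM x (V x)) as h.
    rewrite <- hV, inner_norm, Cmod_R, Rabs_pos_eq in h by apply pow2_ge_0.
    pose proof (norm_pos _ x); pose proof (norm_pos _ (V x)).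
    pose proof (Rle_abs M).
    destruct (Req_dec (norm (V x)) 0) as [e|e]; [rewrite e; nra|].
    assert (norm (V x) <= M * norm x).
    { apply (Rmult_le_reg_r (norm (V x))); lra. }
    nra. }
assert (e : (fun u => adjoint (incl_minus G) (V u)) = incl_plus G).
{ apply (basis_lin_ext _ _ plus_basis); [apply plus_basis_basis| |
    apply incl_plus_linear|].
  - apply lin_op_comp; [now apply adjoint_linear|exact lV].
  - intros k; apply (basis_ext H (phi F)); [apply phi_basis|]; intros j.
    rewrite (inner_conj _ (adjoint _ _)), (adjoint_spec _ _ _ lm), hV.
    unfold plus_basis; rewrite pairing_span, incl_plus_span
      by (apply span_kappa_phi || apply in_span_gen).
    symmetry; apply inner_conj. }
rewrite <- hV, <- (adjoint_spec _ _ _ lm).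
apply (f_equal (fun S => inner (S u) g)) in e; exact e.
Qed.

End Rigging.

(** * The evaluation operator *)

Lemma at_right_pos : at_right 0 (fun y => 0 < y).
Proof. exists (mkposreal 1 Rlt_0_1); intros y _ h; exact h. Qed.

Section Evaluation.

Context (H K : HilbertSpace) (F : frame H K) (T : operator H) (lam : R)
  (hT : self_adjoint T).

Let S (y : R) : K -> K := sandwiched F (im_part (resolvent T (lam, y))).

Lemma sandwiched_linear y : 0 < y -> is_linear (S y).
Proof.
intros hy; unfold S, sandwiched.
pose proof (frame_linear H K F) as lF.
apply (lin_op_comp K H K F
  (fun x => im_part (resolvent T (lam, y)) (adjoint F x))); [exact lF|].
apply lin_op_comp; [|now apply adjoint_linear].
apply im_part_linear; [exact hT|simpl; lra].
Qed.

Lemma sandwiched_form y k k' :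
  inner k (S y k') =
  inner (adjoint F k) (im_part (resolvent T (lam, y)) (adjoint F k')).
Proof. symmetry; apply adjoint_spec, frame_linear. Qed.

Context (L : K -> K) (hL : trace_limit (at_right 0) S L).

(** Positivity of y is kept in the conclusion because the resolvent facts applied afterwards require
    a non-real point. *)
Lemma sandwiched_limit k k' (eps : R) : 0 < eps ->
  at_right 0 (fun y => 0 < y /\
    Cmod (inner k (S y k') - inner k (L k')) < eps).
Proof.
intros he; destruct hL as [lL h].
pose proof (norm_pos K k); pose proof (norm_pos K k').
assert (hd : 0 < norm k * norm k' + 1) by nra.
assert (hd' : 0 < eps / (norm k * norm k' + 1))
  by (apply Rdiv_lt_0_compat; assumption).
apply (filter_imp (fun y => 0 < y /\ Rbar_lt (trace_norm
  (fun x => minus (S y x) (L x))) (eps / (norm k * norm k' + 1)))).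
- intros y [hy ht]; split; [exact hy|].
  rewrite <- inner_minus_r; eapply Rle_lt_trans; [apply cauchy_schwarz|].
  assert (hn := norm_le_trace_norm K K (fun x => minus (S y x) (L x)) _
    (ex_intro _ _ (psi_basis _ _ F))
    (lin_op_minus K K (S y) L (sandwiched_linear y hy) lL) ht k').
  cbv beta in hn; set (q := eps / (norm k * norm k' + 1)) in *.
  assert (e : q * (norm k * norm k' + 1) = eps) by (unfold q; field; lra).
  assert (norm k * norm (minus (S y k') (L k')) <= norm k * (q * norm k'))
    by (apply Rmult_le_compat_l; assumption).
  nra.
- apply filter_and; [apply at_right_pos|exact (h (mkposreal _ hd'))].
Qed.

Lemma limit_nonneg : nonneg_operator L.
Proof.
split; [apply hL|]; intros k.
assert (h : forall eps, 0 < eps -> - eps <= Re (inner k (L k)) /\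
  - eps <= Im (inner k (L k)) <= eps).
{ intros eps he.
  destruct (filter_ex _ (sandwiched_limit k k eps he)) as [y [hy hc]].
  rewrite sandwiched_form in hc.
  destruct (proj2 (im_part_nonneg H T hT lam y hy) (adjoint F k)) as [h1 h2].
  pose proof (Rle_lt_trans _ _ _ (re_le_Cmod _) hc) as a1.
  pose proof (Rle_lt_trans _ _ _ (Im_le_Cmod _) hc) as a2.
  apply Rabs_lt_between in a1; apply Rabs_lt_between in a2.
  unfold Re, Im in *; simpl in a1, a2; lra. }
split.
- apply Rnot_lt_le; intros hlt.
  destruct (h (- Re (inner k (L k)) / 2)) as [h1 _]; lra.
- destruct (Rtotal_order (Im (inner k (L k))) 0) as [hlt|[h0|hlt]]; [|exact h0|].
  + destruct (h (- Im (inner k (L k)) / 2)) as [_ h1]; lra.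
  + destruct (h (Im (inner k (L k)) / 2)) as [_ h1]; lra.
Qed.

(** Because F^* psi_j = kappa_j phi_j, the function under the limit is the matrix element of the
    sandwiched operator at psi_i and psi_j; uniqueness of limits identifies the chosen value. *)
Lemma phi_entry_eq i j :
  phi_entry T F lam i j = (/ PI * inner (psi F i) (L (psi F j)))%C.
Proof.
unfold phi_entry; f_equal.
set (f := fun y => (kappa F i * kappa F j *
  inner (phi F i) (im_part (resolvent T (lam, y)) (phi F j)))%C).
set (l0 := inner (psi F i) (L (psi F j))).
assert (hf : filterlim f (at_right 0) (locally l0)).
{ apply filterlim_locally; intros eps.
  apply (filter_imp (fun y => 0 < y /\
    Cmod (inner (psi F i) (S y (psi F j)) - l0) < eps)).
  - intros y [hy hc]; apply C_NormedModule_mixin_compat1.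
    replace (f y) with (inner (psi F i) (S y (psi F j))); [exact hc|].
    rewrite sandwiched_form, !frame_adjoint_psi.
    rewrite (linear_scal _ (im_part_linear H T hT (lam, y) ltac:(simpl; lra))).
    rewrite inner_scal_l, inner_scal_r; unfold f.
    replace (Cconj (kappa F i)) with (RtoC (kappa F i))
      by (apply C_ext; simpl; ring).
    ring.
  - apply sandwiched_limit, cond_pos. }
pose proof (epsilon_spec (inhabits (0 : C))
  (fun l : C => filterlim f (at_right 0) (locally l)) (ex_intro _ l0 hf)) as hs.
exact (filterlim_locally_unique (V := C_NormedModule) f _ _ hs hf).
Qed.

(** The operator U^* L U / pi has the prescribed matrix, so a bounded operator with these entries
    exists; agreement on unit vectors makes it the chosen one. *)
Lemma phi_op_form (U : l2 -> K) : is_linear U ->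
  (forall j, U (l2_unit j) = psi F j) ->
  phi_op T F lam = fun b => scal (RtoC (/ PI)) (adjoint U (L (U b))).
Proof.
intros lU hU; destruct hL as [lL _].
set (A0 := fun b => scal (RtoC (/ PI)) (adjoint U (L (U b)))).
assert (lA0 : is_linear A0).
{ apply lin_op_scal, (lin_op_comp l2 K l2 (adjoint U) (fun b => L (U b)));
    [now apply adjoint_linear|now apply lin_op_comp]. }
assert (hA0 : forall i j, l2_coord (A0 (l2_unit j)) i = phi_entry T F lam i j).
{ intros i j; rewrite <- inner_l2_unit, phi_entry_eq; unfold A0.
  rewrite inner_scal_r, adjoint_spec_r, !hU by exact lU.
  rewrite RtoC_inv by apply PI_neq0; reflexivity. }
destruct (epsilon_spec (inhabits (fun _ : l2 => zero : l2)) (fun A =>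
    is_linear A /\
    forall i j, l2_coord (A (l2_unit j)) i = phi_entry T F lam i j)
  (ex_intro _ A0 (conj lA0 hA0))) as [lA hA].
apply (basis_lin_ext l2 l2 l2_unit); [apply l2_unit_basis|exact lA|exact lA0|].
intros j; apply l2_ext; intros i; rewrite hA0; apply hA.
Qed.

Lemma phi_op_nonneg_form (U : l2 -> K) : is_linear U ->
  (forall j, U (l2_unit j) = psi F j) ->
  nonneg_operator (phi_op T F lam) /\
  forall b, Re (inner b (phi_op T F lam b)) = Re (inner (U b) (L (U b))) / PI.
Proof.
intros lU hU; rewrite (phi_op_form U lU hU).
assert (e : forall b, inner b (scal (RtoC (/ PI)) (adjoint U (L (U b)))) =
  (RtoC (/ PI) * inner (U b) (L (U b)))%C).
{ intros b; now rewrite inner_scal_r, adjoint_spec_r. }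
pose proof (Rinv_0_lt_compat _ PI_RGT_0) as hpi.
split; [split|].
- apply lin_op_scal, (lin_op_comp l2 K l2 (adjoint U) (fun b => L (U b)));
    [now apply adjoint_linear|apply lin_op_comp; [apply hL|exact lU]].
- intros b; rewrite e; destruct (proj2 limit_nonneg (U b)) as [h1 h2].
  unfold Re, Im in *; simpl; rewrite h2; split; [|ring].
  apply Rle_trans with (/ PI * fst (inner (U b) (L (U b)))); [|lra].
  apply Rmult_le_pos; lra.
- intros b; rewrite e; unfold Re; simpl; unfold Rdiv; ring.
Qed.

Context (G : rigging F).

(** Take Z = U W, where W sends [plus_basis j] to the j-th unit vector and U sends that to psi_j.
    Then F^* Z u = u, E_lam = eta W, and since eta^2 = U^* L U / pi the norm of E_lam u is a value
    of the form of L. *)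
Lemma evaluation_form : exists Z : H_plus G -> K, is_linear Z /\
  (forall u, incl_plus G u = adjoint F (Z u)) /\
  is_linear (evaluation G T lam) /\
  forall u, norm (evaluation G T lam u) ^ 2 = Re (inner (Z u) (L (Z u))) / PI.
Proof.
destruct (basis_isometry _ _ _ _ (plus_basis_basis H K F G) l2_unit_basis)
  as [W [lW hW]].
destruct (basis_isometry _ _ _ _ l2_unit_basis (psi_basis _ _ F))
  as [U [lU hU]].
assert (hUe : forall j, U (l2_unit j) = psi F j).
{ intros j; apply (basis_ext K (psi F)); [apply psi_basis|]; intros k.
  rewrite hU, (proj1 l2_unit_basis), (proj1 (psi_basis _ _ F)); reflexivity. }
destruct (phi_op_nonneg_form U lU hUe) as [hn hform].
destruct (op_sqrt_spec l2 _ hn) as [heta _].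
change (op_sqrt (phi_op T F lam)) with (eta T F lam) in heta.
assert (hE : evaluation G T lam = fun u => eta T F lam (W u)).
{ apply functional_extensionality; intros u; unfold evaluation.
  assert (hs : is_series (fun j =>
    scal (inner (phi F j) (incl_plus G u) / kappa F j)%C
      (eta T F lam (l2_unit j))) (eta T F lam (W u))).
  { apply is_series_cvg.
    pose proof (proj1 (is_series_cvg _ _ _) (proj2 l2_unit_basis (W u))) as hw.
    apply (cvg_lin l2 l2 (eta T F lam)) in hw; [|apply heta].
    apply (cvg_ext _ _ _ _) with (2 := hw); intros n.
    rewrite (lin_sum_n l2 l2 (eta T F lam)) by apply heta.
    apply sum_n_ext; intros j.
    rewrite (linear_scal _ (proj1 heta)), hW, incl_plus_coefficient.
    f_equal; field; apply kappa_neq. }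
  pose proof (epsilon_spec (inhabits (zero : l2)) (is_series (fun j =>
    scal (inner (phi F j) (incl_plus G u) / kappa F j)%C
      (eta T F lam (l2_unit j)))) (ex_intro _ _ hs)) as hs'.
  apply is_series_cvg in hs, hs'; exact (cvg_unique _ _ _ _ hs' hs). }
exists (fun u => U (W u)); split; [now apply lin_op_comp|]; split; [|split].
- intros u; apply (basis_ext H (phi F)); [apply phi_basis|]; intros j.
  now rewrite frame_adjoint_coefficient, hU, hW, incl_plus_coefficient.
- rewrite hE; apply lin_op_comp; [apply heta|exact lW].
- intros u; rewrite hE; unfold eta.
  rewrite op_sqrt_norm by exact hn; apply hform.
Qed.

End Evaluation.

Lemma evaluation_linear (H K : HilbertSpace) (F : frame H K) (G : rigging F)
    (T : operator H) (lam : R) :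
  self_adjoint T -> in_Lambda T F lam -> is_linear (evaluation G T lam).
Proof.
intros hT [_ [L hL]].
destruct (evaluation_form H K F T lam hT L hL G) as [Z [_ [_ [h _]]]]; exact h.
Qed.

Lemma evaluation_norm_limit (H K : HilbertSpace) (F : frame H K) (G : rigging F)
    (T : operator H) (lam s : R) (u : H_plus G) (eps : R) :
  self_adjoint T -> in_Lambda T F lam -> s = 1 \/ s = -1 -> 0 < eps ->
  at_right 0 (fun y => 0 < y /\
    Rabs (y / PI * norm (resolvent T (lam, s * y) (incl_plus G u)) ^ 2
      - norm (evaluation G T lam u) ^ 2) < eps).
Proof.
intros hT [_ [L hL]] hs he.
destruct (evaluation_form H K F T lam hT L hL G) as [Z [_ [hZ [_ hn]]]].
pose proof PI_RGT_0 as hpi.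
apply filter_imp with (2 := sandwiched_limit H K F T lam hT L hL (Z u) (Z u)
  (PI * eps) (Rmult_lt_0_compat _ _ hpi he)).
intros y [hy hc]; split; [exact hy|].
rewrite sandwiched_form, <- hZ in hc.
pose proof (Rle_lt_trans _ _ _ (re_le_Cmod _) hc) as a1.
rewrite hn; replace (y / PI * norm (resolvent T (lam, s * y) (incl_plus G u)) ^ 2)
  with (y * norm (resolvent T (lam, s * y) (incl_plus G u)) ^ 2 / PI)
  by (field; lra).
rewrite (resolvent_norm_im_part H T hT) by assumption.
set (p := inner (incl_plus G u) _) in *; set (q := inner (Z u) _) in *.
replace (Re p / PI - Re q / PI) with (Re (p - q)%C / PI)
  by (unfold Re; simpl; field; lra).
unfold Rdiv; rewrite Rabs_mult, (Rabs_pos_eq (/ PI))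
  by (apply Rlt_le, Rinv_0_lt_compat, hpi).
apply (Rmult_lt_reg_l PI); [exact hpi|].
replace (PI * (Rabs (Re (p - q)) * / PI)) with (Rabs (Re (p - q)))
  by (field; lra).
exact a1.
Qed.

(** * The wave form *)

(** Passage to the limit in a^2 <= b c in a form that asks only for one approximating triple per
    eps, which a single small y provides. *)
Lemma limit_cauchy_schwarz (A B C : R) : 0 <= A -> 0 <= B -> 0 <= C ->
  (forall eps, 0 < eps -> exists a b c, 0 <= b /\ 0 <= c /\
    Rabs (a - A) < eps /\ Rabs (b - B) < eps /\ Rabs (c - C) < eps /\
    a ^ 2 <= b * c) -> A ^ 2 <= B * C.
Proof.
intros hA hB hC h; apply Rnot_lt_le; intros hlt.
(* For eps <= 1, replacing a, b, c by A, B, C costs at most 2 A eps on the left and (B + C + 1) eps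
   on the right, in total m eps; this must stay below the gap d. *)
set (d := A ^ 2 - B * C); set (m := 2 * A + B + C + 1).
assert (hd : 0 < d) by (unfold d; lra).
assert (hm : 0 < m) by (unfold m; lra).
assert (he : 0 < Rmin 1 (d / (2 * m))).
{ apply Rmin_pos; [lra|apply Rdiv_lt_0_compat; lra]. }
destruct (h _ he) as [a [b [c [hb [hc [h1 [h2 [h3 h4]]]]]]]].
set (eps := Rmin 1 (d / (2 * m))) in *.
assert (e1 : eps <= 1) by apply Rmin_l.
assert (e2 : eps * m <= d / 2).
{ apply Rle_trans with (d / (2 * m) * m).
  - apply Rmult_le_compat_r; [lra|apply Rmin_r].
  - apply Req_le; field; lra. }
apply Rabs_lt_between in h1; apply Rabs_lt_between in h2;
  apply Rabs_lt_between in h3.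
assert (h5 : A ^ 2 <= a ^ 2 + 2 * A * eps).
{ pose proof (pow2_ge_0 (a - A)); assert (0 <= A * (a - A + eps)) by nra; nra. }
assert (h6 : b * c <= (B + eps) * (C + eps))
  by (apply Rmult_le_compat; lra).
assert (h7 : eps * eps <= eps * 1) by (apply Rmult_le_compat_l; lra).
unfold d, m in *; lra.
Qed.

Section WaveForm.

Context (H K : HilbertSpace) (F : frame H K) (G : rigging F)
  (T1 T0 : operator H) (lam s : R) (a : H_plus G -> H_minus G)
  (hT1 : self_adjoint T1) (hT0 : self_adjoint T0)
  (hL1 : in_Lambda T1 F lam) (hL0 : in_Lambda T0 F lam)
  (hs : s = 1 \/ s = -1) (ha : is_wave_limit G T1 T0 lam s a).

Let W (y : R) (f : H_plus G) : H_minus G :=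
  incl_minus G (scal (RtoC (y / PI))
    (resolvent T1 (lam, - s * y) (resolvent T0 (lam, s * y) (incl_plus G f)))).

Lemma wave_Im_neq y : 0 < y -> Im (lam, s * y) <> 0 /\ Im (lam, - s * y) <> 0.
Proof. intros hy; simpl; destruct hs as [-> | ->]; lra. Qed.

Lemma wave_approx_linear y : 0 < y -> is_linear (W y).
Proof.
intros hy; destruct (wave_Im_neq y hy) as [h1 h2].
apply (lin_op_comp (H_plus G) H (H_minus G) (incl_minus G) (fun f =>
  scal (RtoC (y / PI)) (resolvent T1 (lam, - s * y)
    (resolvent T0 (lam, s * y) (incl_plus G f))))); [apply incl_minus_linear|].
apply lin_op_scal, (lin_op_comp (H_plus G) H H (resolvent T1 (lam, - s * y))
  (fun f => resolvent T0 (lam, s * y) (incl_plus G f)));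
  [now apply resolvent_linear|].
apply lin_op_comp; [now apply resolvent_linear|apply incl_plus_linear].
Qed.

Lemma wave_pairing_limit f g (eps : R) : 0 < eps ->
  at_right 0 (fun y => 0 < y /\
    Cmod (pairing G f (W y g) - pairing G f (a g)) < eps).
Proof.
intros he; destruct ha as [la h].
destruct (pairing_bounded _ G) as [M hM].
pose proof (norm_pos _ f); pose proof (norm_pos _ g); pose proof (Rabs_pos M).
set (q := Rabs M * norm f * norm g).
assert (hq : 0 <= q) by (unfold q; repeat apply Rmult_le_pos; assumption).
assert (hd' : 0 < eps / (q + 1)) by (apply Rdiv_lt_0_compat; lra).
apply (filter_imp (fun y => 0 < y /\ Rbar_lt (trace_norm
  (fun x => minus (W y x) (a x))) (eps / (q + 1)))).
- intros y [hy ht]; split; [exact hy|].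
  assert (e : (pairing G f (W y g) - pairing G f (a g))%C =
    pairing G f (minus (W y g) (a g))).
  { rewrite minus_as_plus, pairing_plus_r, pairing_scal_r.
    apply C_ext; simpl; ring. }
  rewrite e; eapply Rle_lt_trans; [apply hM|].
  assert (hn := norm_le_trace_norm _ _ (fun x => minus (W y x) (a x)) _
    (ex_intro _ _ (plus_basis_basis H K F G))
    (lin_op_minus _ _ (W y) a (wave_approx_linear y hy) la) ht g).
  cbv beta in hn; set (t := eps / (q + 1)) in *.
  assert (et : t * (q + 1) = eps) by (unfold t; field; lra).
  set (nd := norm (minus (W y g) (a g))) in *.
  assert (hnd : 0 <= nd) by apply norm_pos.
  apply Rle_lt_trans with (Rabs M * norm f * (t * norm g)).
  + apply Rle_trans with (Rabs M * norm f * nd).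
    * apply Rmult_le_compat_r; [exact hnd|].
      apply Rmult_le_compat_r; [assumption|apply Rle_abs].
    * apply Rmult_le_compat_l; [now apply Rmult_le_pos|exact hn].
  + replace (Rabs M * norm f * (t * norm g)) with (t * q) by (unfold q; ring).
    lra.
- apply filter_and; [apply at_right_pos|exact (h (mkposreal _ hd'))].
Qed.

(** The pairing becomes an inner product in H, where R_{lam - i s y}(T1) moves to the left as the
    adjoint of R_{lam + i s y}(T1). After Cauchy-Schwarz, each of the two squared norms takes one
    factor y / pi. *)
Lemma wave_pairing_approx y f g : 0 < y ->
  Cmod (pairing G f (W y g)) ^ 2 <=
  (y / PI * norm (resolvent T1 (lam, s * y) (incl_plus G f)) ^ 2) *
  (y / PI * norm (resolvent T0 (lam, s * y) (incl_plus G g)) ^ 2).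
Proof.
intros hy; destruct (wave_Im_neq y hy) as [h1 h2].
unfold W; rewrite pairing_incl, inner_scal_r.
replace (lam, - s * y) with (Cconj (lam, s * y)).
2:{ unfold Cconj; simpl; f_equal; ring. }
rewrite <- (resolvent_adjoint H T1 hT1) by exact h1.
rewrite adjoint_spec_r by now apply resolvent_linear.
assert (hyp : 0 < y / PI) by (apply Rdiv_lt_0_compat; [exact hy|apply PI_RGT_0]).
rewrite Cmod_mult, Cmod_R, Rabs_pos_eq, Rpow_mult_distr by lra.
set (u := resolvent T1 _ _); set (v := resolvent T0 _ _).
replace (y / PI * norm u ^ 2 * (y / PI * norm v ^ 2))
  with ((y / PI) ^ 2 * (norm u * norm v) ^ 2) by ring.
apply Rmult_le_compat_l; [apply pow2_ge_0|].
apply pow_incr; split; [apply Cmod_ge_0|apply cauchy_schwarz].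
Qed.

Lemma wave_pairing_bound f g :
  Cmod (pairing G f (a g)) <=
  norm (evaluation G T1 lam f) * norm (evaluation G T0 lam g).
Proof.
apply sqr_le_inv; [apply Rmult_le_pos; apply norm_pos|].
rewrite Rpow_mult_distr.
apply limit_cauchy_schwarz; [apply Cmod_ge_0|apply pow2_ge_0|apply pow2_ge_0|].
intros eps he.
pose proof (filter_and _ _ (wave_pairing_limit f g eps he) (filter_and _ _
  (evaluation_norm_limit H K F G T1 lam s f eps hT1 hL1 hs he)
  (evaluation_norm_limit H K F G T0 lam s g eps hT0 hL0 hs he))) as hf.
(* The three approximations hold for all small y > 0, so one y serves them together. *)
destruct (filter_ex _ hf) as [y [[hy h1] [[_ h2] [_ h3]]]].
assert (hyp : 0 < y / PI) by (apply Rdiv_lt_0_compat; [exact hy|apply PI_RGT_0]).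
exists (Cmod (pairing G f (W y g))),
  (y / PI * norm (resolvent T1 (lam, s * y) (incl_plus G f)) ^ 2),
  (y / PI * norm (resolvent T0 (lam, s * y) (incl_plus G g)) ^ 2).
split; [apply Rmult_le_pos; [lra|apply pow2_ge_0]|].
split; [apply Rmult_le_pos; [lra|apply pow2_ge_0]|].
split; [|split; [exact h2|split; [exact h3|now apply wave_pairing_approx]]].
eapply Rle_lt_trans; [|exact h1].
exact (norm_triangle_inv (V := C_NormedModule) _ _).
Qed.

Lemma pairing_minus_l (u v : H_plus G) w :
  pairing G (minus u v) w = (pairing G u w - pairing G v w)%C.
Proof.
rewrite minus_as_plus, pairing_plus_l, pairing_scal_l.
apply C_ext; unfold Re, Im; simpl; ring.
Qed.

Lemma wave_pairing_well_defined f f' g g' :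
  evaluation G T1 lam f = evaluation G T1 lam f' ->
  evaluation G T0 lam g = evaluation G T0 lam g' ->
  pairing G f (a g) = pairing G f' (a g').
Proof.
intros e1 e0; pose proof (proj1 ha) as la.
pose proof (evaluation_linear H K F G T1 lam hT1 hL1) as l1.
pose proof (evaluation_linear H K F G T0 lam hT0 hL0) as l0.
assert (z1 : norm (evaluation G T1 lam (minus f f')) = 0).
{ rewrite lin_minus, e1 by exact l1.
  transitivity (norm (zero : l2)); [f_equal; vec|apply norm_zero_H]. }
assert (z0 : norm (evaluation G T0 lam (minus g g')) = 0).
{ rewrite lin_minus, e0 by exact l0.
  transitivity (norm (zero : l2)); [f_equal; vec|apply norm_zero_H]. }
assert (h1 : pairing G (minus f f') (a g) = 0).
{ apply Cmod_eq_0, Rle_antisym; [|apply Cmod_ge_0].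
  eapply Rle_trans; [apply wave_pairing_bound|]; rewrite z1; lra. }
assert (h0 : pairing G f' (a (minus g g')) = 0).
{ apply Cmod_eq_0, Rle_antisym; [|apply Cmod_ge_0].
  eapply Rle_trans; [apply wave_pairing_bound|]; rewrite z0; lra. }
rewrite pairing_minus_l in h1.
rewrite lin_minus, minus_as_plus, pairing_plus_r, pairing_scal_r in h0
  by exact la.
(* One argument is changed at a time; each difference lies in the kernel of an evaluation operator,
   where the bound vanishes. *)
transitivity (pairing G f' (a g)).
- rewrite <- (Cplus_0_r (pairing G f' (a g))), <- h1; ring.
- rewrite <- (Cplus_0_r (pairing G f' (a g'))), <- h0.
  apply C_ext; unfold Re, Im; simpl; ring.
Qed.

(** Any choice of preimages gives the same pairing, so choosing one by [epsilon] is harmless on the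
    ranges; elsewhere the value is arbitrary. *)
Lemma wave_form_exists : exists w : l2 -> l2 -> C, forall f g,
  w (evaluation G T1 lam f) (evaluation G T0 lam g) = pairing G f (a g).
Proof.
exists (fun u v => epsilon (inhabits (0 : C)) (fun c => exists f g,
  evaluation G T1 lam f = u /\ evaluation G T0 lam g = v /\
  c = pairing G f (a g))).
intros f g.
destruct (epsilon_spec (inhabits (0 : C)) (fun c => exists f' g',
  evaluation G T1 lam f' = evaluation G T1 lam f /\
  evaluation G T0 lam g' = evaluation G T0 lam g /\
  c = pairing G f' (a g'))) as [f' [g' [h1 [h0 ->]]]].
- now exists (pairing G f (a g)), f, g.
- now apply wave_pairing_well_defined.
Qed.

End WaveForm.

(** * The form on the ranges of the evaluation operators *)

Lemma set_closure_incl (X : HilbertSpace) (D : X -> Prop) u :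
  D u -> set_closure D u.
Proof.
intros h eps; exists u; split; [exact h|].
replace (norm (minus u u)) with 0; [apply cond_pos|].
symmetry; transitivity (norm (zero : X)); [f_equal; vec|apply norm_zero_H].
Qed.

Lemma range_subspace (X Y : HilbertSpace) (E : X -> Y) : is_linear E ->
  subspace (fun v => exists u, E u = v).
Proof.
intros hE; split; [|split].
- exists zero; now apply lin_zero.
- intros x y [u <-] [v <-]; exists (plus u v); apply (linear_plus _ hE).
- intros c x [u <-]; exists (scal c u); apply (linear_scal _ hE).
Qed.

Theorem proposition6p8 :
  forall (H K : HilbertSpace) (F : frame H K) (G : rigging F)
    (H0 : operator H) (J : R -> K -> K),
  self_adjoint H0 ->
  (forall r, bounded_self_adjoint (J r)) ->
  (forall x, J 0 x = zero) ->
  norm_continuous J ->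
  piecewise_analytic J ->
  forall (r lam : R) (s : R) (a : H_plus G -> H_minus G),
  let Hr := perturbed H0 F (J r) in
  let Er := evaluation G Hr lam in
  let E0 := evaluation G H0 lam in
  let Dr := evaluation_range G Hr lam in
  let D0 := evaluation_range G H0 lam in
  in_Lambda Hr F lam ->
  in_Lambda H0 F lam ->
  s = 1 \/ s = -1 ->
  is_wave_limit G Hr H0 lam s a ->
  exists w : l2 -> l2 -> C,
    (forall f g, w (Er f) (E0 g) = pairing G f (a g)) /\
    densely_defined_form (fibre G Hr lam) (fibre G H0 lam) Dr D0 w /\
    Rbar_le (form_norm Dr D0 w) 1.
Proof.
intros H K F G H0 J hH0 hJ _ _ _ r lam s a Hr Er E0 Dr D0 hLr hL0 hs ha.
assert (hHr : self_adjoint Hr).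
{ apply (perturbation_self_adjoint H H0 hH0).
  apply sandwiched_self_adjoint; [apply frame_linear|apply hJ]. }
pose proof (evaluation_linear H K F G Hr lam hHr hLr) as lEr.
pose proof (evaluation_linear H K F G H0 lam hH0 hL0) as lE0.
pose proof (proj1 ha) as la.
destruct (wave_form_exists H K F G Hr H0 lam s a hHr hH0 hLr hL0 hs ha)
  as [w hw].
exists w; split; [exact hw|]; split.
- split; [exact (range_subspace _ _ _ lEr)|].
  split; [exact (range_subspace _ _ _ lE0)|].
  split; [intros u hu; exact (set_closure_incl l2 Dr u hu)|].
  split; [intros u hu; exact (set_closure_incl l2 D0 u hu)|].
  (* Density is immediate: each fibre is by definition the closure of the range. *)
  split; [intros u hu; exact hu|]; split; [intros u hu; exact hu|].
  split; [|split; [|split]].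
  + intros u u' v [f <-] [f' <-] [g <-].
    rewrite <- (linear_plus _ lEr), !hw; apply pairing_plus_l.
  + intros c u v [f <-] [g <-].
    rewrite <- (linear_scal _ lEr), !hw; apply pairing_scal_l.
  + intros u v v' [f <-] [g <-] [g' <-].
    rewrite <- (linear_plus _ lE0), !hw, (linear_plus _ la); apply pairing_plus_r.
  + intros c u v [f <-] [g <-].
    rewrite <- (linear_scal _ lE0), !hw, (linear_scal _ la); apply pairing_scal_r.
- apply Lub_Rbar_correct.
  intros c [u [v [[f <-] [[g <-] [hu [hv ->]]]]]]; simpl.
  rewrite hw; eapply Rle_trans;
    [exact (wave_pairing_bound H K F G Hr H0 lam s a hHr hH0 hLr hL0 hs ha f g)|].
  pose proof (norm_pos _ (evaluation G Hr lam f)).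
  pose proof (norm_pos _ (evaluation G H0 lam g)).
  rewrite <- (Rmult_1_l 1); now apply Rmult_le_compat.
Qed.
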